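(* Let $R$ be a discrete valuation ring with uniformizing parameter $t$ and residue field $K=R/(t)$. For any positive real number $c<\pi$, the stable category of the Frobenius category $\mathcal{F}_c$ is equivalent to the category $\mathcal{C}_c$ over $K$.
   Context: $S^1=\mathbb{R}/2\pi\mathbb{Z}$, and for $x\in\mathbb{R}$ the class of $x$ in $S^1$ is $[x]$. A representation $V$ of $S^1$ over $R$ consists of an $R$-module $V[x]$ for every $[x]\in S^1$ and an $R$-linear map $V^{(x,\alpha)}:V[x]\to V[x-\alpha]$ for every $[x]\in S^1$ and real $\alpha\ge 0$ (depending only on $[x]$ and $\alpha$), such that $V^{(x-\beta,\alpha)}\circ V^{(x,\beta)}=V^{(x,\alpha+\beta)}$ for all $\alpha,\beta\ge 0$, and $V^{(x,2\pi n)}:V[x]\to V[x]$ is multiplication by $t^n$ for all $n\in\mathbb{N}$. A morphism $f:V\to W$ is a family of $R$-linear maps $f_{[x]}:V[x]\to W[x]$ with $W^{(x,\alpha)}f_{[x]}=f_{[x-\alpha]}V^{(x,\alpha)}$. Monomorphisms, epimorphisms, exactness and direct sums are taken pointwise; a representation is projective if morphisms from it lift through all epimorphisms. $P_{[x]}$ is the representation with $P_{[x]}[x-\alpha]=Re_x^\alpha$ free on one generator $e_x^\alpha$ for $0\le\alpha<2\pi$; for $n\in\mathbb{N}$ put $e_x^{\gamma+2\pi n}:=t^ne_x^\gamma$; write $e_x=e_x^0$; the structure maps are $P_{[x]}^{(x-\alpha,\beta)}(e_x^\alpha)=e_x^{\alpha+\beta}$. A representation is finitely generated if it is a quotient of a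 finite direct sum of representations $P_{[x_i]}$. $\mathcal{P}_{S^1}$ is the category of all finitely generated projective representations of $S^1$ over $R$; every object of it is isomorphic to a finite direct sum $\bigoplus P_{[x_i]}$. The category $\mathcal{F}_\pi$: objects are pairs $(V,d)$ with $V\in\mathcal{P}_{S^1}$ and $d:V\to V$ an endomorphism with $d^2=t$ (multiplication by $t$); morphisms $(V,d)\to(W,d)$ are morphisms $f:V\to W$ with $fd=df$. Exact sequences in $\mathcal{F}_\pi$ are the sequences $(X,d)\xrightarrow{f}(Y,d)\xrightarrow{g}(Z,d)$ such that $0\to X\xrightarrow{f}Y\xrightarrow{g}Z\to 0$ is exact (hence split exact) in $\mathcal{P}_{S^1}$. Depth: for nonzero $f:P_{[x]}\to P_{[y]}$, the depth $\delta(f)$ is the unique real $\alpha\ge0$ with $f(e_x)=ue_y^\alpha$ for a unit $u\in R$; $\delta(0)=\infty$. For $f:\bigoplus_iP_{[x_i]}\to\bigoplus_jP_{[y_j]}$ with components $f_{ji}$, $\delta(f)=\min\delta(f_{ji})$ (independent of the decompositions). $\mathcal{F}_c$ is the full subcategory of $\mathcal{F}_\pi$ whose objects are all $(V,d)$ with $\delta(d)\ge\pi-c$; its exact sequences are those of $\mathcal{F}_\pi$ with all terms in $\mathcal{F}_c$. It is a Frobenius category. Its stable category has the same objects, with morphism sets taken modulo morphisms factoring through projective-injective objects of $\mathcal{F}_c$. $\mathcal{C}_c$: put $\phi(x)=x+\pi-c$ for $x\in\mathbb{R}$. $\mathcal{C}_c$ is the additive category (formal finite direct sums, matrices of morphisms)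 generated by the following $K$-category. Objects: ordered pairs of points $(x_0,x_1)$ in $S^1$ such that (for suitable real representatives) $x_0\le\phi(x_0)\le x_1\le\phi^{-1}(x_0+2\pi)$. Morphisms: for $X=(x_0,x_1)$, $Y=(y_0,y_1)$, $\mathcal{C}_c(X,Y)$ is the one-dimensional space $Kb_+^{XY}$ if the elements of $X,Y$ lift to real numbers with $x_0\le y_0<\phi^{-1}(x_1)\le x_1\le y_1<\phi^{-1}(x_0+2\pi)$; it is the one-dimensional space $Kb_-^{XY}$ if they lift to real numbers with $x_0\le y_1<\phi^{-1}(x_1)\le x_1\le y_0+2\pi<\phi^{-1}(x_0+2\pi)$; it is $0$ if the elements of $X,Y$ do not lift to such real numbers. Composition: $rb_\epsilon^{YZ}\circ sb_{\epsilon'}^{XY}=rs\,b_{\epsilon\epsilon'}^{XZ}$ if $\mathcal{C}_c(X,Z)=Kb_{\epsilon\epsilon'}^{XZ}$, and $0$ otherwise ($r,s\in K$, $\epsilon,\epsilon'\in\{+,-\}$). *)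

(* Defs.v *)
From HB Require Import structures.
From mathcomp Require Import all_boot all_order all_algebra generic_quotient ring_quotient.
From mathcomp Require Import archimedean.
From mathcomp Require Import boolp classical_sets reals constructive_ereal ereal trigo.
From mathcomp Require Import ring lra.

Set Implicit Arguments.
Unset Strict Implicit.
Unset Printing Implicit Defensive.

Import Order.TTheory GRing.Theory Num.Theory.
Local Open Scope ring_scope.

Section ValuationRing.
Variable R : idomainType.

Definition is_ideal (I : R -> Prop) : Prop :=
  [/\ I 0, forall a b, I a -> I b -> I (a + b) & forall r a, I a -> I (r * a)].

Definition principal (a : R) : R -> Prop := fun b => exists r, b = r * a.

Definition is_maximal (M : R -> Prop) : Prop :=
  [/\ is_ideal M, ~ M 1 &
      forall J : R -> Prop, is_ideal J -> ~ J 1 ->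
        (forall a, M a -> J a) -> forall a, J a -> M a].

(* A local principal ideal domain that is not a field. *)
Definition is_dvr : Prop :=
  [/\ forall I, is_ideal I -> exists a, forall b, I b <-> principal a b,
      exists M, is_maximal M,
      forall M N, is_maximal M -> is_maximal N -> forall a, M a <-> N a &
      exists a : R, a != 0 /\ a \isn't a GRing.unit].

Definition is_uniformizer (t : R) : Prop := is_maximal (principal t).

(* [K] is [R / (t)], presented by its quotient map. *)
Definition is_residue_field (t : R) (K : fieldType) (q : {rmorphism R -> K})
    : Prop :=
  (forall k, exists a, q a = k) /\ (forall a, q a = 0 <-> principal t a).

End ValuationRing.

(* An [A]-linear category. Hom-sets are setoids: equality of morphisms is [heq], which lets a quotient
   category keep the morphisms of the original one. *)
Record lincat (A : comNzRingType) := LinCat {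
  obj :> Type;
  hom : obj -> obj -> Type;
  heq : forall X Y, hom X Y -> hom X Y -> Prop;
  hid : forall X, hom X X;
  hcomp : forall X Y Z, hom Y Z -> hom X Y -> hom X Z;
  hzero : forall X Y, hom X Y;
  hadd : forall X Y, hom X Y -> hom X Y -> hom X Y;
  hopp : forall X Y, hom X Y -> hom X Y;
  hscale : forall X Y, A -> hom X Y -> hom X Y;
  heq_refl : forall X Y (f : hom X Y), heq f f;
  heq_sym : forall X Y (f g : hom X Y), heq f g -> heq g f;
  heq_trans : forall X Y (f g h : hom X Y), heq f g -> heq g h -> heq f h;
  hcomp_eq : forall X Y Z (f f' : hom Y Z) (g g' : hom X Y),
    heq f f' -> heq g g' -> heq (hcomp f g) (hcomp f' g');
  hadd_eq : forall X Y (f f' g g' : hom X Y),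
    heq f f' -> heq g g' -> heq (hadd f g) (hadd f' g');
  hscale_eq : forall X Y a (f f' : hom X Y),
    heq f f' -> heq (hscale a f) (hscale a f');
  hcompA : forall X Y Z W (f : hom Z W) (g : hom Y Z) (h : hom X Y),
    heq (hcomp f (hcomp g h)) (hcomp (hcomp f g) h);
  hcomp1l : forall X Y (f : hom X Y), heq (hcomp (hid Y) f) f;
  hcomp1r : forall X Y (f : hom X Y), heq (hcomp f (hid X)) f;
  haddA : forall X Y (f g h : hom X Y),
    heq (hadd f (hadd g h)) (hadd (hadd f g) h);
  haddC : forall X Y (f g : hom X Y), heq (hadd f g) (hadd g f);
  hadd0 : forall X Y (f : hom X Y), heq (hadd (hzero X Y) f) f;
  haddN : forall X Y (f : hom X Y), heq (hadd (hopp f) f) (hzero X Y);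
  hscaleA : forall X Y a b (f : hom X Y),
    heq (hscale a (hscale b f)) (hscale (a * b) f);
  hscale1 : forall X Y (f : hom X Y), heq (hscale 1 f) f;
  hscaleDr : forall X Y a (f g : hom X Y),
    heq (hscale a (hadd f g)) (hadd (hscale a f) (hscale a g));
  hscaleDl : forall X Y a b (f : hom X Y),
    heq (hscale (a + b) f) (hadd (hscale a f) (hscale b f));
  hcompDl : forall X Y Z (f f' : hom Y Z) (g : hom X Y),
    heq (hcomp (hadd f f') g) (hadd (hcomp f g) (hcomp f' g));
  hcompDr : forall X Y Z (f : hom Y Z) (g g' : hom X Y),
    heq (hcomp f (hadd g g')) (hadd (hcomp f g) (hcomp f g'));
  hcompZl : forall X Y Z a (f : hom Y Z) (g : hom X Y),
    heq (hcomp (hscale a f) g) (hscale a (hcomp f g));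
  hcompZr : forall X Y Z a (f : hom Y Z) (g : hom X Y),
    heq (hcomp f (hscale a g)) (hscale a (hcomp f g))
}.

Arguments hid {A C} X : rename.
Arguments hzero {A C} X Y : rename.

Notation "f =~ g" := (heq f g) (at level 70, no associativity).

Section LinCatTheory.
Variables (A : comNzRingType) (C : lincat A).
Implicit Types X Y Z : C.

Lemma heq_addI X Y (f g h : hom X Y) : hadd f g =~ hadd f h -> g =~ h.
Proof.
move=> e; have aux (k : hom X Y) : k =~ hadd (hopp f) (hadd f k).
  apply: heq_sym; apply: heq_trans (haddA _ _ _) _.
  by apply: heq_trans (hadd0 k); apply: hadd_eq (haddN _) (heq_refl _).
apply: heq_trans (aux g) _; apply: heq_trans (heq_sym (aux h)).
exact: hadd_eq (heq_refl _) e.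
Qed.

Lemma hadd0r X Y (f : hom X Y) : hadd f (hzero X Y) =~ f.
Proof. exact: heq_trans (haddC _ _) (hadd0 _). Qed.

Lemma haddI0 X Y (f : hom X Y) : hadd f f =~ f -> f =~ hzero X Y.
Proof.
by move=> e; apply: (@heq_addI _ _ f); apply: heq_trans e (heq_sym (hadd0r _)).
Qed.

Lemma hcomp0l X Y Z (g : hom X Y) : hcomp (hzero Y Z) g =~ hzero X Z.
Proof.
apply: haddI0; apply: heq_trans (heq_sym (hcompDl _ _ _)) _.
exact: hcomp_eq (hadd0 _) (heq_refl _).
Qed.

Lemma hcomp0r X Y Z (g : hom Y Z) : hcomp g (hzero X Y) =~ hzero X Z.
Proof.
apply: haddI0; apply: heq_trans (heq_sym (hcompDr _ _ _)) _.
exact: hcomp_eq (heq_refl _) (hadd0 _).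
Qed.

Lemma hscale0r X Y a : hscale a (hzero X Y) =~ hzero X Y.
Proof.
apply: haddI0; apply: heq_trans (heq_sym (hscaleDr _ _ _)) _.
exact: hscale_eq (hadd0 _).
Qed.

Lemma hscale0l X Y (f : hom X Y) : hscale 0 f =~ hzero X Y.
Proof.
apply: haddI0; apply: heq_trans (heq_sym (hscaleDl _ _ _)) _.
by rewrite addr0; apply: heq_refl.
Qed.

Lemma hopp_uniq X Y (f g : hom X Y) : hadd f g =~ hzero X Y -> g =~ hopp f.
Proof.
move=> e; apply: (@heq_addI _ _ f); apply: heq_trans e _.
by apply: heq_sym; apply: heq_trans (haddC _ _) (haddN _).
Qed.

Lemma hoppZ X Y (f : hom X Y) : hscale (- 1) f =~ hopp f.
Proof.
apply: hopp_uniq.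
apply: heq_trans (hadd_eq (heq_sym (hscale1 f)) (heq_refl _)) _.
apply: heq_trans (heq_sym (hscaleDl _ _ _)) _.
by rewrite subrr; apply: hscale0l.
Qed.

Lemma hopp_eq X Y (f g : hom X Y) : f =~ g -> hopp f =~ hopp g.
Proof.
move=> e; apply: heq_trans (heq_sym (hoppZ _)) _.
exact: heq_trans (hscale_eq _ e) (hoppZ _).
Qed.

Lemma haddACA X Y (f g h k : hom X Y) :
  hadd (hadd f g) (hadd h k) =~ hadd (hadd f h) (hadd g k).
Proof.
apply: heq_trans (heq_sym (haddA _ _ _)) _.
apply: heq_trans (haddA _ _ _).
apply: hadd_eq (heq_refl _) _.
apply: heq_trans (haddA _ _ _) _.
apply: heq_trans (heq_sym (haddA _ _ _)).
exact: hadd_eq (haddC _ _) (heq_refl _).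
Qed.

(* The condition on [hscale] follows from stability under composition. *)
Record lin_ideal := LinIdeal {
  inI : forall X Y, hom X Y -> Prop;
  inI_eq : forall X Y (f g : hom X Y), f =~ g -> inI f -> inI g;
  inI0 : forall X Y, inI (hzero X Y);
  inID : forall X Y (f g : hom X Y), inI f -> inI g -> inI (hadd f g);
  inIl : forall X Y Z (f : hom Y Z) (g : hom X Y), inI g -> inI (hcomp f g);
  inIr : forall X Y Z (f : hom Y Z) (g : hom X Y), inI f -> inI (hcomp f g)
}.

Section Quotient.
Variable I : lin_ideal.

Definition qeq X Y (f g : hom X Y) : Prop := inI I (hadd f (hopp g)).

Lemma inIZ X Y a (f : hom X Y) : inI I f -> inI I (hscale a f).
Proof.
move=> If; apply: inI_eq (inIl (hscale a (hid Y)) If).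
by apply: heq_trans (hcompZl _ _ _) _; apply: hscale_eq (hcomp1l _).
Qed.

Lemma qeq_heq X Y (f g : hom X Y) : f =~ g -> qeq f g.
Proof.
move=> e; apply: inI_eq (inI0 _ _ _); apply: heq_sym.
apply: heq_trans (hadd_eq e (heq_refl _)) _.
exact: heq_trans (haddC _ _) (haddN _).
Qed.

Lemma qeqP X Y (f g : hom X Y) :
  qeq f g <-> exists2 n, inI I n & f =~ hadd n g.
Proof.
split=> [h|[n In e]].
  exists (hadd f (hopp g)) => //; apply: heq_sym.
  apply: heq_trans (heq_sym (haddA _ _ _)) _.
  exact: heq_trans (hadd_eq (heq_refl _) (haddN _)) (hadd0r _).
apply: inI_eq In; apply: heq_sym.
apply: heq_trans (hadd_eq e (heq_refl _)) _.
apply: heq_trans (heq_sym (haddA _ _ _)) _.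
apply: heq_trans (hadd_eq (heq_refl _) _) (hadd0r _).
exact: heq_trans (haddC _ _) (haddN _).
Qed.

Lemma qeq_sym X Y (f g : hom X Y) : qeq f g -> qeq g f.
Proof.
move=> /qeqP[n In e]; apply/qeqP; exists (hscale (- 1) n); first exact: inIZ.
apply: heq_sym.
apply: heq_trans (hadd_eq (hoppZ _) e) _.
apply: heq_trans (haddA _ _ _) _.
exact: heq_trans (hadd_eq (haddN _) (heq_refl _)) (hadd0 _).
Qed.

Lemma qeq_trans X Y (f g h : hom X Y) : qeq f g -> qeq g h -> qeq f h.
Proof.
move=> /qeqP[n In e] /qeqP[m Im e']; apply/qeqP; exists (hadd n m).
  exact: inID.
apply: heq_trans e _; apply: heq_trans (haddA _ _ _).
exact: hadd_eq (heq_refl _) e'.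
Qed.

Lemma qcomp_eq X Y Z (f f' : hom Y Z) (g g' : hom X Y) :
  qeq f f' -> qeq g g' -> qeq (hcomp f g) (hcomp f' g').
Proof.
move=> /qeqP[n In e] /qeqP[m Im e']; apply: (@qeq_trans _ _ _ (hcomp f' g)).
  apply/qeqP; exists (hcomp n g); first exact: inIr.
  by apply: heq_trans (hcompDl _ _ _); apply: hcomp_eq (heq_refl _).
apply/qeqP; exists (hcomp f' m); first exact: inIl.
by apply: heq_trans (hcompDr _ _ _); apply: hcomp_eq (heq_refl _) _.
Qed.

Lemma qadd_eq X Y (f f' g g' : hom X Y) :
  qeq f f' -> qeq g g' -> qeq (hadd f g) (hadd f' g').
Proof.
move=> /qeqP[n In e] /qeqP[m Im e']; apply/qeqP; exists (hadd n m).
  exact: inID.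
by apply: heq_trans (haddACA _ _ _ _); apply: hadd_eq.
Qed.

Lemma qscale_eq X Y a (f f' : hom X Y) :
  qeq f f' -> qeq (hscale a f) (hscale a f').
Proof.
move=> /qeqP[n In e]; apply/qeqP; exists (hscale a n); first exact: inIZ.
by apply: heq_trans (hscaleDr _ _ _); apply: hscale_eq.
Qed.

Definition quotient_cat : lincat A.
Proof.
refine (@LinCat A (obj C) (@hom A C) qeq (@hid A C) (@hcomp A C) (@hzero A C)
  (@hadd A C) (@hopp A C) (@hscale A C)
  _ qeq_sym qeq_trans qcomp_eq qadd_eq qscale_eq
  _ _ _ _ _ _ _ _ _ _ _ _ _ _ _) => *; apply: qeq_heq;
  do ?[exact: heq_refl | exact: hcompA | exact: hcomp1l | exact: hcomp1r
      | exact: haddA | exact: haddC | exact: hadd0 | exact: haddN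
      | exact: hscaleA | exact: hscale1 | exact: hscaleDr | exact: hscaleDl
      | exact: hcompDl | exact: hcompDr | exact: hcompZl | exact: hcompZr].
Defined.

End Quotient.

Definition full_subcat (P : C -> Prop) : lincat A.
Proof.
by refine (@LinCat A (sig P) (fun X Y : sig P => hom (sval X) (sval Y))
  (fun X Y : sig P => @heq A C _ _) (fun X : sig P => hid (sval X))
  (fun X Y Z : sig P => @hcomp A C _ _ _) (fun X Y : sig P => hzero _ _)
  (fun X Y : sig P => @hadd A C _ _) (fun X Y : sig P => @hopp A C _ _)
  (fun X Y : sig P => @hscale A C _ _)
  _ _ _ _ _ _ _ _ _ _ _ _ _ _ _ _ _ _ _ _ _); move=> *;
  do ?[exact: heq_refl | exact: heq_sym | exact: heq_trans; eassumption
      | exact: hcomp_eq | exact: hadd_eq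
      | exact: hscale_eq | exact: hcompA | exact: hcomp1l | exact: hcomp1r
      | exact: haddA | exact: haddC | exact: hadd0 | exact: haddN
      | exact: hscaleA | exact: hscale1 | exact: hscaleDr | exact: hscaleDl
      | exact: hcompDl | exact: hcompDr | exact: hcompZl | exact: hcompZr
      | apply: heq_trans; eassumption].
Defined.

Definition has_biproducts : Prop :=
  (exists Z : C, hid Z =~ hzero Z Z) /\
  (forall X Y, exists (S : C) (i : hom X S) (j : hom Y S)
                      (p : hom S X) (q : hom S Y),
     [/\ hcomp p i =~ hid X, hcomp q j =~ hid Y,
         hcomp p j =~ hzero Y X, hcomp q i =~ hzero X Y &
         hadd (hcomp i p) (hcomp j q) =~ hid S]).

(* [exact_seq f g] stands for the short exact sequences of an exact structure. *)
Section Stable.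
Variable exact_seq : forall X Y Z, hom X Y -> hom Y Z -> Prop.

Definition projective_obj (P : C) : Prop :=
  forall X Y Z (f : hom X Y) (g : hom Y Z), exact_seq f g ->
  forall h : hom P Z, exists k : hom P Y, hcomp g k =~ h.

Definition injective_obj (Q : C) : Prop :=
  forall X Y Z (f : hom X Y) (g : hom Y Z), exact_seq f g ->
  forall h : hom X Q, exists k : hom Y Q, hcomp k f =~ h.

Definition projective_injective (P : C) : Prop :=
  projective_obj P /\ injective_obj P.

Definition factors_projinj X Y (f : hom X Y) : Prop :=
  exists (P : C) (a : hom X P) (b : hom P Y),
    projective_injective P /\ hcomp b a =~ f.

Hypothesis biC : has_biproducts.

Lemma factors_eq X Y (f g : hom X Y) :
  f =~ g -> factors_projinj f -> factors_projinj g.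
Proof.
by move=> e [P [a [b [Pp h]]]]; exists P, a, b; split=> //; apply: heq_trans e.
Qed.

Lemma factors0 X Y : factors_projinj (hzero X Y).
Proof.
have [[Z Z0] _] := biC; exists Z, (hzero X Z), (hzero Z Y).
split; last exact: hcomp0l.
split=> U V W f g _ h.
  exists (hzero Z V); apply: heq_trans (hcomp0r _ _) _.
  apply: heq_trans (hcomp1r h); apply: heq_sym.
  by apply: heq_trans (hcomp_eq (heq_refl h) Z0) (hcomp0r _ _).
exists (hzero V Z); apply: heq_trans (hcomp0l _ _) _.
apply: heq_trans (hcomp1l h); apply: heq_sym.
by apply: heq_trans (hcomp_eq Z0 (heq_refl h)) (hcomp0l _ _).
Qed.

Lemma factorsD X Y (f g : hom X Y) :
  factors_projinj f -> factors_projinj g -> factors_projinj (hadd f g).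
Proof.
move=> [P [a [b [[Pp Pi] ef]]]] [Q [c [d [[Qp Qi] eg]]]].
have [_ /(_ P Q)[S [i [j [p [q [pi1 qj1 pj0 qi0 e1]]]]]]] := biC.
exists S, (hadd (hcomp i a) (hcomp j c)), (hadd (hcomp b p) (hcomp d q)).
split; last first.
  have aux (T U V : C) (x : hom U V) (r : hom S U) (s : hom T S) (y : hom X T) w :
      hcomp r s =~ w -> hcomp (hcomp x r) (hcomp s y) =~ hcomp x (hcomp w y).
    move=> e; apply: heq_trans (heq_sym (hcompA _ _ _)) _.
    apply: hcomp_eq (heq_refl _) _; apply: heq_trans (hcompA _ _ _) _.
    exact: hcomp_eq e (heq_refl _).
  apply: heq_trans (hcompDl _ _ _) _.
  apply: hadd_eq; apply: heq_trans (hcompDr _ _ _) _.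
    apply: heq_trans (hadd0r _); apply: hadd_eq.
      apply: heq_trans (aux _ _ _ _ _ _ _ _ pi1) _; apply: heq_trans ef.
      exact: hcomp_eq (heq_refl _) (hcomp1l _).
    apply: heq_trans (aux _ _ _ _ _ _ _ _ pj0) _.
    apply: heq_trans (hcomp0r _ b).
    exact: hcomp_eq (heq_refl _) (hcomp0l _ _).
  apply: heq_trans (hadd0 _); apply: hadd_eq.
    apply: heq_trans (aux _ _ _ _ _ _ _ _ qi0) _.
    apply: heq_trans (hcomp0r _ d).
    exact: hcomp_eq (heq_refl _) (hcomp0l _ _).
  apply: heq_trans (aux _ _ _ _ _ _ _ _ qj1) _; apply: heq_trans eg.
  exact: hcomp_eq (heq_refl _) (hcomp1l _).
split=> U V W u v E h.
  have [k ek] := Pp _ _ _ _ _ E (hcomp h i).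
  have [l el] := Qp _ _ _ _ _ E (hcomp h j).
  exists (hadd (hcomp k p) (hcomp l q)).
  apply: heq_trans (hcompDr _ _ _) _.
  apply: heq_trans (hcomp1r h).
  apply: heq_trans (hcomp_eq (heq_refl h) e1).
  apply: heq_trans (heq_sym (hcompDr _ _ _)).
  by apply: hadd_eq; apply: heq_trans (hcompA _ _ _) _;
     apply: heq_trans (heq_sym (hcompA _ _ _)); apply: hcomp_eq (heq_refl _).
have [k ek] := Pi _ _ _ _ _ E (hcomp p h).
have [l el] := Qi _ _ _ _ _ E (hcomp q h).
exists (hadd (hcomp i k) (hcomp j l)).
apply: heq_trans (hcompDl _ _ _) _.
apply: heq_trans (hcomp1l h).
apply: heq_trans (hcomp_eq e1 (heq_refl h)).
apply: heq_trans (heq_sym (hcompDl _ _ _)).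
by apply: hadd_eq; apply: heq_trans (heq_sym (hcompA _ _ _)) _;
   apply: heq_trans (hcompA _ _ _); apply: hcomp_eq (heq_refl _) _.
Qed.

Lemma factorsl X Y Z (f : hom Y Z) (g : hom X Y) :
  factors_projinj g -> factors_projinj (hcomp f g).
Proof.
move=> [P [a [b [Pp h]]]]; exists P, a, (hcomp f b); split=> //.
apply: heq_trans (heq_sym (hcompA _ _ _)) _.
exact: hcomp_eq (heq_refl _) h.
Qed.

Lemma factorsr X Y Z (f : hom Y Z) (g : hom X Y) :
  factors_projinj f -> factors_projinj (hcomp f g).
Proof.
move=> [P [a [b [Pp h]]]]; exists P, (hcomp a g), b; split=> //.
apply: heq_trans (hcompA _ _ _) _.
exact: hcomp_eq h (heq_refl _).
Qed.

Definition projinj_ideal : lin_ideal :=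
  LinIdeal factors_eq factors0 factorsD factorsl factorsr.

Definition stable_cat : lincat A := quotient_cat projinj_ideal.

End Stable.
End LinCatTheory.

Section Equivalence.
Variable A : comNzRingType.

Record lin_functor (C D : lincat A) := LinFunctor {
  fobj :> C -> D;
  fmap : forall X Y : C, hom X Y -> hom (fobj X) (fobj Y);
  fmap_eq : forall X Y (f g : hom X Y), f =~ g -> fmap f =~ fmap g;
  fmap1 : forall X, fmap (hid X) =~ hid (fobj X);
  fmapM : forall X Y Z (f : hom Y Z) (g : hom X Y),
    fmap (hcomp f g) =~ hcomp (fmap f) (fmap g);
  fmapD : forall X Y (f g : hom X Y), fmap (hadd f g) =~ hadd (fmap f) (fmap g);
  fmapZ : forall X Y a (f : hom X Y), fmap (hscale a f) =~ hscale a (fmap f)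
}.

Definition id_functor (C : lincat A) : lin_functor C C.
Proof.
by refine (@LinFunctor C C id (fun X Y f => f) _ _ _ _ _) => * //;
  apply: heq_refl.
Defined.

Definition comp_functor (C D E : lincat A)
  (G : lin_functor D E) (F : lin_functor C D) : lin_functor C E.
Proof.
refine (@LinFunctor C E (fun X => G (F X)) (fun X Y f => fmap G (fmap F f))
  _ _ _ _ _) => *.
- by do 2!apply: fmap_eq.
- exact: heq_trans (fmap_eq _ (fmap1 _ _)) (fmap1 _ _).
- exact: heq_trans (fmap_eq _ (fmapM _ _ _)) (fmapM _ _ _).
- exact: heq_trans (fmap_eq _ (fmapD _ _ _)) (fmapD _ _ _).
- exact: heq_trans (fmap_eq _ (fmapZ _ _ _)) (fmapZ _ _ _).
Defined.

Definition naturally_isomorphic (C D : lincat A) (F G : lin_functor C D) : Prop :=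
  exists (eta : forall X : C, hom (F X) (G X))
         (eta' : forall X : C, hom (G X) (F X)),
    [/\ forall X, hcomp (eta' X) (eta X) =~ hid (F X),
        forall X, hcomp (eta X) (eta' X) =~ hid (G X) &
        forall X Y (f : hom X Y),
          hcomp (eta Y) (fmap F f) =~ hcomp (fmap G f) (eta X)].

Definition equivalent (C D : lincat A) : Prop :=
  exists (F : lin_functor C D) (G : lin_functor D C),
    naturally_isomorphic (comp_functor G F) (id_functor C) /\
    naturally_isomorphic (comp_functor F G) (id_functor D).

End Equivalence.

Definition restrict_scalars (A B : comNzRingType) (q : {rmorphism A -> B})
  (C : lincat B) : lincat A.
Proof.
refine (@LinCat A (obj C) (@hom B C) (@heq B C) (@hid B C) (@hcomp B C)
  (@hzero B C) (@hadd B C) (@hopp B C)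
  (fun X Y a f => hscale (q a) f)
  (@heq_refl B C) (@heq_sym B C) (@heq_trans B C) (@hcomp_eq B C)
  (@hadd_eq B C) (fun X Y a => @hscale_eq B C X Y (q a))
  (@hcompA B C) (@hcomp1l B C) (@hcomp1r B C) (@haddA B C) (@haddC B C)
  (@hadd0 B C) (@haddN B C) _ _ (fun X Y a => @hscaleDr B C X Y (q a)) _
  (@hcompDl B C) (@hcompDr B C)
  (fun X Y Z a => @hcompZl B C X Y Z (q a))
  (fun X Y Z a => @hcompZr B C X Y Z (q a))) => *.
- by rewrite rmorphM; apply: hscaleA.
- by rewrite rmorph1; apply: hscale1.
- by rewrite rmorphD; apply: hscaleDl.
Defined.

Section Circle.
Variable RR : realType.

Definition full_turns : {pred RR} :=
  fun x => `[< exists k : int, x = k%:~R * (2 * pi) >].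

Lemma full_turns_zmod_closed : zmod_closed full_turns.
Proof.
split; first by apply/asboolP; exists 0; rewrite mul0r.
move=> _ _ /asboolP[k ->] /asboolP[l ->].
by apply/asboolP; exists (k - l); rewrite rmorphB mulrBl.
Qed.

HB.instance Definition _ :=
  GRing.isZmodClosed.Build RR full_turns full_turns_zmod_closed.

Definition circle : Type := Quotient.quot full_turns.
HB.instance Definition _ := GRing.Zmodule.on circle.
HB.instance Definition _ := Quotient.on circle.

Definition cls (x : RR) : circle := \pi_(circle)%qT x.

Lemma clsP x y : cls x = cls y <-> exists k : int, x - y = k%:~R * (2 * pi).
Proof.
split=> [/eqP|h]; last apply/eqP.
  by rewrite /cls -Quotient.idealrBE => /asboolP.
by rewrite /cls -Quotient.idealrBE; apply/asboolP.
Qed.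

Lemma clsB x y : cls (x - y) = cls x - cls y.
Proof. exact: (raddfB (\pi_(Quotient.quot full_turns))%qT). Qed.

Lemma cls0 : cls 0 = 0.
Proof. by rewrite -(subrr 0) clsB subrr. Qed.

Lemma clsD x y : cls (x + y) = cls x + cls y.
Proof. by rewrite -{1}[y]opprK clsB -[- y]sub0r clsB cls0 sub0r opprK. Qed.

Lemma clsM2pi (k : int) : cls (k%:~R * (2 * pi)) = 0.
Proof. by rewrite -cls0; apply/clsP; exists k; rewrite subr0. Qed.

Lemma twopi_gt0 : 0 < 2 * pi :> RR.
Proof. by rewrite mulr_gt0 ?pi_gt0. Qed.

(* The representative of a point in [0, 2 pi[ *)
Definition ang (p : circle) : RR :=
  repr p - (Num.floor (repr p / (2 * pi)))%:~R * (2 * pi).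

Lemma angK p : cls (ang p) = p.
Proof. by rewrite /ang clsB clsM2pi subr0 /cls reprK. Qed.

Lemma ang_itv p : 0 <= ang p < 2 * pi.
Proof.
have /andP[h1 h2] := floor_itv (repr p / (2 * pi)).
move: h1 h2; rewrite ler_pdivlMr ?twopi_gt0// ltr_pdivrMr ?twopi_gt0// /ang.
by rewrite rmorphD mulrDl mul1r; move=> ? ?; apply/andP; split; lra.
Qed.

Lemma cls_inj_itv x y : cls x = cls y -> `|x - y| < 2 * pi -> x = y.
Proof.
move=> /clsP[k e]; rewrite e normrM (gtr0_norm twopi_gt0).
rewrite -[X in _ < X]mul1r ltr_pM2r ?twopi_gt0//.
rewrite -intr_norm (ltr_int _ _ 1) => k0.
have {}k0 : k = 0 by case: k k0 {e} => [[|n]|n].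
by move/eqP: e; rewrite k0 mul0r subr_eq0 => /eqP.
Qed.

(* [arc p q a] : moving by [a >= 0] from [p] in the negative direction ends
   at [q]; the structure maps below are indexed by such triples, so that no
   transport along equalities of points is needed. *)
Definition arc (p q : circle) (a : RR) : bool := (0 <= a) && (q == p - cls a).

Lemma arc_ge0 p q a : arc p q a -> 0 <= a. Proof. by case/andP. Qed.

Lemma arc_end p q a : arc p q a -> q = p - cls a.
Proof. by case/andP=> _ /eqP. Qed.

Lemma arc_trans p q r a b : arc p q a -> arc q r b -> arc p r (a + b).
Proof.
move=> /andP[a0 /eqP->] /andP[b0 /eqP->].
by rewrite /arc addr_ge0// clsD opprD addrA eqxx.
Qed.

End Circle.

Section Representations.
Variables (RR : realType) (R : idomainType) (t : R).
Local Notation circle := (circle RR).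

Record rep := Rep {
  rmod :> circle -> lmodType R;
  rmap : forall (p q : circle) (a : RR), arc p q a -> {linear rmod p -> rmod q};
  rmapD : forall p q r a b (hb : arc p q b) (ha : arc q r a)
    (hab : arc p r (a + b)) v, rmap ha (rmap hb v) = rmap hab v;
  rmap_turns : forall p n (h : arc p p (2 * pi * n%:R)) v,
    rmap h v = t ^+ n *: v
}.

Record rhom (V W : rep) := RHom {
  rfun :> forall p, {linear V p -> W p};
  rfun_nat : forall p q a (h : arc p q a) v,
    rmap W h (rfun p v) = rfun q (rmap V h v)
}.

Definition rhom_eq (V W : rep) (f g : rhom V W) : Prop :=
  forall p v, f p v = g p v.

Definition mklinear (U W : lmodType R) (f : U -> W) (lf : linear f)
    : {linear U -> W} :=
  HB.pack f (GRing.isLinear.Build R U W _ f lf).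

Lemma idlin (U : lmodType R) : linear (fun v : U => v).
Proof. by []. Qed.

Definition rid (V : rep) : rhom V V.
Proof. by exists (fun p => mklinear (@idlin (V p))). Defined.

Lemma complin (U V W : lmodType R) (g : {linear V -> W}) (f : {linear U -> V}) :
  linear (fun v => g (f v)).
Proof. by move=> a u v; rewrite !linearP. Qed.

Definition rcomp (U V W : rep) (g : rhom V W) (f : rhom U V) : rhom U W.
Proof.
exists (fun p => mklinear (complin (g p) (f p))) => p q a h v /=.
by rewrite !rfun_nat.
Defined.

Lemma zerolin (U W : lmodType R) : linear (fun _ : U => 0 : W).
Proof. by move=> a u v; rewrite scaler0 addr0. Qed.

Definition rzero (V W : rep) : rhom V W.
Proof.
by exists (fun p => mklinear (@zerolin (V p) (W p))) => p q a h v /=;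
  rewrite linear0.
Defined.

Lemma addlin (U W : lmodType R) (f g : {linear U -> W}) :
  linear (fun v => f v + g v).
Proof. by move=> a u v; rewrite !linearP scalerDr addrACA. Qed.

Definition radd (V W : rep) (f g : rhom V W) : rhom V W.
Proof.
exists (fun p => mklinear (addlin (f p) (g p))) => p q a h v /=.
by rewrite linearD !rfun_nat.
Defined.

Lemma scalelin (U W : lmodType R) (c : R) (f : {linear U -> W}) :
  linear (fun v => c *: f v).
Proof. by move=> a u v; rewrite linearP scalerDr !scalerA mulrC. Qed.

Definition rscale (V W : rep) (c : R) (f : rhom V W) : rhom V W.
Proof.
exists (fun p => mklinear (scalelin c (f p))) => p q a h v /=.
by rewrite linearZ rfun_nat.
Defined.

Definition monic_rep (V W : rep) (f : rhom V W) : Prop :=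
  forall p, injective (f p).

Definition epic_rep (V W : rep) (f : rhom V W) : Prop :=
  forall p w, exists v, f p v = w.

Definition exact_rep (U V W : rep) (f : rhom U V) (g : rhom V W) : Prop :=
  forall p v, g p v = 0 <-> exists u, f p u = v.

Definition projective_rep (P : rep) : Prop :=
  forall (V W : rep) (g : rhom V W), epic_rep g ->
  forall h : rhom P W, exists k : rhom P V, rhom_eq (rcomp g k) h.

Record riso (V W : rep) := RIso {
  riso_to :> rhom V W;
  riso_inv : rhom W V;
  riso_toK : rhom_eq (rcomp riso_inv riso_to) (rid V);
  riso_invK : rhom_eq (rcomp riso_to riso_inv) (rid W)
}.

(* The point [p] is [x - alpha] for a unique [0 <= alpha < 2 pi], namely
   [ang (x - p)], and the module at [p] is free on [e_x^alpha]. Moving by [a]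
   reaches [e_x^(alpha + a)], which is [t^n] times the generator at the
   endpoint, [n] being the integer part of [(alpha + a) / 2 pi]. *)
Definition turns (x p : circle) (a : RR) : nat :=
  Num.truncn ((ang (x - p) + a) / (2 * pi)).

Lemma turnsE x p q a : arc p q a ->
  ang (x - p) + a = ang (x - q) + (turns x p a)%:R * (2 * pi).
Proof.
move=> h; have a0 := arc_ge0 h.
have /andP[b0 b1] := ang_itv (x - p).
have /andP[c0 c1] := ang_itv (x - q).
have ge0 : 0 <= (ang (x - p) + a) / (2 * pi).
  by apply: divr_ge0; [exact: addr_ge0 | exact: ltW (twopi_gt0 RR)].
have /andP[] := truncn_itv ge0; rewrite -/(turns x p a).
rewrite ler_pdivlMr ?twopi_gt0// ltr_pdivrMr ?twopi_gt0// => h1.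
rewrite -natr1 mulrDl mul1r => h2.
apply/eqP; rewrite -subr_eq; apply/eqP; apply: cls_inj_itv; last first.
  by rewrite ltr_norml; apply/andP; split; lra.
rewrite clsB clsD !angK -[X in cls (X * _)]/((Posz _)%:~R) clsM2pi subr0.
by rewrite (arc_end h) opprB addrA addrAC.
Qed.

Lemma turnsD x p q r a b : arc p q b -> arc q r a ->
  (turns x q a + turns x p b)%N = turns x p (a + b).
Proof.
move=> hb ha; have e1 := turnsE x hb; have e2 := turnsE x ha.
have e3 := turnsE x (arc_trans hb ha).
apply/eqP; rewrite [a + b]addrC -(eqr_nat RR) natrD.
rewrite -(inj_eq (mulIf (lt0r_neq0 (twopi_gt0 RR)))) mulrDl.
by apply/eqP; lra.
Qed.

Lemma turns_full x p n : turns x p (2 * pi * n%:R) = n.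
Proof.
have /andP[b0 b1] := ang_itv (x - p).
apply: truncn_def; rewrite ler_pdivlMr ?twopi_gt0// ltr_pdivrMr ?twopi_gt0//.
by rewrite -natr1; apply/andP; split; lra.
Qed.

Lemma pmaplin (n : nat) : linear (fun r : R^o => t ^+ n *: r).
Proof. by move=> a u v; rewrite scalerDr !scalerA mulrC. Qed.

Definition prep (x : circle) : rep.
Proof.
refine (@Rep (fun _ => R^o : lmodType R)
  (fun p q a _ => mklinear (pmaplin (turns x p a))) _ _) => [p q r a b hb ha hab v|p n h v] /=.
  by rewrite scalerA -exprD (turnsD x hb ha).
by rewrite turns_full.
Defined.

(* [e_x^a], as an element of the module of [prep x] at [q = x - a]. *)
Definition pgen (x q : circle) (a : RR) (h : arc x q a) : prep x q :=
  rmap (prep x) h (1 : R^o).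

Lemma psumlin (I : finType) (n : I -> nat) :
  linear (fun v : {ffun I -> R^o} => [ffun i => t ^+ n i *: v i] : {ffun I -> R^o}).
Proof.
by move=> a u v; apply/ffunP=> i; rewrite !ffunE scalerDr !scalerA mulrC.
Qed.

Definition psum (I : finType) (x : I -> circle) : rep.
Proof.
refine (@Rep (fun _ => {ffun I -> R^o} : lmodType R)
  (fun p q a _ => mklinear (psumlin (fun i => turns (x i) p a))) _ _)
  => [p q r a b hb ha hab v|p n h v] /=; apply/ffunP=> i; rewrite !ffunE.
  by rewrite scalerA -exprD (turnsD (x i) hb ha).
by rewrite turns_full.
Defined.

Lemma pinlin (I : finType) (i : I) :
  linear (fun r : R^o => [ffun k => if k == i then r else 0] : {ffun I -> R^o}).
Proof.
by move=> a u v; apply/ffunP=> k; rewrite !ffunE; case: eqP => // _;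
  rewrite scaler0 addr0.
Qed.

Definition pin (I : finType) (x : I -> circle) (i : I) : rhom (prep (x i)) (psum x).
Proof.
exists (fun p => mklinear (pinlin i)) => p q a h v /=.
by apply/ffunP=> k; rewrite !ffunE; case: eqP => [->//|_]; rewrite scaler0.
Defined.

Lemma pprojlin (I : finType) (i : I) : linear (fun v : {ffun I -> R^o} => v i).
Proof. by move=> a u v; rewrite !ffunE. Qed.

Definition pproj (I : finType) (x : I -> circle) (i : I) :
  rhom (psum x) (prep (x i)).
Proof.
by exists (fun p => mklinear (pprojlin i)) => p q a h v /=; rewrite !ffunE.
Defined.

Definition finitely_generated (V : rep) : Prop :=
  exists (I : finType) (x : I -> circle) (f : rhom (psum x) V), epic_rep f.

(* For [f] nonzero the set below is a singleton when [R] is a discrete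
   valuation ring with uniformizer [t]. *)
Definition depth1 (x y : circle) (f : rhom (prep x) (prep y)) : \bar RR :=
  if `[< rhom_eq f (rzero _ _) >] then +oo%E else
  ereal_inf [set a%:E | a in
    [set a | exists (h : arc y x a) (u : R),
       u \is a GRing.unit /\ f x (1 : R^o) = u *: pgen h]]%classic.

Definition depth_psum (I J : finType) (x : I -> circle) (y : J -> circle)
    (f : rhom (psum x) (psum y)) : \bar RR :=
  \big[Order.min/+oo%E]_(i : I) \big[Order.min/+oo%E]_(j : J)
     depth1 (rcomp (pproj y j) (rcomp f (pin x i))).

(* For [V] and [W] finitely generated projective, such a [d] exists and does not
   depend on the chosen decompositions. *)
Definition has_depth (V W : rep) (f : rhom V W) (d : \bar RR) : Prop :=
  exists (I J : finType) (x : I -> circle) (y : J -> circle)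
    (phi : riso V (psum x)) (psi : riso W (psum y)),
    d = depth_psum (rcomp psi (rcomp f (riso_inv phi))).

End Representations.

Section Frobenius.
Variables (RR : realType) (R : idomainType) (t : R).
Local Notation circle := (circle RR).
Local Notation rep := (rep RR t).

Record fpi_obj := FpiObj {
  fpi_rep :> rep;
  fpi_fg : finitely_generated fpi_rep;
  fpi_projective : projective_rep fpi_rep;
  fpi_d : rhom fpi_rep fpi_rep;
  fpi_dd : forall p v, fpi_d p (fpi_d p v) = t *: v
}.

Record fpi_hom (X Y : fpi_obj) := FpiHom {
  fpi_fun :> rhom X Y;
  fpi_comm : rhom_eq (rcomp fpi_fun (fpi_d X)) (rcomp (fpi_d Y) fpi_fun)
}.

Definition fpi_id (X : fpi_obj) : fpi_hom X X.
Proof. by exists (rid X). Defined.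

Definition fpi_comp (X Y Z : fpi_obj) (g : fpi_hom Y Z) (f : fpi_hom X Y) :
  fpi_hom X Z.
Proof.
exists (rcomp g f) => p v /=.
by have /= -> := fpi_comm f v; have /= -> := fpi_comm g (f p v).
Defined.

Definition fpi_zero (X Y : fpi_obj) : fpi_hom X Y.
Proof. by exists (rzero X Y) => p v /=; rewrite linear0. Defined.

Definition fpi_add (X Y : fpi_obj) (f g : fpi_hom X Y) : fpi_hom X Y.
Proof.
exists (radd f g) => p v /=; rewrite linearD.
by have /= -> := fpi_comm f v; have /= -> := fpi_comm g v.
Defined.

Definition fpi_scale (X Y : fpi_obj) (a : R) (f : fpi_hom X Y) : fpi_hom X Y.
Proof.
exists (rscale a f) => p v /=; rewrite linearZ.
by have /= -> := fpi_comm f v.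
Defined.

Definition fpi_opp (X Y : fpi_obj) (f : fpi_hom X Y) : fpi_hom X Y :=
  fpi_scale (- 1) f.

Definition Fpi : lincat R.
Proof.
refine (@LinCat R fpi_obj fpi_hom (fun X Y f g => rhom_eq f g) fpi_id fpi_comp
  fpi_zero fpi_add fpi_opp fpi_scale
  _ _ _ _ _ _ _ _ _ _ _ _ _ _ _ _ _ _ _ _ _) => //=.
- by move=> X Y f g e p v; rewrite e.
- by move=> X Y f g h e1 e2 p v; rewrite e1 e2.
- by move=> X Y Z f f' g g' e1 e2 p v /=; rewrite e2 e1.
- by move=> X Y f f' g g' e1 e2 p v /=; rewrite e1 e2.
- by move=> X Y a f f' e p v /=; rewrite e.
- by move=> X Y f g h p v /=; rewrite addrA.
- by move=> X Y f g p v /=; rewrite addrC.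
- by move=> X Y f p v /=; rewrite add0r.
- by move=> X Y f p v /=; rewrite scaleN1r addNr.
- by move=> X Y a b f p v /=; rewrite scalerA.
- by move=> X Y f p v /=; rewrite scale1r.
- by move=> X Y a f g p v /=; rewrite scalerDr.
- by move=> X Y a b f p v /=; rewrite scalerDl.
- by move=> X Y Z f g g' p v /=; rewrite linearD.
- by move=> X Y Z a f g p v /=; rewrite linearZ.
Defined.

Definition Fpi_exact (X Y Z : Fpi) (f : hom X Y) (g : hom Y Z) : Prop :=
  [/\ monic_rep (f : fpi_hom X Y), epic_rep (g : fpi_hom Y Z) &
      exact_rep (f : fpi_hom X Y) (g : fpi_hom Y Z)].

Definition in_Fc (c : RR) (X : Fpi) : Prop :=
  exists2 d : \bar RR, has_depth (fpi_d X) d & ((pi - c)%:E <= d)%E.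

Definition Fc (c : RR) : lincat R := full_subcat (in_Fc c).

Definition Fc_exact (c : RR) (X Y Z : Fc c) (f : hom X Y) (g : hom Y Z) : Prop :=
  @Fpi_exact (sval X) (sval Y) (sval Z) f g.

Section DirectSum.
Variables V W : rep.

Lemma pairlin (U1 U2 W1 W2 : lmodType R)
    (f : {linear U1 -> W1}) (g : {linear U2 -> W2}) :
  linear (fun v : U1 * U2 => (f v.1, g v.2)).
Proof. by move=> a u v; rewrite !linearP. Qed.

Definition dsum : rep.
Proof.
refine (@Rep _ _ t (fun p => (V p * W p)%type : lmodType R)
  (fun p q a h => mklinear (pairlin (rmap V h) (rmap W h))) _ _)
  => [p q r a b hb ha hab [v w]|p n h [v w]] /=.
  by rewrite !(rmapD _ _ hab).
by rewrite !rmap_turns.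
Defined.

Lemma inllin (U1 U2 : lmodType R) : linear (fun v : U1 => (v, 0) : U1 * U2).
Proof. by move=> a u v; congr (_, _); rewrite /= scaler0 addr0. Qed.
Lemma inrlin (U1 U2 : lmodType R) : linear (fun v : U2 => (0, v) : U1 * U2).
Proof. by move=> a u v; congr (_, _); rewrite /= scaler0 addr0. Qed.
Lemma fstlin (U1 U2 : lmodType R) : linear (fun v : U1 * U2 => v.1).
Proof. by []. Qed.
Lemma sndlin (U1 U2 : lmodType R) : linear (fun v : U1 * U2 => v.2).
Proof. by []. Qed.

Definition dinl : rhom V dsum.
Proof.
by exists (fun p => mklinear (@inllin (V p) (W p))) => p q a h v /=;
  rewrite linear0.
Defined.
Definition dinr : rhom W dsum.
Proof.
by exists (fun p => mklinear (@inrlin (V p) (W p))) => p q a h v /=;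
  rewrite linear0.
Defined.
Definition dfst : rhom dsum V.
Proof. by exists (fun p => mklinear (@fstlin (V p) (W p))). Defined.
Definition dsnd : rhom dsum W.
Proof. by exists (fun p => mklinear (@sndlin (V p) (W p))). Defined.
End DirectSum.

Definition dmap (V W V' W' : rep) (f : rhom V V') (g : rhom W W') :
  rhom (dsum V W) (dsum V' W').
Proof.
exists (fun p => mklinear (pairlin (f p) (g p))) => p q a h [v w] /=.
by rewrite !rfun_nat.
Defined.

Lemma dsum_projective V W :
  projective_rep V -> projective_rep W -> projective_rep (dsum V W).
Proof.
move=> PV PW X Y g eg h.
have [k ek] := PV _ _ _ eg (rcomp h (dinl V W)).
have [l el] := PW _ _ _ eg (rcomp h (dinr V W)).
exists (radd (rcomp k (dfst V W)) (rcomp l (dsnd V W))) => p [v w] /=.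
rewrite linearD; have /= -> := ek p v; have /= -> := el p w.
by rewrite -linearD; congr (h p _); congr (_, _); rewrite ?addr0 ?add0r.
Qed.

Section SumIndex.
Variables (I J : finType) (x : I -> circle) (y : J -> circle).

Definition sumfun (k : I + J) : circle :=
  match k with inl i => x i | inr j => y j end.

Lemma joinlin : linear (fun v : {ffun I -> R^o} * {ffun J -> R^o} =>
  [ffun k => match k with inl i => v.1 i | inr j => v.2 j end]
     : {ffun I + J -> R^o}).
Proof. by move=> a u v; apply/ffunP=> -[i|j]; rewrite !ffunE. Qed.

Lemma splitlin : linear (fun v : {ffun I + J -> R^o} =>
  ([ffun i => v (inl i)], [ffun j => v (inr j)])
     : {ffun I -> R^o} * {ffun J -> R^o}).
Proof. by move=> a u v; congr (_, _); apply/ffunP=> k; rewrite !ffunE. Qed.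

Definition pjoin : rhom (dsum (psum t x) (psum t y)) (psum t sumfun).
Proof.
exists (fun p => mklinear joinlin) => p q a h v /=.
by apply/ffunP=> -[i|j]; rewrite !ffunE.
Defined.

Definition psplit : rhom (psum t sumfun) (dsum (psum t x) (psum t y)).
Proof.
exists (fun p => mklinear splitlin) => p q a h v /=.
by congr (_, _); apply/ffunP=> k; rewrite !ffunE.
Defined.

Lemma pjoinK p v : psplit p (pjoin p v) = v.
Proof. by case: v => v w /=; congr (_, _); apply/ffunP=> k; rewrite !ffunE. Qed.

Lemma psplitK p v : pjoin p (psplit p v) = v.
Proof. by apply/ffunP=> -[i|j]; rewrite !ffunE. Qed.

Definition sum_iso (V W : rep) (phi : riso V (psum t x)) (psi : riso W (psum t y)) :
  riso (dsum V W) (psum t sumfun).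
Proof.
exists (rcomp pjoin (dmap phi psi))
       (rcomp (dmap (riso_inv phi) (riso_inv psi)) psplit) => p v.
  change (dmap (riso_inv phi) (riso_inv psi) p
            (psplit p (pjoin p (dmap phi psi p v))) = v).
  rewrite pjoinK; case: v => v w; congr (_, _); first exact: (riso_toK phi).
  exact: (riso_toK psi).
change (pjoin p (dmap phi psi p
          (dmap (riso_inv phi) (riso_inv psi) p (psplit p v))) = v).
rewrite -[RHS]psplitK; congr (pjoin p _); case: (psplit p v) => w w'.
congr (_, _); first exact: (riso_invK phi).
exact: (riso_invK psi).
Defined.

End SumIndex.

Lemma dsum_fg V W :
  finitely_generated V -> finitely_generated W ->
  finitely_generated (dsum V W).
Proof.
move=> [I [x [f ef]]] [J [y [g eg]]].
exists (I + J)%type, (sumfun x y), (rcomp (dmap f g) (psplit x y)) => p [v w].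
have [v' <-] := ef p v; have [w' <-] := eg p w.
exists (pjoin x y p (v', w')).
change (dmap f g p (psplit x y p (pjoin x y p (v', w'))) = (f p v', g p w')).
by rewrite pjoinK.
Qed.

Definition fpi_sum (X Y : fpi_obj) : fpi_obj.
Proof.
refine (@FpiObj (dsum X Y) (dsum_fg (fpi_fg X) (fpi_fg Y))
  (dsum_projective (@fpi_projective X) (@fpi_projective Y))
  (dmap (fpi_d X) (fpi_d Y)) _) => p [v w] /=.
by rewrite !fpi_dd.
Defined.

Lemma depth1_zero (x y : circle) (f : rhom (prep t x) (prep t y)) :
  rhom_eq f (rzero _ _) -> depth1 f = +oo%E.
Proof. by move=> h; rewrite /depth1; case: asboolP. Qed.

Lemma depth1_eq (x y : circle) (f g : rhom (prep t x) (prep t y)) :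
  rhom_eq f g -> depth1 f = depth1 g.
Proof.
move=> e; rewrite /depth1 e.
have -> : `[< rhom_eq f (rzero _ _) >] = `[< rhom_eq g (rzero _ _) >] => //.
by apply/asboolP/asboolP => h p v; rewrite -h e.
Qed.

Lemma depth_psum_ge (I J : finType) (x : I -> circle) (y : J -> circle)
    (f : rhom (psum t x) (psum t y)) d :
  (forall i j, (d <= depth1 (rcomp (pproj t y j) (rcomp f (pin t x i))))%E) <->
  (d <= depth_psum f)%E.
Proof.
split=> [h|h i j].
  by apply: le_bigmin; rewrite ?leey// => i _; apply: le_bigmin; rewrite ?leey.
apply: le_trans h _; apply: le_trans (bigmin_le _ i _) _; exact: bigmin_le.
Qed.

Lemma has_depth_sum (V W V' W' : rep) (f : rhom V V') (g : rhom W W') b d1 d2 :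
  has_depth f d1 -> has_depth g d2 -> (b <= d1)%E -> (b <= d2)%E ->
  exists2 d, has_depth (dmap f g) d & (b <= d)%E.
Proof.
move=> [I1 [J1 [x1 [y1 [phi1 [psi1 ->]]]]]] [I2 [J2 [x2 [y2 [phi2 [psi2 ->]]]]]].
move=> /depth_psum_ge b1 /depth_psum_ge b2.
eexists.
  exists (I1 + I2)%type, (J1 + J2)%type, (sumfun x1 x2), (sumfun y1 y2).
  by exists (sum_iso phi1 phi2), (sum_iso psi1 psi2).
have pin1 i p (r : R^o) : psplit x1 x2 p (pin t (sumfun x1 x2) (inl i) p r) =
    (pin t x1 i p r, 0).
  by congr (_, _); apply/ffunP=> k; rewrite !ffunE.
have pin2 i p (r : R^o) : psplit x1 x2 p (pin t (sumfun x1 x2) (inr i) p r) =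
    (0, pin t x2 i p r).
  by congr (_, _); apply/ffunP=> k; rewrite !ffunE.
have proj1 j p v : pproj t (sumfun y1 y2) (inl j) p (pjoin y1 y2 p v) =
    pproj t y1 j p v.1 by rewrite /= ffunE.
have proj2 j p v : pproj t (sumfun y1 y2) (inr j) p (pjoin y1 y2 p v) =
    pproj t y2 j p v.2 by rewrite /= ffunE.
have dE (V1 V2 V3 V4 : rep) (u : rhom V1 V2) (w : rhom V3 V4) p a b' :
  dmap u w p (a, b') = (u p a, w p b') by [].
pose F p v := pjoin y1 y2 p (dmap psi1 psi2 p (dmap f g p
  (dmap (riso_inv phi1) (riso_inv phi2) p (psplit x1 x2 p v)))).
apply/depth_psum_ge => -[i|i] [j|j].
- apply: le_trans (b1 i j) _; rewrite le_eqVlt; apply/orP; left.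
  apply/eqP/depth1_eq => p v; apply/esym.
  change (pproj t (sumfun y1 y2) (inl j) p
    (F p (pin t (sumfun x1 x2) (inl i) p v)) =
    pproj t y1 j p (psi1 p (f p (riso_inv phi1 p (pin t x1 i p v))))).
  by rewrite /F proj1 pin1 !dE.
- rewrite depth1_zero ?leey// => p v.
  change (pproj t (sumfun y1 y2) (inr j) p
    (F p (pin t (sumfun x1 x2) (inl i) p v)) = 0).
  by rewrite /F proj2 pin1 !dE !linear0.
- rewrite depth1_zero ?leey// => p v.
  change (pproj t (sumfun y1 y2) (inl j) p
    (F p (pin t (sumfun x1 x2) (inr i) p v)) = 0).
  by rewrite /F proj1 pin2 !dE !linear0.
- apply: le_trans (b2 i j) _; rewrite le_eqVlt; apply/orP; left.
  apply/eqP/depth1_eq => p v; apply/esym.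
  change (pproj t (sumfun y1 y2) (inr j) p
    (F p (pin t (sumfun x1 x2) (inr i) p v)) =
    pproj t y2 j p (psi2 p (g p (riso_inv phi2 p (pin t x2 i p v))))).
  by rewrite /F proj2 pin2 !dE.
Qed.

Definition nopoint (v : void) : circle := match v with end.

Lemma psum0_eq0 p (v : psum t nopoint p) : v = 0.
Proof. by apply/ffunP=> -[]. Qed.

Definition fpi_nil : fpi_obj.
Proof.
refine (@FpiObj (psum t nopoint) _ _ (rzero _ _) _).
- by exists void, nopoint, (rid _) => p w; exists w.
- move=> V W g eg h; exists (rzero _ _) => p v.
  by rewrite (psum0_eq0 v) !linear0.
- by move=> p v; rewrite (psum0_eq0 v) scaler0.
Defined.

Lemma fpi_nil_in_Fc c : in_Fc c fpi_nil.
Proof.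
exists (+oo)%E; last exact: leey.
pose i := RIso (riso_to := rid (psum t nopoint)) (riso_inv := rid _)
  (fun p v => erefl) (fun p v => erefl).
exists void, void, nopoint, nopoint, i, i; rewrite /depth_psum.
by rewrite big1_eq || rewrite big_pred0 // => -[].
Qed.

Lemma Fc_has_biproducts c : has_biproducts (Fc c).
Proof.
split.
  exists (exist _ fpi_nil (fpi_nil_in_Fc c)).
  by change (rhom_eq (rid (psum t nopoint)) (rzero _ _)) => p v;
    apply: psum0_eq0.
move=> [X [dX hX bX]] [Y [dY hY bY]].
have hS : in_Fc c (fpi_sum X Y) := has_depth_sum hX hY bX bY.
have @i : fpi_hom X (fpi_sum X Y).
  by exists (dinl X Y) => p v /=; rewrite linear0.
have @j : fpi_hom Y (fpi_sum X Y).
  by exists (dinr X Y) => p v /=; rewrite linear0.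
have @p : fpi_hom (fpi_sum X Y) X by exists (dfst X Y).
have @q : fpi_hom (fpi_sum X Y) Y by exists (dsnd X Y).
exists (exist _ (fpi_sum X Y : Fpi) hS), i, j, p, q; split=> //.
change (rhom_eq (radd (rcomp (dinl X Y) (dfst X Y)) (rcomp (dinr X Y) (dsnd X Y)))
  (rid (dsum X Y))) => r [v w].
by congr (_, _); rewrite /= ?addr0 ?add0r.
Qed.

Definition stable_Fc (c : RR) : lincat R :=
  stable_cat (@Fc_exact c) (Fc_has_biproducts c).

End Frobenius.

Section Cluster.
Variables (RR : realType) (K : fieldType) (c : RR).
Local Notation circle := (circle RR).

Definition phi (x : RR) : RR := x + pi - c.
Definition phiV (x : RR) : RR := x - pi + c.

Lemma phiK : cancel phi phiV. Proof. by move=> x; rewrite /phi /phiV; lra. Qed.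
Lemma phiVK : cancel phiV phi. Proof. by move=> x; rewrite /phi /phiV; lra. Qed.

Record cpair := CPair {
  cp0 : circle;
  cp1 : circle;
  cp_lift : exists x0 x1 : RR, [/\ cls x0 = cp0, cls x1 = cp1,
    x0 <= phi x0, phi x0 <= x1 & x1 <= phiV (x0 + 2 * pi)]
}.

Definition lifts (X Y : cpair) (x0 x1 y0 y1 : RR) : Prop :=
  [/\ cls x0 = cp0 X, cls x1 = cp1 X, cls y0 = cp0 Y & cls y1 = cp1 Y].

Definition has_bplus (X Y : cpair) : Prop :=
  exists x0 x1 y0 y1, lifts X Y x0 x1 y0 y1 /\
    [/\ x0 <= y0, y0 < phiV x1, phiV x1 <= x1, x1 <= y1 &
        y1 < phiV (x0 + 2 * pi)].

Definition has_bminus (X Y : cpair) : Prop :=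
  exists x0 x1 y0 y1, lifts X Y x0 x1 y0 y1 /\
    [/\ x0 <= y1, y1 < phiV x1, phiV x1 <= x1, x1 <= y0 + 2 * pi &
        y0 + 2 * pi < phiV (x0 + 2 * pi)].

(* [Some false], [Some true] and [None] stand for the morphism spaces [K b_+],
   [K b_-] and [0]; the product of signs becomes [addb]. *)
Definition cbasis (X Y : cpair) : option bool :=
  if `[< has_bplus X Y >] then Some false
  else if `[< has_bminus X Y >] then Some true else None.

Record chom (X Y : cpair) := CHom {
  ccoef :> K;
  ccoef0 : cbasis X Y = None -> ccoef = 0
}.

Definition compatible (X Y Z : cpair) : bool :=
  match cbasis Y Z, cbasis X Y with
  | Some e, Some e' => cbasis X Z == Some (e (+) e')
  | _, _ => false
  end.

Lemma ccomp_subproof (X Y Z : cpair) (r s : K) :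
  cbasis X Z = None -> (if compatible X Y Z then r * s else 0) = 0.
Proof.
move=> e; rewrite /compatible e.
by case: (cbasis Y Z) => [?|//]; case: (cbasis X Y).
Qed.

Definition ccomp (X Y Z : cpair) (g : chom Y Z) (f : chom X Y) : chom X Z :=
  CHom (@ccomp_subproof X Y Z g f).

(* Formal finite direct sums, with matrices as morphisms. *)
Record cobj := CObj { csize : nat; csummand :> 'I_csize -> cpair }.

Definition cmat (X Y : cobj) : Type :=
  forall (j : 'I_(csize Y)) (i : 'I_(csize X)), chom (X i) (Y j).

Definition cmat_eq (X Y : cobj) (f g : cmat X Y) : Prop :=
  forall j i, f j i = g j i :> K.

Lemma cid_subproof (X : cobj) (j i : 'I_(csize X)) :
  cbasis (X i) (X j) = None ->
  (if (i == j) && (cbasis (X i) (X j) == Some false) then 1 else 0) = 0 :> K.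
Proof. by move=> ->; rewrite andbF. Qed.

Definition cmat_id (X : cobj) : cmat X X := fun j i => CHom (@cid_subproof X j i).

Lemma csum_subproof (X Y : cpair) (n : nat) (F : 'I_n -> chom X Y) :
  cbasis X Y = None -> \sum_(k < n) (F k : K) = 0.
Proof. by move=> e; rewrite big1// => k _; apply: ccoef0. Qed.

Definition cmat_comp (X Y Z : cobj) (g : cmat Y Z) (f : cmat X Y) : cmat X Z :=
  fun k i => CHom (csum_subproof (fun j => ccomp (g k j) (f j i))).

Definition cmat_zero (X Y : cobj) : cmat X Y := fun j i => CHom (fun _ => erefl).

Lemma cadd_subproof (X Y : cpair) (f g : chom X Y) :
  cbasis X Y = None -> (f : K) + (g : K) = 0.
Proof. by move=> e; rewrite !ccoef0// addr0. Qed.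

Definition cmat_add (X Y : cobj) (f g : cmat X Y) : cmat X Y :=
  fun j i => CHom (cadd_subproof (f j i) (g j i)).

Lemma cscale_subproof (X Y : cpair) (a : K) (f : chom X Y) :
  cbasis X Y = None -> a * (f : K) = 0.
Proof. by move=> e; rewrite ccoef0// mulr0. Qed.

Definition cmat_scale (X Y : cobj) (a : K) (f : cmat X Y) : cmat X Y :=
  fun j i => CHom (cscale_subproof a (f j i)).

Definition cmat_opp (X Y : cobj) (f : cmat X Y) : cmat X Y := cmat_scale (- 1) f.

(* [near4] is the chain of inequalities defining [b_+], and [basis e] treats both
   signs at once: for [b_-] the two points of the target are exchanged. *)
Section Laws.
Hypothesis c_itv : 0 < c < pi.

Definition near4 (x0 x1 y0 y1 : RR) : Prop :=
  [/\ x0 <= y0, y0 < phiV x1, x1 <= y1 & y1 < phiV (x0 + 2 * pi)].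

Definition lift2 (e : bool) (X : cpair) (u v : RR) : Prop :=
  cls u = (if e then cp1 X else cp0 X) /\ cls v = (if e then cp0 X else cp1 X).

Definition basis (e : bool) (X Y : cpair) : Prop :=
  exists x0 x1 a b, [/\ lift2 false X x0 x1, lift2 e Y a b & near4 x0 x1 a b].

Lemma c_gt0 : 0 < c. Proof. by case/andP: c_itv. Qed.
Lemma c_ltpi : c < pi. Proof. by case/andP: c_itv. Qed.

Lemma cls_add2pi (x : RR) (k : int) : cls (x + k%:~R * (2 * pi)) = cls x.
Proof. by rewrite clsD clsM2pi addr0. Qed.

Lemma cls_p (x : RR) : cls (x + 2 * pi) = cls x.
Proof. by rewrite -(cls_add2pi x 1) mul1r. Qed.

Lemma cls_m (x : RR) : cls (x - 2 * pi) = cls x.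
Proof. by rewrite -(cls_add2pi x (- 1)) rmorphN mulN1r. Qed.

Lemma basis_plus X Y : has_bplus X Y <-> basis false X Y.
Proof.
split=> [[x0 [x1 [y0 [y1 [[? ? ? ?] [? ? ? ? ?]]]]]]|].
  by exists x0, x1, y0, y1.
move=> [x0 [x1 [y0 [y1 [[? ?] [? ?] [? ? ? ?]]]]]].
exists x0, x1, y0, y1; split; first by [].
by split=> //; rewrite /phiV; move: c_ltpi; lra.
Qed.

Lemma basis_minus X Y : has_bminus X Y <-> basis true X Y.
Proof.
split=> [[x0 [x1 [y0 [y1 [[? ? ? ?] [? ? ? ? ?]]]]]]|].
  by exists x0, x1, y1, (y0 + 2 * pi); split=> //; split=> //; rewrite cls_p.
move=> [x0 [x1 [y1 [y0 [[? ?] [? ?] [? ? ? ?]]]]]].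
exists x0, x1, (y0 - 2 * pi), y1; split; first by split=> //; rewrite cls_m.
by rewrite subrK; split=> //; rewrite /phiV; move: c_ltpi; lra.
Qed.

Lemma near_len x0 x1 a b : near4 x0 x1 a b -> 0 < x1 - x0 < 2 * pi.
Proof.
move: c_gt0 c_ltpi; rewrite /near4 /phiV => ? ? [? ? ? ?].
by apply/andP; split; lra.
Qed.

Lemma near_len' x0 x1 a b : near4 x0 x1 a b -> 0 < b - a < 2 * pi.
Proof.
move: c_gt0 c_ltpi; rewrite /near4 /phiV => ? ? [? ? ? ?].
by apply/andP; split; lra.
Qed.

Lemma near_swap u v a b : near4 u v a b -> near4 (v - 2 * pi) u (b - 2 * pi) a.
Proof. by rewrite /near4 /phiV => -[? ? ? ?]; split; lra. Qed.

Lemma near_swap' u v a b : near4 (v - 2 * pi) u a b -> near4 u v b (a + 2 * pi).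
Proof. by rewrite /near4 /phiV => -[? ? ? ?]; split; lra. Qed.

Lemma basis_lift0 e X Y u v : basis e X Y -> lift2 false X u v ->
  0 < v - u < 2 * pi -> exists a b, lift2 e Y a b /\ near4 u v a b.
Proof.
move=> [x0 [x1 [a [b [[X0 X1] [Y0 Y1] n]]]]] [/= U V] /andP[l1 l2].
have /andP[l3 l4] := near_len n.
have /clsP[k ek] : cls u = cls x0 by rewrite U X0.
have ev : v = x1 + k%:~R * (2 * pi).
  apply: cls_inj_itv; first by rewrite cls_add2pi V X1.
  by rewrite ltr_norml; apply/andP; split; lra.
exists (a + k%:~R * (2 * pi)), (b + k%:~R * (2 * pi)).
split; first by split; rewrite cls_add2pi.
by move: n; rewrite /near4 /phiV => -[? ? ? ?]; split; lra.
Qed.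

Lemma basis_lift d e X Y u v : basis e X Y -> lift2 d X u v ->
  0 < v - u < 2 * pi -> exists a b, lift2 (d (+) e) Y a b /\ near4 u v a b.
Proof.
case: d => [h [U V] l|]; last exact: basis_lift0.
have [||a [b [[A B] n]]] := @basis_lift0 e X Y (v - 2 * pi) u h.
- by split=> //; rewrite cls_m.
- by case/andP: l => ? ?; apply/andP; split; lra.
exists b, (a + 2 * pi); split; last exact: near_swap'.
by rewrite /lift2 cls_p; case: (e) A B => /= -> ->.
Qed.

Lemma basis_unlift d e X Y u v a b : lift2 d X u v -> lift2 (d (+) e) Y a b ->
  near4 u v a b -> basis e X Y.
Proof.
case: d => [[U V] [A B] n|]; last by exists u, v, a, b.
exists (v - 2 * pi), u, (b - 2 * pi), a; split; last exact: near_swap.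
  by split; rewrite /= ?cls_m.
by rewrite /lift2 cls_m; case: (e) A B => /= -> ->.
Qed.

Lemma lift_ex d X : exists u v, lift2 d X u v /\ 0 < v - u < 2 * pi.
Proof.
have [x0 [x1 [X0 X1]]] := cp_lift X; move: c_gt0 c_ltpi; rewrite /phi /phiV => ? ? ? ? ?.
case: d; last by exists x0, x1; do !split=> //; lra.
by exists x1, (x0 + 2 * pi); split; [split=> //; rewrite cls_p | lra].
Qed.

Lemma basis_uniq e e' X Y : basis e X Y -> basis e' X Y -> e = e'.
Proof.
move=> h h'; have [u [v [L l]]] := lift_ex false X.
have [a [b [[A B] n]]] := basis_lift h L l.
have [a' [b' [[A' B'] n']]] := basis_lift h' L l.
case: (eqVneq e e') => // ne; exfalso.
have eab : cls b = cls a' by rewrite B A'; case: e e' ne {h h' A B A' B'} => [] [].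
have : b = a'.
  apply: cls_inj_itv eab _; move: c_gt0 c_ltpi n n'; rewrite /near4 /phiV.
  by move=> ? ? [? ? ? ?] [? ? ? ?]; rewrite ltr_norml; apply/andP; split; lra.
move: c_gt0 c_ltpi n n'; rewrite /near4 /phiV.
by move=> ? ? [? ? ? ?] [? ? ? ?] ?; lra.
Qed.

Lemma cbasisP e X Y : cbasis X Y = Some e <-> basis e X Y.
Proof.
rewrite /cbasis; case: asboolP => [/basis_plus h|np].
  by split=> [[<-]//|h']; rewrite (basis_uniq h h').
case: asboolP => [/basis_minus h|nm].
  by split=> [[<-]//|h']; rewrite (basis_uniq h h').
by split=> //; case: e => [/basis_minus|/basis_plus].
Qed.

Lemma compatibleP X Y Z : compatible X Y Z <->
  exists e e', [/\ basis e Y Z, basis e' X Y & basis (e (+) e') X Z].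
Proof.
rewrite /compatible; split=> [|[e [e' [/cbasisP-> /cbasisP-> /cbasisP->]]]//].
case E : (cbasis Y Z) => [e|//]; case E' : (cbasis X Y) => [e'|//] /eqP h.
by exists e, e'; split; apply/cbasisP.
Qed.

Lemma near_comp u v a b p q e Z X : lift2 false X u v -> lift2 e Z p q ->
  near4 u v a b -> near4 a b p q -> basis e X Z -> near4 u v p q.
Proof.
move=> L [P Q] n1 n2 h.
have [p' [q' [[P' Q'] n]]] := basis_lift h L (near_len n1).
have -> : p = p'.
  apply: cls_inj_itv; first by rewrite P P'.
  move: c_gt0 c_ltpi n1 n2 n; rewrite /near4 /phiV.
  by move=> ? ? [? ? ? ?] [? ? ? ?] [? ? ? ?]; rewrite ltr_norml; apply/andP; split; lra.
have -> // : q = q'.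
apply: cls_inj_itv; first by rewrite Q Q'.
move: c_gt0 c_ltpi n1 n2 n; rewrite /near4 /phiV.
by move=> ? ? [? ? ? ?] [? ? ? ?] [? ? ? ?]; rewrite ltr_norml; apply/andP; split; lra.
Qed.

Lemma near_comp_gen d u v a b p q e Z X : lift2 d X u v -> lift2 (d (+) e) Z p q ->
  near4 u v a b -> near4 a b p q -> basis e X Z -> near4 u v p q.
Proof.
case: d => [|]; last exact: near_comp.
move=> [U V] [P Q] n1 n2 h.
have -> : q = (q - 2 * pi) + 2 * pi by rewrite subrK.
apply: near_swap'.
apply: (@near_comp _ _ (b - 2 * pi) a _ _ e Z X).
- by split; rewrite /= ?cls_m.
- by rewrite /lift2 cls_m; case: (e) P Q => /= -> ->.
- exact: near_swap.
- exact: near_swap.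
- exact: h.
Qed.

Lemma compatibleA W X Y Z :
  compatible W X Z && compatible X Y Z = compatible W Y Z && compatible W X Y.
Proof.
have aux e1 e2 e3 : basis e1 W X -> basis e2 X Y -> basis e3 Y Z ->
    exists u v a b p q r s,
    [/\ lift2 false W u v, lift2 e1 X a b, lift2 (e1 (+) e2) Y p q &
        lift2 (e1 (+) e2 (+) e3) Z r s] /\
    [/\ near4 u v a b, near4 a b p q & near4 p q r s].
  move=> h1 h2 h3; have [u [v [L l]]] := lift_ex false W.
  have [a [b [La n1]]] := basis_lift h1 L l.
  have [p [q [Lp n2]]] := basis_lift h2 La (near_len' n1).
  have [r [s [Lr n3]]] := basis_lift h3 Lp (near_len' n2).
  by exists u, v, a, b, p, q, r, s.
apply/andP/andP => -[/compatibleP[e [e' [h1 h2 h3]]] /compatibleP[f [f' [k1 k2 k3]]]].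
- have e1 : e = f (+) f' by apply: basis_uniq h1 k3.
  have [u [v [a [b [p [q [r [s [[L La Lp Lr] [n1 n2 n3]]]]]]]]]] := aux _ _ _ h2 k2 k1.
  have m1 : near4 a b r s.
    apply: near_comp_gen La _ n2 n3 h1; rewrite e1.
    by rewrite [f (+) f']addbC addbA.
  have m2 : near4 u v r s.
    apply: near_comp_gen L _ n1 m1 h3; rewrite e1 /=.
    by move: Lr; rewrite addbC addbA [f (+) e']addbC; case: (e') (f) (f') => [] [] [].
  have m3 : near4 u v p q.
    by move: n1 n2 n3 m2; rewrite /near4 => -[? ? ? ?] [? ? ? ?] [? ? ? ?] [? ? ? ?]; split; lra.
  have hWY : basis (f' (+) e') W Y.
    by apply: basis_unlift L _ m3; rewrite /= addbC.
  split; apply/compatibleP.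
    by exists f, (f' (+) e'); split=> //; rewrite addbA -e1.
  by exists f', e'.
- have e1 : e' = f (+) f' by apply: basis_uniq h2 k3.
  have [u [v [a [b [p [q [r [s [[L La Lp Lr] [n1 n2 n3]]]]]]]]]] := aux _ _ _ k2 k1 h1.
  have m1 : near4 u v p q.
    by apply: near_comp_gen L _ n1 n2 h2; rewrite e1 /= addbC.
  have m2 : near4 u v r s.
    apply: near_comp_gen L _ m1 n3 h3; rewrite e1 /=.
    by move: Lr; case: (e) (f) (f') => [] [] [].
  have m3 : near4 a b r s.
    by move: n1 n2 n3 m2; rewrite /near4 /phiV => -[? ? ? ?] [? ? ? ?] [? ? ? ?] [? ? ? ?]; split; lra.
  have hXZ : basis (e (+) f) X Z.
    apply: basis_unlift La _ m3.
    by move: Lr; case: (e) (f) (f') => [] [] [].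
  split; apply/compatibleP.
    by exists (e (+) f), f'; split=> //; rewrite -addbA -e1.
  by exists e, f.
Qed.

Lemma cbasis_id X Y e : cbasis X Y = Some e ->
  cbasis X X = Some false /\ cbasis Y Y = Some false.
Proof.
move=> /cbasisP h; have [u [v [L l]]] := lift_ex false X.
have [a [b [La n]]] := basis_lift h L l.
split; apply/cbasisP.
  apply: (basis_unlift L L); move: n; rewrite /near4 /phiV => -[? ? ? ?].
  by split; lra.
apply: (basis_unlift La); first by rewrite addbF; exact: La.
by move: n; rewrite /near4 /phiV => -[? ? ? ?]; split; lra.
Qed.

Definition Cc : lincat K.
Proof.
refine (@LinCat K cobj cmat cmat_eq cmat_id cmat_comp cmat_zero cmat_add cmat_opp
  cmat_scale _ _ _ _ _ _ _ _ _ _ _ _ _ _ _ _ _ _ _ _ _).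
- by [].
- by move=> X Y f g e j i; rewrite e.
- by move=> X Y f g h e1 e2 j i; rewrite e1 e2.
- move=> X Y Z f f' g g' e1 e2 k i /=.
  by apply: eq_bigr => j _; rewrite e1 e2.
- by move=> X Y f f' g g' e1 e2 j i /=; rewrite e1 e2.
- by move=> X Y a f f' e j i /=; rewrite e.
- move=> X Y Z W f g h l i /=.
  transitivity (\sum_(k < csize Z) \sum_(j < csize Y)
     (if compatible (X i) (Z k) (W l) && compatible (X i) (Y j) (Z k)
      then ccoef (f l k) * ccoef (g k j) * ccoef (h j i) else 0)).
    apply: eq_bigr => k _; case: ifP => _ /=; last by rewrite big1.
    rewrite big_distrr /=; apply: eq_bigr => j _.
    by case: ifP => _; rewrite ?mulr0// mulrA.
  rewrite exchange_big /=; apply: eq_bigr => j _.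
  transitivity (\sum_(k < csize Z)
     (if compatible (X i) (Y j) (W l) && compatible (Y j) (Z k) (W l)
      then ccoef (f l k) * ccoef (g k j) * ccoef (h j i) else 0)).
    by apply: eq_bigr => k _; rewrite compatibleA.
  case: ifP => _ /=; last by rewrite big1.
  rewrite big_distrl /=; apply: eq_bigr => k _.
  by case: ifP => _; rewrite ?mul0r.
- move=> X Y f j i /=; rewrite (bigD1 j) //= eqxx /=.
  rewrite big1 ?addr0; last first.
    by move=> k /negbTE kj; rewrite kj /= mul0r if_same.
  case E : (cbasis (X i) (Y j)) => [e|]; last by rewrite (ccoef0 _ E) mulr0 if_same.
  have [_ eY] := cbasis_id E.
  by rewrite /compatible E eY /= eqxx mul1r.
- move=> X Y f j i /=; rewrite (bigD1 i) //= eqxx /=.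
  rewrite big1 ?addr0; last first.
    by move=> k; rewrite eq_sym => /negbTE ki; rewrite ki /= mulr0 if_same.
  case E : (cbasis (X i) (Y j)) => [e|]; last by rewrite (ccoef0 _ E) mul0r if_same.
  have [eX _] := cbasis_id E.
  by rewrite /compatible E eX /= addbF eqxx mulr1.
- by move=> X Y f g h j i /=; rewrite addrA.
- by move=> X Y f g j i /=; rewrite addrC.
- by move=> X Y f j i /=; rewrite add0r.
- by move=> X Y f j i /=; rewrite mulN1r addNr.
- by move=> X Y a b f j i /=; rewrite mulrA.
- by move=> X Y f j i /=; rewrite mul1r.
- by move=> X Y a f g j i /=; rewrite mulrDr.
- by move=> X Y a b f j i /=; rewrite mulrDl.
- move=> X Y Z f f' g k i /=; rewrite -big_split /=; apply: eq_bigr => j _.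
  by case: ifP => _; rewrite ?addr0// mulrDl.
- move=> X Y Z f g g' k i /=; rewrite -big_split /=; apply: eq_bigr => j _.
  by case: ifP => _; rewrite ?addr0// mulrDr.
- move=> X Y Z a f g k i /=; rewrite big_distrr /=; apply: eq_bigr => j _.
  by case: ifP => _; rewrite ?mulr0// mulrA.
- move=> X Y Z a f g k i /=; rewrite big_distrr /=; apply: eq_bigr => j _.
  by case: ifP => _; rewrite ?mulr0// mulrCA.
Defined.

End Laws.
End Cluster.

(* Main.v *)
From mathcomp Require Import all_boot all_order all_algebra.
From mathcomp Require Import archimedean.
From mathcomp Require Import boolp classical_sets reals constructive_ereal ereal trigo.
From mathcomp Require Import lra.
Require Import Defs.

Set Implicit Arguments.
Unset Strict Implicit.
Unset Printing Implicit Defensive.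

Import Order.TTheory GRing.Theory Num.Theory.
Local Open Scope ring_scope.

(** The objects of [F_c] are built from pairs: two generators at points [x_0], [x_1] of the
    circle, with [d] sending each generator to the structure map applied to the other one. Such a
    pair lies in [F_c] exactly when both arcs between its points have length at least [pi - c],
    which is the condition on the objects of [C_c]. The proof compares the two categories on pairs
    and then extends the comparison to direct sums.

    Morphisms between pairs. A shift moves both generators of the source forward along the
    circle, by lengths [al false] and [al true], onto the generators of the target, exchanging them
    or not according to a sign [e]. Every morphism between pairs is an [R]-combination of one shift of
    each sign ([hom_decomp]).

    The stable category. A pair one of whose arcs has the extreme length [pi - c] is projective and
    injective: a morphism from it is determined by the image of one generator, a morphism to it by
    one coordinate ([boundary_projinj]). A shift that moves a generator [s] by at least
    [len x s - (pi - c)] passes through such a pair, called a hull of the source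
    ([far_shift_ideal]). What remains are the short shifts, and these exist in precisely the cases
    in which [C_c] has a basis element of sign [e] ([basis_short]). Multiplication by [t] is the
    shift by a full turn, which is never short, so stable morphism spaces are spaces over [K].
    Composing two short shifts adds the lengths and multiplies the signs; the result is short or
    stably zero, which is the composition rule of [C_c] ([lift_chomM]). Conversely a unit multiple
    of a short shift is not stably zero: the two hulls of [x] fit into an exact sequence
    [0 -> x -> hull false + hull true -> cohull -> 0] of [F_c], so that a morphism through an
    injective object factors through the hulls ([factors_hulls]), and then its coefficient is
    divisible by [t] ([short_shift_faithful]).

    Decomposition. In an object [(V, d)] of [F_c] one takes an entry of [d] of least depth [al].
    The generator it starts from and the image of that generator under [d], divided by the
    structure map of length [al], span a pair [P] stable under [d]. Among endomorphisms that are at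
    least as deep as this entry, [P] plays the part of a boundary pair, so the injectivity argument
    yields a retraction of [V] onto [P] that commutes with [d] ([split_off]). By induction on the
    rank every object is a direct sum of pairs ([Fc_decomposes]).

    Since [C_c] is the additive category of formal sums of pairs, a full and faithful functor
    on pairs whose values generate the target under direct sums extends to an equivalence
    ([hull_equivalent]).

    Depth is handled through a condition without reference to bases: a morphism has depth at least
    [b] when its values are divisible by the structure maps of length [b] ([deep]). *)

(** * Direct sums in linear categories *)

Section HomSum.
Variables (A : comNzRingType) (C : lincat A).
Implicit Types X Y Z : C.

(** Morphisms are compared by [=~], so their sums form a monoid only up to [=~]. *)
Definition hsum X Y (I : Type) (s : seq I) (F : I -> hom X Y) : hom X Y :=
  foldr (fun i f => hadd (F i) f) (hzero X Y) s.

Lemma hsum_eq X Y (I : Type) (s : seq I) (F G : I -> hom X Y) :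
  (forall i, F i =~ G i) -> hsum s F =~ hsum s G.
Proof.
move=> e; elim: s => [|i s ih]; first exact: heq_refl.
exact: hadd_eq (e i) ih.
Qed.

Lemma hcomp_hsumr X Y Z (I : Type) (s : seq I) (g : hom Y Z) (F : I -> hom X Y) :
  hcomp g (hsum s F) =~ hsum s (fun i => hcomp g (F i)).
Proof.
elim: s => [|i s ih]; first exact: hcomp0r.
exact: heq_trans (hcompDr _ _ _) (hadd_eq (heq_refl _) ih).
Qed.

Lemma hcomp_hsuml X Y Z (I : Type) (s : seq I) (F : I -> hom Y Z) (g : hom X Y) :
  hcomp (hsum s F) g =~ hsum s (fun i => hcomp (F i) g).
Proof.
elim: s => [|i s ih]; first exact: hcomp0l.
exact: heq_trans (hcompDl _ _ _) (hadd_eq (heq_refl _) ih).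
Qed.

Lemma hsum_single X Y (I : finType) (F : I -> hom X Y) (k : I) :
  (forall i, i != k -> F i =~ hzero X Y) -> hsum (enum I) F =~ F k.
Proof.
move=> F0; have : k \in enum I by rewrite mem_enum.
elim: (enum I) (enum_uniq I) => //= i s ih /andP[si us].
rewrite inE; have [ki _|ne] := eqVneq k i.
  apply: heq_trans (hadd0r _); rewrite ki; apply: hadd_eq (heq_refl _) _.
  elim: s si {ih us} => [_|j s ih]; first exact: heq_refl.
  rewrite inE negb_or -ki => /andP[jk sk].
  by apply: heq_trans (hadd0 _); apply: hadd_eq; [apply: F0; rewrite eq_sym|apply: ih; rewrite -ki].
rewrite /= => ks; apply: heq_trans (hadd_eq (F0 _ _) (ih us ks)) (hadd0 _).
by rewrite eq_sym.
Qed.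

(** Completeness is joint monicity of the projections rather than [sum in pr = id],
    so that reindexing a decomposition needs no permutation of sums. *)
Record dsum_data (I : finType) (E : I -> C) (V : C) := DsumData {
  dsin : forall i, hom (E i) V;
  dspr : forall i, hom V (E i);
  dsprK : forall i, hcomp (dspr i) (dsin i) =~ hid (E i);
  dspr0 : forall i j, i != j -> hcomp (dspr j) (dsin i) =~ hzero (E i) (E j);
  dspr_inj : forall X (f g : hom X V),
    (forall i, hcomp (dspr i) f =~ hcomp (dspr i) g) -> f =~ g
}.

Lemma hcompAC X Y Z W (f : hom Z W) (g : hom Y Z) (h : hom X Y) k :
  hcomp g h =~ k -> hcomp (hcomp f g) h =~ hcomp f k.
Proof.
by move=> e; apply: heq_trans (heq_sym (hcompA _ _ _)) _; apply: hcomp_eq (heq_refl _) e.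
Qed.

Lemma hcompAC' X Y Z W (f : hom Z W) (g : hom Y Z) (h : hom X Y) k :
  hcomp f g =~ k -> hcomp f (hcomp g h) =~ hcomp k h.
Proof.
by move=> e; apply: heq_trans (hcompA _ _ _) _; apply: hcomp_eq e (heq_refl _).
Qed.

Lemma dsum_sum (I : finType) (E : I -> C) V (D : dsum_data E V) :
  hsum (enum I) (fun i => hcomp (dsin D i) (dspr D i)) =~ hid V.
Proof.
apply: (dspr_inj (d := D)) => k; apply: heq_trans (hcomp_hsumr _ _ _) _.
apply: heq_trans (hsum_single (k := k) _) _.
  move=> i ne; apply: heq_trans (hcompAC' _ (dspr0 D ne)) _; exact: hcomp0l.
apply: heq_trans (hcompAC' _ (dsprK D k)) _.
exact: heq_trans (hcomp1l _) (heq_sym (hcomp1r _)).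
Qed.

Lemma sum_pr_inj (I : finType) (E : I -> C) V (inn : forall i, hom (E i) V)
    (pr : forall i, hom V (E i)) :
  hsum (enum I) (fun i => hcomp (inn i) (pr i)) =~ hid V ->
  forall X (f g : hom X V),
    (forall i, hcomp (pr i) f =~ hcomp (pr i) g) -> f =~ g.
Proof.
move=> e X f g h; have aux (k : hom X V) :
    k =~ hsum (enum I) (fun i => hcomp (inn i) (hcomp (pr i) k)).
  apply: heq_sym; apply: heq_trans (hcomp1l k).
  apply: heq_trans (hcomp_eq e (heq_refl k)).
  apply: heq_trans (heq_sym (hcomp_hsuml _ _ _)).
  by apply: hsum_eq => i; apply: hcompA.
apply: heq_trans (aux f) _; apply: heq_trans _ (heq_sym (aux g)).
by apply: hsum_eq => i; apply: hcomp_eq (heq_refl _) (h i).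
Qed.

Lemma dsum_in_inj (I : finType) (E : I -> C) V (D : dsum_data E V)
    X (f g : hom V X) :
  (forall i, hcomp f (dsin D i) =~ hcomp g (dsin D i)) -> f =~ g.
Proof.
move=> h; have aux (k : hom V X) :
    k =~ hsum (enum I) (fun i => hcomp (hcomp k (dsin D i)) (dspr D i)).
  apply: heq_sym; apply: heq_trans (hcomp1r k).
  apply: heq_trans (hcomp_eq (heq_refl k) (dsum_sum D)).
  apply: heq_trans (heq_sym (hcomp_hsumr _ _ _)).
  by apply: hsum_eq => i; apply: heq_sym; apply: hcompA.
apply: heq_trans (aux f) _; apply: heq_trans _ (heq_sym (aux g)).
by apply: hsum_eq => i; apply: hcomp_eq (h i) (heq_refl _).
Qed.

Definition dsum_reindex (I J : finType) (E : I -> C) V (s : J -> I) :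
  bijective s -> dsum_data E V -> dsum_data (fun j => E (s j)) V.
Proof.
move=> bs D.
refine (@DsumData J _ V (fun j => dsin D (s j)) (fun j => dspr D (s j)) _ _ _).
- by move=> j; apply: (dsprK D).
- by move=> i j ne; apply: (dspr0 D); rewrite (inj_eq (bij_inj bs)).
move=> X f g h; apply: (dspr_inj (d := D)) => i.
by have [r _ sr] := bs; rewrite -[i]sr.
Defined.

Definition dsum_empty (E : void -> C) (V : C) :
  hid V =~ hzero V V -> dsum_data E V.
Proof.
move=> V0; apply: (@DsumData void E V (fun i => match i with end)
  (fun i => match i with end)) => [[]|[]|] // X f g _.
have aux (k : hom X V) : k =~ hzero X V.
  apply: heq_trans (heq_sym (hcomp1l k)) _.
  exact: heq_trans (hcomp_eq V0 (heq_refl k)) (hcomp0l _ _).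
exact: heq_trans (aux f) (heq_sym (aux g)).
Defined.

Definition ocons (I : Type) (E0 : C) (E : I -> C) (o : option I) : C :=
  if o is Some i then E i else E0.

Definition dsum_cons (I : finType) (E0 : C) (E : I -> C) (W V : C)
    (i : hom E0 V) (j : hom W V) (p : hom V E0) (q : hom V W) :
  [/\ hcomp p i =~ hid E0, hcomp q j =~ hid W, hcomp p j =~ hzero W E0,
      hcomp q i =~ hzero E0 W & hadd (hcomp i p) (hcomp j q) =~ hid V] ->
  dsum_data E W -> dsum_data (ocons E0 E) V.
Proof.
move=> [pi qj pj qi e1] D.
pose inn (o : option I) : hom (ocons E0 E o) V :=
  match o with Some k => hcomp j (dsin D k) | None => i end.
pose prr (o : option I) : hom V (ocons E0 E o) :=
  match o with Some k => hcomp (dspr D k) q | None => p end.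
have aux Y Z (f : hom W Z) (g : hom Y W) (k : hom Y Z) : hcomp f g =~ k ->
    hcomp (hcomp f q) (hcomp j g) =~ k.
  move=> e; apply: heq_trans (heq_sym (hcompA _ _ _)) _; apply: heq_trans e.
  apply: hcomp_eq (heq_refl _) _; apply: heq_trans (hcompAC' _ qj) _; exact: hcomp1l.
apply: (@DsumData _ _ V inn prr) => [[k|]|[k|] [l|] ne|X f g h] //=.
- exact: aux (dsprK D k).
- exact: aux (dspr0 D ne).
- exact: heq_trans (hcompAC' _ pj) (hcomp0l _ _).
- exact: heq_trans (hcompAC _ qi) (hcomp0r _ _).
have {}h : hcomp q f =~ hcomp q g /\ hcomp p f =~ hcomp p g.
  split; last exact: (h None).
  apply: (dspr_inj (d := D)) => k; apply: heq_trans (hcompA _ _ _) _.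
  exact: heq_trans (h (Some k)) (heq_sym (hcompA _ _ _)).
have aux2 (k : hom X V) :
    k =~ hadd (hcomp i (hcomp p k)) (hcomp j (hcomp q k)).
  apply: heq_sym; apply: heq_trans (hcomp1l k).
  apply: heq_trans (hcomp_eq e1 (heq_refl k)); apply: heq_sym.
  apply: heq_trans (hcompDl _ _ _) _.
  by apply: hadd_eq; apply: heq_sym; apply: hcompA.
apply: heq_trans (aux2 f) _; apply: heq_trans _ (heq_sym (aux2 g)).
by case: h => h1 h2; apply: hadd_eq; apply: hcomp_eq (heq_refl _) _.
Defined.

Lemma dsum_exists : has_biproducts C ->
  forall n (E : 'I_n -> C), exists V, inhabited (dsum_data E V).
Proof.
move=> [[Z Z0] bip]; elim=> [|n ih] E.
  exists Z; constructor.
  have D : dsum_data (fun x : void => match x with end) Z := dsum_empty _ Z0.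
  have nov (i : 'I_0) : void by case: i.
  have bv : bijective nov by exists (fun v : void => match v with end) => -[].
  have := dsum_reindex bv D.
  by congr (dsum_data _ _); apply: functional_extensionality_dep => -[].
have [W [D]] := ih (fun i => E (lift ord0 i)).
have [V [i [j [p [q bd]]]]] := bip (E ord0) W.
exists V; constructor.
have bu : bijective (@unlift n.+1 ord0).
  exists (fun o => if o is Some k then lift ord0 k else ord0) => [k|[k|]].
  - by case: unliftP.
  - by rewrite liftK.
  - by rewrite unlift_none.
have := dsum_reindex bu (dsum_cons bd D).
congr (dsum_data _ _); apply: functional_extensionality_dep => k.
by case: (unliftP ord0 k) => [k' ->|->].
Qed.

Definition dsum_iso (I : finType) (E : I -> C) V W (f : hom V W) (g : hom W V) :
  hcomp f g =~ hid W -> hcomp g f =~ hid V -> dsum_data E V -> dsum_data E W.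
Proof.
move=> fg gf D.
have aux Y Z (h : hom V Z) (k : hom Y V) :
    hcomp (hcomp h g) (hcomp f k) =~ hcomp h k.
  apply: heq_trans (heq_sym (hcompA _ _ _)) _.
  apply: hcomp_eq (heq_refl _) _; apply: heq_trans (hcompAC' _ gf) _.
  exact: hcomp1l.
apply: (@DsumData _ _ W (fun i => hcomp f (dsin D i)) (fun i => hcomp (dspr D i) g)).
- by move=> i; apply: heq_trans (aux _ _ _ _) (dsprK D i).
- by move=> i j ne; apply: heq_trans (aux _ _ _ _) (dspr0 D ne).
move=> X h k e.
have {}e : hcomp g h =~ hcomp g k.
  apply: (dspr_inj (d := D)) => i; apply: heq_trans (hcompA _ _ _) _.
  exact: heq_trans (e i) (heq_sym (hcompA _ _ _)).
have aux2 (l : hom X W) : l =~ hcomp f (hcomp g l).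
  apply: heq_sym; apply: heq_trans (hcompAC' _ fg) _; exact: hcomp1l.
apply: heq_trans (aux2 h) _; apply: heq_trans _ (heq_sym (aux2 k)).
exact: hcomp_eq (heq_refl _) e.
Defined.

End HomSum.

(** Joint monicity does not pass to a quotient, but the identity [sum in pr =~ id] does. *)
Definition dsum_quotient (A : comNzRingType) (C : lincat A) (J : lin_ideal C)
    (I : finType) (E : I -> C) (V : C) :
  dsum_data E V -> @dsum_data A (quotient_cat J) I E V.
Proof.
move=> D; apply: (@DsumData A (quotient_cat J) I E V (dsin D) (dspr D)).
- by move=> i; apply: qeq_heq; apply: (dsprK D).
- by move=> i j ne; apply: qeq_heq; apply: (dspr0 D).
apply: (@sum_pr_inj A (quotient_cat J)).
by apply: qeq_heq; apply: (dsum_sum D).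
Defined.

(** * Full and faithful functors *)

Section FullyFaithful.
Variables (A : comNzRingType) (C D : lincat A) (G : lin_functor C D).

(** The inverse chooses for every object an isomorphic value of [G] and carries morphisms along
    these isomorphisms; fullness lifts them and faithfulness proves all identities. *)
Lemma equivalent_of_full_faithful :
  (forall X Y (g : hom (G X) (G Y)), exists f : hom X Y, fmap G f =~ g) ->
  (forall X Y (f f' : hom X Y), fmap G f =~ fmap G f' -> f =~ f') ->
  (forall V : D, exists (X : C) (a : hom V (G X)) (b : hom (G X) V),
     hcomp a b =~ hid (G X) /\ hcomp b a =~ hid V) ->
  equivalent D C.
Proof.
move=> full faith ess.
pose H0 V := projT1 (cid (ess V)).
pose a V : hom V (G (H0 V)) := projT1 (cid (projT2 (cid (ess V)))).
pose b V : hom (G (H0 V)) V := projT1 (cid (projT2 (cid (projT2 (cid (ess V)))))).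
have [ab ba] : (forall V, hcomp (a V) (b V) =~ hid _) /\
               (forall V, hcomp (b V) (a V) =~ hid V).
  by split=> V; case: (projT2 (cid (projT2 (cid (projT2 (cid (ess V))))))).
pose H1 V W (f : hom V W) := projT1 (cid (full _ _ (hcomp (a W) (hcomp f (b V))))).
have H1E V W (f : hom V W) : fmap G (H1 V W f) =~ hcomp (a W) (hcomp f (b V)).
  exact: projT2 (cid (full _ _ (hcomp (a W) (hcomp f (b V))))).
have @H : lin_functor D C.
  refine (@LinFunctor A D C H0 H1 _ _ _ _ _).
  - move=> X Y f g e; apply: faith.
    apply: heq_trans (H1E _ _ _) _; apply: heq_trans _ (heq_sym (H1E _ _ _)).
    by apply: hcomp_eq (heq_refl _) _; apply: hcomp_eq e (heq_refl _).
  - move=> X; apply: faith; apply: heq_trans (H1E _ _ _) _.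
    apply: heq_trans (hcomp_eq (heq_refl _) (hcomp1l _)) _.
    exact: heq_trans (ab X) (heq_sym (fmap1 _ _)).
  - move=> X Y Z f g; apply: faith; apply: heq_trans (H1E _ _ _) _.
    apply: heq_sym; apply: heq_trans (fmapM _ _ _) _.
    apply: heq_trans (hcomp_eq (H1E _ _ _) (H1E _ _ _)) _.
    apply: heq_trans (heq_sym (hcompA _ _ _)) _; apply: hcomp_eq (heq_refl _) _.
    apply: heq_trans (heq_sym (hcompA _ _ _)) _.
    apply: heq_trans (hcompA _ _ _); apply: hcomp_eq (heq_refl _) _.
    apply: heq_trans (hcompAC' _ (ba Y)) _; exact: hcomp1l.
  - move=> X Y f g; apply: faith; apply: heq_trans (H1E _ _ _) _.
    apply: heq_sym; apply: heq_trans (fmapD _ _ _) _.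
    apply: heq_trans (hadd_eq (H1E _ _ _) (H1E _ _ _)) _.
    apply: heq_trans (heq_sym (hcompDr _ _ _)) _; apply: hcomp_eq (heq_refl _) _.
    exact: heq_sym (hcompDl _ _ _).
  - move=> X Y r f; apply: faith; apply: heq_trans (H1E _ _ _) _.
    apply: heq_sym; apply: heq_trans (fmapZ _ _ _) _.
    apply: heq_trans (hscale_eq _ (H1E _ _ _)) _.
    apply: heq_trans (heq_sym (hcompZr _ _ _)) _; apply: hcomp_eq (heq_refl _) _.
    exact: heq_sym (hcompZl _ _ _).
exists H, G; split.
  exists b, a; split=> //= V W f; apply: heq_trans (hcomp_eq (heq_refl _) (H1E _ _ _)) _.
  apply: heq_trans (hcompAC' _ (ba W)) _; exact: hcomp1l.
pose u X := projT1 (cid (full _ _ (a (G X)))).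
have uE X : fmap G (u X) =~ a (G X) by exact: projT2 (cid (full _ _ (a (G X)))).
pose v X := projT1 (cid (full _ _ (b (G X)))).
have vE X : fmap G (v X) =~ b (G X) by exact: projT2 (cid (full _ _ (b (G X)))).
exists v, u; split=> [X|X|X Y f] /=; apply: (faith); apply: heq_trans (fmapM _ _ _) _.
- apply: heq_trans (hcomp_eq (uE X) (vE X)) _.
  exact: heq_trans (ab _) (heq_sym (fmap1 _ _)).
- apply: heq_trans (hcomp_eq (vE X) (uE X)) _.
  exact: heq_trans (ba _) (heq_sym (fmap1 _ _)).
- apply: heq_sym; apply: heq_trans (fmapM _ _ _) _; apply: heq_sym.
  apply: heq_trans (hcomp_eq (vE Y) (H1E _ _ _)) _.
  apply: heq_trans (hcompAC' _ (ba _)) _.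
  apply: heq_trans (hcomp1l _) _; apply: hcomp_eq (heq_refl _) (heq_sym (vE X)).
Qed.

End FullyFaithful.

(** * Extension from pairs to formal direct sums *)

Section AdditiveHull.
Variables (RR : realType) (R : comNzRingType) (K : fieldType) (q : {rmorphism R -> K}).
Variables (c : RR) (c_itv : 0 < c < pi) (D : lincat R).
Local Notation cpair := (cpair c).
Local Notation chom := (@chom RR K c).
Variables (E : cpair -> D) (F : forall X Y, chom X Y -> hom (E X) (E Y)).
Hypothesis D_bip : has_biproducts D.
Hypothesis F_eq : forall X Y (f g : chom X Y), ccoef f = ccoef g -> F f =~ F g.
Hypothesis FD : forall X Y (f g h : chom X Y), ccoef h = ccoef f + ccoef g ->
  F h =~ hadd (F f) (F g).
Hypothesis FZ : forall X Y a (f h : chom X Y), ccoef h = q a * ccoef f ->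
  F h =~ hscale a (F f).
Hypothesis F1 : forall X (f : chom X X),
  ccoef f = (if cbasis X X == Some false then 1 else 0) -> F f =~ hid (E X).
Hypothesis FM : forall X Y Z (g : chom Y Z) (f : chom X Y),
  F (ccomp g f) =~ hcomp (F g) (F f).
Hypothesis F_full : forall X Y (g : hom (E X) (E Y)), exists f : chom X Y, F f =~ g.
Hypothesis F_faithful : forall X Y (f : chom X Y), F f =~ hzero _ _ -> ccoef f = 0.
Hypothesis F_ess : forall V : D, exists n (X : 'I_n -> cpair),
  inhabited (dsum_data (fun i => E (X i)) V).

Let Cq : lincat R := restrict_scalars q (Cc K c_itv).
Let sumex (X : cobj c) := dsum_exists D_bip (fun i : 'I_(csize X) => E (X i)).
Let S (X : cobj c) : D := projT1 (cid (sumex X)).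
Let SD (X : cobj c) : dsum_data (fun i : 'I_(csize X) => E (X i)) (S X).
Proof.
have h : exists d : dsum_data (fun i : 'I_(csize X) => E (X i)) (S X), True.
  by have [d] := projT2 (cid (sumex X)); exists d.
exact: projT1 (cid h).
Qed.

Lemma F0 X Y (f : chom X Y) : ccoef f = 0 -> F f =~ hzero _ _.
Proof.
move=> f0; apply: haddI0; apply: heq_sym; apply: FD.
by rewrite f0 addr0.
Qed.

Lemma hull_sum X Y (I : Type) (s : seq I) (f : I -> chom X Y) (h : chom X Y) :
  ccoef h = \sum_(i <- s) ccoef (f i) -> F h =~ hsum s (fun i => F (f i)).
Proof.
elim: s h => [|i s ih] h; rewrite ?big_nil ?big_cons => e; first exact: F0.
have s0 : cbasis X Y = None -> \sum_(j <- s) (f j : K) = 0.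
  by move=> n; rewrite big1// => j _; apply: ccoef0.
apply: heq_trans (@FD _ _ (f i) (CHom s0) h e) _.
exact: hadd_eq (heq_refl _) (ih (CHom s0) erefl).
Qed.

(** [F] acts on pairs; a matrix of morphisms of [C_c] is sent to the morphism between chosen direct
    sums that has the images of its coefficients as components. All functor laws are then checked
    on components. *)
Definition hull_map (X Y : cobj c) (f : cmat K X Y) : hom (S X) (S Y) :=
  hsum (enum 'I_(csize Y)) (fun j => hsum (enum 'I_(csize X)) (fun i =>
    hcomp (dsin (SD Y) j) (hcomp (F (f j i)) (dspr (SD X) i)))).

Lemma hull_entry X Y (f : cmat K X Y) j i :
  hcomp (dspr (SD Y) j) (hcomp (hull_map f) (dsin (SD X) i)) =~ F (f j i).
Proof.
have col k : hcomp (hsum (enum 'I_(csize X)) (fun i =>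
    hcomp (dsin (SD Y) k) (hcomp (F (f k i)) (dspr (SD X) i)))) (dsin (SD X) i) =~
    hcomp (dsin (SD Y) k) (F (f k i)).
  apply: heq_trans (hcomp_hsuml _ _ _) _.
  apply: heq_trans (hsum_single (k := i) _) _.
    move=> l li; apply: heq_trans (hcompAC _ (hcompAC _ (dspr0 (SD X) _))) _.
      by rewrite eq_sym.
    apply: heq_trans (hcomp_eq (heq_refl _) (hcomp0r _ _)) _; exact: hcomp0r.
  apply: heq_trans (hcompAC _ (hcompAC _ (dsprK (SD X) i))) _.
  by apply: hcomp_eq (heq_refl _) (hcomp1r _).
apply: heq_trans (hcomp_eq (heq_refl _) (hcomp_hsuml _ _ _)) _.
apply: heq_trans (hcomp_hsumr _ _ _) _.
apply: heq_trans (hsum_single (k := j) _) _ => [k kj|].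
  apply: heq_trans (hcomp_eq (heq_refl _) (col k)) _.
  apply: heq_trans (hcompAC' _ (dspr0 (SD Y) kj)) _; exact: hcomp0l.
apply: heq_trans (hcomp_eq (heq_refl _) (col j)) _.
apply: heq_trans (hcompAC' _ (dsprK (SD Y) j)) _; exact: hcomp1l.
Qed.

Lemma hull_ext X Y (g h : hom (S X) (S Y)) :
  (forall j i, hcomp (dspr (SD Y) j) (hcomp g (dsin (SD X) i)) =~
               hcomp (dspr (SD Y) j) (hcomp h (dsin (SD X) i))) -> g =~ h.
Proof.
move=> e; apply: (dsum_in_inj (D := SD X)) => i.
by apply: (dspr_inj (d := SD Y)) => j.
Qed.

Lemma hull_extF X Y (f : cmat K X Y) (g : hom (S X) (S Y)) :
  (forall j i, F (f j i) =~ hcomp (dspr (SD Y) j) (hcomp g (dsin (SD X) i))) ->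
  hull_map f =~ g.
Proof.
by move=> e; apply: hull_ext => j i; apply: heq_trans (hull_entry _ _ _) (e j i).
Qed.

Lemma entryM X Y Z (g : hom (S Y) (S Z)) (f : hom (S X) (S Y)) k i :
  hcomp (dspr (SD Z) k) (hcomp (hcomp g f) (dsin (SD X) i)) =~
  hsum (enum 'I_(csize Y)) (fun j =>
    hcomp (hcomp (dspr (SD Z) k) (hcomp g (dsin (SD Y) j)))
          (hcomp (dspr (SD Y) j) (hcomp f (dsin (SD X) i)))).
Proof.
have aux : f =~ hsum (enum 'I_(csize Y)) (fun j =>
    hcomp (dsin (SD Y) j) (hcomp (dspr (SD Y) j) f)).
  apply: heq_sym; apply: heq_trans (hcomp1l f).
  apply: heq_trans (hcomp_eq (dsum_sum (SD Y)) (heq_refl f)).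
  apply: heq_trans (heq_sym (hcomp_hsuml _ _ _)).
  by apply: hsum_eq => j; apply: hcompA.
apply: heq_trans (hcomp_eq (heq_refl _) (hcomp_eq (hcomp_eq (heq_refl g) aux) (heq_refl _))) _.
apply: heq_trans (hcomp_eq (heq_refl _) (hcomp_eq (hcomp_hsumr _ _ _) (heq_refl _))) _.
apply: heq_trans (hcomp_eq (heq_refl _) (hcomp_hsuml _ _ _)) _.
apply: heq_trans (hcomp_hsumr _ _ _) _.
apply: hsum_eq => j; apply: heq_trans (hcompA _ _ _).
apply: hcomp_eq (heq_refl _) _.
apply: heq_trans (hcompA _ _ _); apply: heq_trans (heq_sym (hcompA _ _ _)) _.
apply: hcomp_eq (heq_refl _) _; apply: heq_trans (heq_sym (hcompA _ _ _)) _.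
by apply: hcomp_eq (heq_refl _) _; apply: heq_sym; apply: hcompA.
Qed.

Definition hull_functor : lin_functor Cq D.
Proof.
refine (@LinFunctor R Cq D S hull_map _ _ _ _ _).
- move=> X Y f g e; apply: hull_extF => j i.
  apply: heq_trans (F_eq (e j i)) _; apply: heq_sym; exact: hull_entry.
- move=> X; apply: hull_extF => j i.
  apply: heq_trans _ (hcomp_eq (heq_refl _) (heq_sym (hcomp1l _))).
  have [<-|ne] := eqVneq i j.
    apply: heq_trans (F1 _) (heq_sym (dsprK (SD X) i)).
    by rewrite /= eqxx.
  apply: heq_trans (F0 _) (heq_sym (dspr0 (SD X) ne)).
  by rewrite /= (negbTE ne).
- move=> X Y Z g f; apply: hull_extF => k i.
  apply: heq_trans _ (heq_sym (entryM _ _ _ _)).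
  apply: heq_trans (hull_sum (s := enum 'I_(csize Y)) (f := fun j => ccomp (g k j) (f j i)) _) _.
    by rewrite /= enumT.
  apply: hsum_eq => j; apply: heq_trans (FM _ _) _.
  by apply: hcomp_eq; apply: heq_sym; apply: hull_entry.
- move=> X Y f g.
  apply: (@hull_extF _ _ (cmat_add (f : cmat K X Y) (g : cmat K X Y))) => j i.
  have hd : F (cmat_add (f : cmat K X Y) (g : cmat K X Y) j i) =~
      hadd (F (f j i)) (F (g j i)) by exact: FD.
  apply: (heq_trans hd).
  apply: heq_trans _ (hcomp_eq (heq_refl _) (heq_sym (hcompDl _ _ _))).
  apply: heq_trans _ (heq_sym (hcompDr _ _ _)).
  by apply: hadd_eq; apply: heq_sym; apply: hull_entry.
- move=> X Y a f; apply: (@hull_extF _ _ (cmat_scale (q a) (f : cmat K X Y))) => j i.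
  have hz : F (cmat_scale (q a) f j i) =~ hscale a (F (f j i)) by exact: FZ.
  apply: (heq_trans hz).
  apply: heq_trans _ (hcomp_eq (heq_refl _) (heq_sym (hcompZl _ _ _))).
  apply: heq_trans _ (heq_sym (hcompZr _ _ _)).
  by apply: hscale_eq; apply: heq_sym; apply: hull_entry.
Defined.

Theorem hull_equivalent : equivalent D Cq.
Proof.
apply: (equivalent_of_full_faithful (G := hull_functor)).
- move=> X Y g.
  pose f : cmat K X Y := fun j i =>
    projT1 (cid (F_full (hcomp (dspr (SD Y) j) (hcomp g (dsin (SD X) i))))).
  exists f; apply: hull_extF => j i.
  exact: projT2 (cid (F_full (hcomp (dspr (SD Y) j) (hcomp g (dsin (SD X) i))))).
- move=> X Y f f' e j i /=.
  pose h : chom (X i) (Y j) := CHom (@cadd_subproof _ _ _ _ _ (f j i)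
    (CHom (@cscale_subproof _ _ _ _ _ (- 1) (f' j i)))).
  suff : ccoef h = 0 by rewrite /= mulN1r => /eqP; rewrite subr_eq0 => /eqP.
  have f'E : F (CHom (@cscale_subproof _ _ _ _ _ (- 1) (f' j i))) =~ hopp (F (f' j i)).
    apply: heq_trans (hoppZ _); apply: FZ.
    by rewrite /= rmorphN rmorph1.
  apply: F_faithful; apply: heq_trans (@FD _ _ (f j i) _ h erefl) _.
  apply: heq_trans (hadd_eq (heq_refl _) f'E) _.
  apply: heq_trans (haddC _ _) _; apply: heq_trans (haddN (F (f j i))).
  apply: hadd_eq (heq_refl _); apply: hopp_eq.
  apply: heq_trans (heq_sym (hull_entry _ _ _)) _.
  apply: heq_trans (hull_entry f j i).
  apply: hcomp_eq (heq_refl _) _; apply: hcomp_eq (heq_refl _); exact: heq_sym.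
move=> V; have [n [X [DV]]] := F_ess V.
pose SX : dsum_data (fun i : 'I_n => E (X i)) (S (CObj X)) := SD (CObj X).
have iso W W' (D1 : dsum_data (fun i => E (X i)) W) (D2 : dsum_data (fun i => E (X i)) W') :
    hcomp (hsum (enum 'I_n) (fun i => hcomp (dsin D1 i) (dspr D2 i)))
          (hsum (enum 'I_n) (fun i => hcomp (dsin D2 i) (dspr D1 i))) =~ hid W.
  apply: (dspr_inj (d := D1)) => k; apply: heq_trans _ (heq_sym (hcomp1r _)).
  have aux U U' (d1 : dsum_data (fun i => E (X i)) U) (d2 : dsum_data (fun i => E (X i)) U') :
      hcomp (dspr d1 k) (hsum (enum 'I_n) (fun i => hcomp (dsin d1 i) (dspr d2 i)))
      =~ dspr d2 k.
    apply: heq_trans (hcomp_hsumr _ _ _) _.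
    apply: heq_trans (hsum_single (k := k) _) _ => [i ne|].
      apply: heq_trans (hcompAC' _ (dspr0 d1 ne)) _; exact: hcomp0l.
    apply: heq_trans (hcompAC' _ (dsprK d1 k)) _; exact: hcomp1l.
  apply: heq_trans (hcompAC' _ (aux _ _ D1 D2)) _; exact: aux.
exists (CObj X), (hsum (enum 'I_n) (fun i => hcomp (dsin SX i) (dspr DV i))),
  (hsum (enum 'I_n) (fun i => hcomp (dsin DV i) (dspr SX i))).
by split; apply: iso.
Qed.

End AdditiveHull.

(** * Discrete valuation rings *)

Section DVR.
Variables (R : idomainType) (t : R).
Hypotheses (R_dvr : is_dvr R) (t_unif : is_uniformizer t).

Lemma principal_ideal (a : R) : is_ideal (principal a).
Proof.
split=> [|x y [r ->] [s ->]|r x [s ->]].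
- by exists 0; rewrite mul0r.
- by exists (r + s); rewrite mulrDl.
- by exists (r * s); rewrite mulrA.
Qed.

Lemma uniformizer_nunit : t \isn't a GRing.unit.
Proof.
apply/negP => tu; have [_ h _] := t_unif; apply: h.
by exists t^-1; rewrite mulVr.
Qed.

(** Otherwise the zero ideal would be maximal, and every nonzero element a unit. *)
Lemma uniformizer_neq0 : t != 0.
Proof.
apply/eqP => t0; have [_ _ _ [a [a0 au]]] := R_dvr; have [_ _ tmax] := t_unif.
have : principal t a.
  apply: (tmax _ (principal_ideal a)); last by exists 1; rewrite mul1r.
    move=> [r e]; move/negP: au; apply; apply/unitrP; exists r.
    by rewrite -e mulrC -e.
  by move=> _ [r ->]; exists 0; rewrite t0 mulr0 mul0r.
by move=> [r e]; move/eqP: a0; rewrite e t0 mulr0.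
Qed.

(** Zorn's lemma puts a non-unit into a maximal ideal, and [(t)] is the only one. *)
Lemma nonunit_in_principal (r : R) : r \isn't a GRing.unit -> principal t r.
Proof.
move=> ru.
pose P (A : set R) := [/\ A r, ~ A 1, forall a b, A a -> A b -> A (a + b) &
  forall s a, A a -> A (s * a)].
pose P' (A : set R) := (forall x, ~ A x) \/ P A.
have PrP : P (principal r).
  split; [by exists 1; rewrite mul1r| |by case: (principal_ideal r)..].
  by move=> [s e]; move/negP: ru; apply; apply/unitrP; exists s; rewrite -e mulrC -e.
have [F FP' Ftot|A [PA Amax]] := @Zorn_bigcup R P'.
  have [[A [FA [x Ax]]]|none] := pselect (exists A, F A /\ exists x, A x); last first.
    by left=> x [A FA Ax]; apply: none; exists A; split=> //; exists x.
  have FP B y : F B -> B y -> P B by move=> /FP'[/(_ y)|].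
  right; have [Ar _ _ _] := FP _ _ FA Ax; split.
  - by exists A.
  - by move=> [B FB B1]; have [_ h _ _] := FP _ _ FB B1; apply: h.
  - move=> a b [B FB Ba] [B' FB' Bb]; have [_ _ h _] := FP _ _ FB Ba.
    have [_ _ h' _] := FP _ _ FB' Bb.
    have [BB'|BB'] := Ftot _ _ FB FB'.
      by exists B' => //; apply: h' => //; apply: BB'.
    by exists B => //; apply: h => //; apply: BB'.
  - move=> s a [B FB Ba]; have [_ _ _ h] := FP _ _ FB Ba.
    by exists B => //; apply: h.
have {}PA : P A.
  case: PA => // A0; exfalso; apply: (Amax (principal r)); last by right.
  split=> [|h]; first by move=> x /A0.
  by apply: (A0 r); apply: h; exists 1; rewrite mul1r.
have [Ar A1 AD AM] := PA.
have Aid : is_ideal A by split=> //; rewrite -(mul0r r); apply: AM.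
have Am : is_maximal A.
  split=> // J Jid J1 AJ a Ja; apply: contrapT => nAa; apply: (Amax J).
    by split=> // h; apply: nAa; apply: h.
  by right; split=> //; [apply: AJ|case: Jid..].
have [_ _ uniq _] := R_dvr.
exact/(uniq _ _ Am t_unif).
Qed.

(** The elements divisible by all powers of [t] form a principal ideal [(a)] such that [a] is [t]
    times another element of [(a)]; as [t] is not a unit, [a = 0]. *)
Lemma dvr_factor (r : R) : r != 0 ->
  exists n (u : R), u \is a GRing.unit /\ r = u * t ^+ n.
Proof.
move=> r0; have [[n nd]|alld] := pselect (exists n, ~ principal (t ^+ n) r).
  elim: n nd => [|n ih] nd.
    by exfalso; apply: nd; exists r; rewrite expr0 mulr1.
  have [[s e]|] := pselect (principal (t ^+ n) r); last exact: ih.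
  exists n, s; split=> //; apply: contrapT => /negP /nonunit_in_principal[s' e'].
  by apply: nd; exists s'; rewrite e e' exprS mulrA.
exfalso; have [pid _ _ _] := R_dvr.
pose I a := forall n, principal (t ^+ n) a.
have [|a aI] := pid I.
  split=> [n|a b Ia Ib n|s a Ia n]; have [h1 h2 h3] := principal_ideal (t ^+ n) => //.
  - by apply: h2.
  - by apply: h3.
have Ir : I r by move=> n; apply: contrapT => h; apply: alld; exists n.
have a0 : a != 0.
  by apply: contraNneq r0 => a0; have /aI[s ->] := Ir; rewrite a0 mulr0.
have Ia : I a by apply/aI; exists 1; rewrite mul1r.
have [b e] := Ia 1%N; rewrite expr1 in e.
have /aI[s es] : I b.
  move=> n; have [d ed] := Ia n.+1; exists d.
  by apply: (mulIf uniformizer_neq0); rewrite -e ed exprSr mulrA.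
move/negP: uniformizer_nunit; apply; apply/unitrP; exists s.
have {}e : s * t = 1 by apply: (mulIf a0); rewrite mul1r -mulrA [t * a]mulrC mulrA -es -e.
by rewrite e mulrC e.
Qed.

Lemma unif_pow_unit (u v : R) m n : u \is a GRing.unit -> v \is a GRing.unit ->
  u * t ^+ m = v * t ^+ n -> m = n.
Proof.
wlog le_mn : u v m n / (m <= n)%N.
  move=> h uu vu e; case/orP: (leq_total m n) => le; first exact: h e.
  by apply/esym; apply: h (esym e).
move=> uu vu; rewrite -(subnKC le_mn) exprD mulrCA mulrA [u * _]mulrC -mulrA.
move/(mulfI (expf_neq0 m uniformizer_neq0)); case: (n - m)%N => [|k e].
  by rewrite addn0.
exfalso; move: uu; rewrite e unitrM vu /= exprS unitrM.
by rewrite (negbTE uniformizer_nunit).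
Qed.

End DVR.

(** * Arcs on the circle *)

Section Arcs.
Variable RR : realType.
Local Notation circle := (circle RR).
Implicit Types x p q : circle.

Lemma arc_ang x p : arc x p (ang (x - p)).
Proof.
by rewrite /arc angK subKr eqxx andbT; case/andP: (ang_itv (x - p)).
Qed.

Lemma arc_pre p (a : RR) : 0 <= a -> arc (p + cls a) p a.
Proof. by move=> a0; rewrite /arc a0 addrK eqxx. Qed.

Lemma arc_refl p : arc p p 0.
Proof. by rewrite /arc lexx cls0 subr0 eqxx. Qed.

Lemma cls_2pi : cls (2 * pi) = 0 :> circle.
Proof. by rewrite -(clsM2pi _ 1) mul1r. Qed.

Lemma arc_2pi p : arc p p (2 * pi).
Proof. by rewrite /arc ltW ?twopi_gt0//= cls_2pi subr0 eqxx. Qed.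

Lemma arc_cls p q (a : RR) : arc p q a -> cls a = p - q.
Proof. by move/arc_end->; rewrite subKr. Qed.

Lemma arcP p q (a : RR) : 0 <= a -> cls a = p - q -> arc p q a.
Proof. by move=> a0 e; rewrite /arc a0 e subKr eqxx. Qed.

Lemma ang_cls (a : RR) : 0 <= a < 2 * pi -> ang (cls a) = a.
Proof.
move=> /andP[a0 a1]; have /andP[b0 b1] := ang_itv (cls a).
by apply: cls_inj_itv; rewrite ?angK// ltr_norml; apply/andP; split; lra.
Qed.

Lemma ang_arc p q (a : RR) : arc p q a -> a < 2 * pi -> ang (p - q) = a.
Proof.
by move=> h a2; rewrite -(arc_cls h) ang_cls// a2 (arc_ge0 h).
Qed.

Lemma ang0 : ang (0 : circle) = 0.
Proof. by rewrite -[X in ang X]cls0 ang_cls// lexx twopi_gt0. Qed.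

Lemma turns_small x (a : RR) : 0 <= a < 2 * pi -> turns x x a = 0%N.
Proof.
move=> /andP[a0 a2]; rewrite /turns subrr ang0 add0r.
by apply: truncn_def; rewrite divr_ge0 ?(ltW (twopi_gt0 RR))//= ltr_pdivrMr ?twopi_gt0// mul1r.
Qed.

Lemma turns_gt0 x p (a : RR) : 2 * pi <= ang (x - p) + a -> (0 < turns x p a)%N.
Proof.
move=> h; rewrite /turns truncn_gt0 ler_pdivlMr ?twopi_gt0// mul1r.
exact: h.
Qed.

End Arcs.

(** * Free representations and their generators *)

Section Psum.
Variables (RR : realType) (R : idomainType) (t : R).
Local Notation circle := (circle RR).
Local Notation rep := (rep RR t).

Section Rmap.
Variable V : rep.

Lemma rmap_irr p q a b (h : arc p q a) (h' : arc p q b) v :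
  a = b -> rmap V h v = rmap V h' v.
Proof. by move=> e; subst b; rewrite (bool_irrelevance h h'). Qed.

Lemma rmapC p q r a b c (h : arc p q a) (h' : arc q r b) (h'' : arc p r c) v :
  c = a + b -> rmap V h' (rmap V h v) = rmap V h'' v.
Proof.
move=> e; have k : arc p r (b + a) by rewrite addrC -e.
by rewrite (rmapD _ _ k); apply: rmap_irr; rewrite e addrC.
Qed.

Lemma rmap_0 p (h : arc p p 0) v : rmap V h v = v.
Proof.
have k : arc p p (2 * pi * 0%:R) by rewrite mulr0.
have -> : rmap V h v = rmap V k v by apply: rmap_irr; rewrite mulr0.
by rewrite rmap_turns expr0 scale1r.
Qed.

Lemma rmap_full p q a b n (h : arc p q a) (h' : arc p q b) v :
  a = b + n%:R * (2 * pi) -> rmap V h v = t ^+ n *: rmap V h' v.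
Proof.
move=> e; have k : arc q q (2 * pi * n%:R).
  apply: arcP; first by rewrite mulr_ge0 ?ler0n// ltW// twopi_gt0.
  by rewrite mulrC -[n%:R]/((Posz n)%:~R) clsM2pi subrr.
rewrite -(rmap_turns k); apply/esym; apply: rmapC.
by rewrite e [n%:R * _]mulrC.
Qed.

Lemma rmap_2pi p (h : arc p p (2 * pi)) v : rmap V h v = t *: v.
Proof.
rewrite (rmap_full (n := 1) h (arc_refl p)) ?rmap_0 ?expr1//.
by rewrite add0r mul1r.
Qed.

End Rmap.

Section Generators.
Variables (I : finType) (x : I -> circle).

Definition gen (k : I) : psum t x (x k) := [ffun i => if i == k then 1 else 0].

Lemma psum_rmapE p q a (h : arc p q a) v i :
  (rmap (psum t x) h v : {ffun I -> R^o}) i = t ^+ turns (x i) p a * (v : {ffun I -> R^o}) i.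
Proof. by rewrite /= ffunE. Qed.

Lemma rmap_genE k p a (h : arc (x k) p a) i :
  (rmap (psum t x) h (gen k) : {ffun I -> R^o}) i =
  if i == k then t ^+ turns (x k) (x k) a else 0.
Proof.
rewrite psum_rmapE ffunE; case: eqP => [->|_]; last by rewrite mulr0.
by rewrite mulr1.
Qed.

Lemma rmap_gen_ang k p i :
  (rmap (psum t x) (arc_ang (x k) p) (gen k) : {ffun I -> R^o}) i = if i == k then 1 else 0.
Proof. by rewrite rmap_genE turns_small ?expr0// ang_itv. Qed.

Lemma psum_decomp p (v : psum t x p) :
  v = \sum_k (v : {ffun I -> R^o}) k *: rmap (psum t x) (arc_ang (x k) p) (gen k).
Proof.
apply/ffunP => i; rewrite sum_ffunE (bigD1 i)//= big1 => [|k ki].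
  by rewrite addr0 !ffunE/= eqxx turns_small ?ang_itv// expr0 scale1r /GRing.scale/= mulr1.
by rewrite !ffunE eq_sym (negbTE ki) !scaler0.
Qed.

Variables (W : rep) (w : forall k, W (x k)).

Let lift_fun p (v : psum t x p) : W p :=
  \sum_k (v : {ffun I -> R^o}) k *: rmap W (arc_ang (x k) p) (w k).

Lemma psum_lift_linear p : linear (@lift_fun p).
Proof.
move=> a u v; rewrite /lift_fun scaler_sumr -big_split /=; apply: eq_bigr => k _.
by rewrite !ffunE scalerDl scalerA.
Qed.

(** [psum t x] is free on the generators [gen k]: at the point [p] the basis element of the summand
    [k] is the image of [gen k] under the shortest arc from [x k] to [p]. *)
Definition psum_lift : rhom (psum t x) W.
Proof.
exists (fun p => mklinear (@psum_lift_linear p)) => p q a h v /=.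
rewrite /lift_fun linear_sum; apply: eq_bigr => k _ /=.
have hk := arc_trans (arc_ang (x k) p) h.
rewrite linearZ /= (rmapC _ _ hk)// ffunE.
rewrite (rmap_full (n := turns (x k) p a) hk (arc_ang (x k) q)) ?(turnsE (x k) h)//.
by rewrite scalerA mulrC.
Defined.

Lemma psum_liftE p (v : psum t x p) : psum_lift p v =
  \sum_k (v : {ffun I -> R^o}) k *: rmap W (arc_ang (x k) p) (w k).
Proof. by []. Qed.

Lemma psum_lift_gen k : psum_lift (x k) (gen k) = w k.
Proof.
rewrite psum_liftE (bigD1 k)//= big1 => [|i ik].
  rewrite ffunE eqxx scale1r addr0.
  have -> : rmap W (arc_ang (x k) (x k)) (w k) = rmap W (arc_refl (x k)) (w k).
    by apply: rmap_irr; rewrite subrr ang0.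
  by rewrite rmap_0.
by rewrite ffunE (negbTE ik) scale0r.
Qed.

End Generators.

Lemma psum_ext (I : finType) (x : I -> circle) (W : rep) (f g : rhom (psum t x) W) :
  (forall k, f (x k) (gen x k) = g (x k) (gen x k)) -> rhom_eq f g.
Proof.
move=> e p v; rewrite (psum_decomp v) !linear_sum; apply: eq_bigr => k _.
by rewrite !linearZ -!rfun_nat e.
Qed.

Lemma psum_projective (I : finType) (x : I -> circle) : projective_rep (psum t x).
Proof.
move=> V W g eg h.
pose v k := projT1 (cid (eg (x k) (h (x k) (gen x k)))).
have vE k : g (x k) (v k) = h (x k) (gen x k).
  exact: projT2 (cid (eg (x k) (h (x k) (gen x k)))).
exists (psum_lift v); apply: psum_ext => k /=.
by rewrite -vE; congr (g _ _); apply: psum_lift_gen.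
Qed.

Lemma psum_fg (I : finType) (x : I -> circle) : finitely_generated (psum t x).
Proof. by exists I, x, (rid _) => p w; exists w. Qed.

Hypothesis t0 : t != 0.

Definition free_rep (V : rep) : Prop :=
  exists (I : finType) (x : I -> circle), inhabited (riso V (psum t x)).

Lemma free_rmap_inj V : free_rep V ->
  forall p q a (h : arc p q a), injective (rmap V h).
Proof.
move=> [I [x [phi]]] p q a h u v e.
rewrite -[u](riso_toK phi) -[v](riso_toK phi) /=; congr (riso_inv phi p _).
have : rmap (psum t x) h (phi p u) = rmap (psum t x) h (phi p v).
  by rewrite !rfun_nat e.
move=> /ffunP e'; apply/ffunP => i; move: (e' i); rewrite !psum_rmapE.
by apply: mulfI; apply: expf_neq0.
Qed.

(** [deep b f] says that [f] has depth at least [b]. Unlike the depth, which is read off a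
    decomposition, this condition visibly does not depend on one. *)
Definition deep (b : RR) (V W : rep) (f : rhom V W) : Prop :=
  forall p q (h : arc q p b) v, exists w, rmap W h w = f p v.

End Psum.

(** * Depth as divisibility by structure maps *)

Section Depth.
Variables (RR : realType) (R : idomainType) (t : R).
Hypotheses (R_dvr : is_dvr R) (t_unif : is_uniformizer t).
Local Notation circle := (circle RR).
Local Notation rep := (rep RR t).
Let t0 : t != 0 := uniformizer_neq0 R_dvr t_unif.

Lemma deep_comp_l (b : RR) (U V W : rep) (g : rhom V W) (f : rhom U V) :
  deep b f -> deep b (rcomp g f).
Proof.
by move=> df p q h v /=; have [w <-] := df _ _ h v; exists (g q w); rewrite rfun_nat.
Qed.

Lemma deep_comp_r (b : RR) (U V W : rep) (g : rhom V W) (f : rhom U V) :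
  deep b g -> deep b (rcomp g f).
Proof. by move=> dg p q h v /=; apply: dg. Qed.

Lemma deep_eq (b : RR) (V W : rep) (f g : rhom V W) :
  rhom_eq f g -> deep b f -> deep b g.
Proof. by move=> e df p q h v; rewrite -e; apply: df. Qed.

(** A witness at a generator, found a distance [b] before it, is carried along the arc from the
    generator to [p]; this commutes with the structure map of length [b]. *)
Lemma deep_gens (b : RR) (I : finType) (x : I -> circle) (W : rep) (f : rhom (psum t x) W) :
  (forall k q (h : arc q (x k) b), exists w, rmap W h w = f (x k) (gen t x k)) ->
  deep b f.
Proof.
move=> df p q h v; have b0 := arc_ge0 h.
pose w k := projT1 (cid (df k _ (arc_pre (x k) b0))).
have wE k : rmap W (arc_pre (x k) b0) (w k) = f (x k) (gen t x k).
  exact: projT2 (cid (df k _ (arc_pre (x k) b0))).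
have hk k : arc (x k + cls b) q (ang (x k - p)).
  apply: arcP; first by case/andP: (ang_itv (x k - p)).
  by rewrite angK (arc_cls h) addrA addrAC addrK.
exists (\sum_k (v : {ffun I -> R^o}) k *: rmap W (hk k) (w k)).
rewrite [in RHS](psum_decomp v) !linear_sum; apply: eq_bigr => k _.
rewrite !linearZ -rfun_nat -wE; congr (_ *: _).
have ha := arc_trans (arc_pre (x k) b0) (arc_ang (x k) p).
by rewrite (rmapC _ _ ha) ?(rmapC _ _ ha)// addrC.
Qed.

(** A nonzero entry [u * t ^+ n] has depth [ang (y - x) + 2 pi n], and divisibility by the
    structure map of length [b] is a lower bound for the valuation [n]. *)
Lemma depth1_geP (b : RR) (x y q : circle) (h : arc q x b)
    (f : rhom (prep t x) (prep t y)) :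
  (b%:E <= depth1 f)%E <->
  exists s, f x (1 : R^o) = t ^+ turns y q b * s :> R.
Proof.
have eq_b := turnsE y h; have b0 := arc_ge0 h; have p0 := twopi_gt0 RR.
have /andP[q0 q1] := ang_itv (y - q); have /andP[x0 x1] := ang_itv (y - x).
have key u a (ha : arc y x a) : f x (1 : R^o) = u *: pgen t ha ->
    f x (1 : R^o) = u * t ^+ turns y y a :> R.
  by move=> ->; rewrite /pgen/= /GRing.scale/= mulr1.
split.
  have [->|f0] := eqVneq (f x (1 : R^o)) 0; first by exists 0; rewrite mulr0.
  rewrite /depth1; case: asboolP => [e|_ le]; first by rewrite e eqxx in f0.
  have [n [u [uu e]]] := dvr_factor R_dvr t_unif f0.
  have an : arc y x (ang (y - x) + n%:R * (2 * pi)).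
    apply: arcP; first by rewrite addr_ge0// mulr_ge0// ltW.
    by rewrite clsD angK -[n%:R]/((Posz n)%:~R) clsM2pi addr0.
  have tn : turns y y (ang (y - x) + n%:R * (2 * pi)) = n.
    apply/eqP; rewrite -(eqr_nat RR); apply/eqP; apply: (mulIf (lt0r_neq0 p0)).
    by have := turnsE y an; rewrite subrr ang0; lra.
  have {le} : b <= ang (y - x) + n%:R * (2 * pi).
    rewrite -lee_fin; apply: le_trans le _; apply: ereal_inf_lbound.
    exists (ang (y - x) + n%:R * (2 * pi)) => //; exists an, u; split=> //.
    by rewrite /pgen /= tn /GRing.scale /= mulr1.
  move=> le.
  have mn : (turns y q b <= n)%N.
    rewrite -ltnS -(ltr_nat RR) -(ltr_pM2r p0) -[n.+1%:R]natr1 mulrDl mul1r; lra.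
  by exists (u * t ^+ (n - turns y q b)); rewrite mulrCA -exprD subnKC.
move=> [s e]; rewrite /depth1; case: asboolP => [_|_]; first exact: leey.
apply: le_ereal_inf_tmp => _ [a [ha [u [uu /key e']]] <-]; rewrite lee_fin.
have s0 : s != 0.
  apply/eqP => s0; move: e'; rewrite e s0 mulr0 => /esym/eqP.
  rewrite mulf_eq0 (negbTE (expf_neq0 _ t0)) orbF => /eqP u0.
  by move: uu; rewrite u0 unitr0.
have [k [u' [uu' es]]] := dvr_factor R_dvr t_unif s0.
have {}e' : turns y y a = (turns y q b + k)%N.
  apply: (unif_pow_unit R_dvr t_unif uu uu').
  by rewrite -e' e es exprD mulrCA.
have := turnsE y ha; rewrite subrr ang0 e' natrD mulrDl add0r => ->.
have : 0 <= k%:R * (2 * pi) :> RR by rewrite mulr_ge0// ltW.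
lra.
Qed.

Lemma psum_entry (I J : finType) (x : I -> circle) (y : J -> circle)
    (f : rhom (psum t x) (psum t y)) i j :
  rcomp (pproj t y j) (rcomp f (pin t x i)) (x i) (1 : R^o) =
  (f (x i) (gen t x i) : {ffun J -> R^o}) j.
Proof. by []. Qed.

Lemma deep_psumP (b : RR) (b0 : 0 <= b) (I J : finType) (x : I -> circle) (y : J -> circle)
    (f : rhom (psum t x) (psum t y)) :
  (b%:E <= depth_psum f)%E <-> deep b f.
Proof.
split=> [/depth_psum_ge h|h]; last first.
  apply/depth_psum_ge => i j; apply/(depth1_geP (arc_pre (x i) b0)).
  have [w e] := h _ _ (arc_pre (x i) b0) (gen t x i).
  exists ((w : {ffun J -> R^o}) j).
  by rewrite psum_entry -e psum_rmapE.
apply: deep_gens => k q hq.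
have /choice[s sE] : forall j, exists s,
    (f (x k) (gen t x k) : {ffun J -> R^o}) j = t ^+ turns (y j) q b * s :> R.
  by move=> j; have /(depth1_geP hq) := h k j; rewrite psum_entry.
by exists ([ffun j => s j] : {ffun J -> R^o}); apply/ffunP => j; rewrite psum_rmapE ffunE sE.
Qed.

Lemma in_Fc_free_deep (c : RR) (X : Fpi RR t) : 0 <= pi - c -> in_Fc c X ->
  free_rep X /\ deep (pi - c) (fpi_d X).
Proof.
move=> b0 [d [I [J [x [y [phi [psi ->]]]]]] /(deep_psumP b0) h]; split.
  by exists I, x; constructor.
apply: deep_eq (deep_comp_r phi (deep_comp_l (riso_inv psi) h)) => p v /=.
have /= -> := riso_toK phi v.
exact: (riso_toK psi).
Qed.

Definition riso_id (V : rep) : riso V V.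
Proof. by exists (rid V) (rid V). Defined.

Lemma has_depth_deep (b : RR) (I : finType) (x : I -> circle)
    (d : rhom (psum t x) (psum t x)) : 0 <= b -> deep b d ->
  exists2 e, has_depth d e & (b%:E <= e)%E.
Proof.
move=> b0 dd; exists (depth_psum (rcomp (riso_id _) (rcomp d (riso_inv (riso_id _))))).
  by exists I, I, x, x, (riso_id _), (riso_id _).
exact/deep_psumP.
Qed.

End Depth.

(** * Pairs of points with a differential exchanging the generators *)

Section PairObject.
Variables (RR : realType) (R : idomainType) (t : R).
Hypothesis t0 : t != 0.
Local Notation circle := (circle RR).
Local Notation rep := (rep RR t).

Lemma ang_opp (p : circle) : p != 0 -> ang p + ang (- p) = 2 * pi.
Proof.
move=> p0; have /andP[a0 a1] := ang_itv p; have /andP[b0 b1] := ang_itv (- p).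
have ap : ang p != 0 by apply: contraNneq p0 => a; rewrite -(angK p) a cls0.
have {}ap : 0 < ang p by rewrite lt_neqAle eq_sym ap.
apply: cls_inj_itv; first by rewrite clsD !angK subrr cls_2pi.
by rewrite ltr_norml; apply/andP; split; lra.
Qed.

Lemma bool_family (P : bool -> Type) s (a : P s) (b : P (~~ s)) :
  exists w : forall k, P k, w s = a /\ w (~~ s) = b.
Proof.
by case: s a b => a b;
  [exists (fun k => if k return P k then a else b)
  |exists (fun k => if k return P k then b else a)].
Qed.

(** Preimages under a monomorphism are unique, hence depend linearly and naturally on the element. *)
Lemma rfactor (A B V : rep) (D : rhom A B) (f : rhom V B) :
  monic_rep D -> (forall p v, exists a, D p a = f p v) ->
  exists g : rhom V A, rhom_eq (rcomp D g) f.
Proof.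
move=> mD im; pose g p v := projT1 (cid (im p v)).
have gE p v : D p (g p v) = f p v by exact: projT2 (cid (im p v)).
have glin p : linear (g p).
  by move=> a u v; apply: (mD p); rewrite linearP !gE linearP.
have @G : rhom V A.
  exists (fun p => mklinear (@glin p)) => p q a h v /=.
  by apply: (mD q); rewrite gE -rfun_nat gE rfun_nat.
by exists G => p v /=; apply: gE.
Qed.

Section Rot.
Variable x : bool -> circle.

(** The length of the arc along which [d] moves the generator [s]: it ends at [x s], and its start
    carries the other generator. *)
Definition len (s : bool) : RR := ang (x (~~ s) - x s).

Lemma len_arc s : arc (x (~~ s)) (x s) (len s). Proof. exact: arc_ang. Qed.

Definition rot : rhom (psum t x) (psum t x) :=
  psum_lift (fun s => rmap (psum t x) (len_arc s) (gen t x (~~ s))).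

Lemma rot_gen s : rot (x s) (gen t x s) = rmap (psum t x) (len_arc s) (gen t x (~~ s)).
Proof. exact: psum_lift_gen. Qed.

(** The exponent of the power of [t] by which [d] acts at [p] from the summand [s] to the
    summand [~~ s]. *)
Definition rot_exp s p : nat := turns (x (~~ s)) (x (~~ s)) (len s + ang (x s - p)).

Lemma rotE p (v : psum t x p) s :
  (rot p v : {ffun bool -> R^o}) (~~ s) =
  t ^+ rot_exp s p * (v : {ffun bool -> R^o}) s.
Proof.
rewrite psum_liftE sum_ffunE big_bool /= [RHS]mulrC.
have E k : (rmap (psum t x) (arc_ang (x k) p)
    (rmap (psum t x) (len_arc k) (gen t x (~~ k))) : {ffun bool -> R^o}) (~~ s) =
    if k == s then t ^+ rot_exp s p else 0.
  have hk := arc_trans (len_arc k) (arc_ang (x k) p).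
  by rewrite (rmapC _ _ hk)// rmap_genE (inj_eq negb_inj) eq_sym; case: eqP => [->|].
have S (a : R) (f : {ffun bool -> R^o}) k : (a *: f) k = a * f k by rewrite ffunE.
by rewrite !S !E; case: (s) => /=; rewrite mulr0 ?addr0 ?add0r.
Qed.

Hypothesis x_neq : x true != x false.

Lemma x_neqs s : x (~~ s) - x s != 0.
Proof. by rewrite subr_eq0; case: s => //=; rewrite eq_sym. Qed.

Lemma len_sum s : len s + len (~~ s) = 2 * pi.
Proof.
rewrite /len negbK -(ang_opp (x_neqs s)); congr (_ + ang _).
by rewrite opprB.
Qed.

Lemma len_gt0 s : 0 < len s.
Proof.
have /andP[a0 _] := ang_itv (x (~~ s) - x s); rewrite lt_neqAle a0 andbT eq_sym.
by apply: contra_neq (x_neqs s) => a; rewrite -(angK (_ - _)) [X in cls X]a cls0.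
Qed.

Lemma rot_rot p v : rot p (rot p v) = t *: v.
Proof.
apply: (@psum_ext _ _ _ _ _ _ (rcomp rot rot) (rscale t (rid _))) => s.
change (rot (x s) (rot (x s) (gen t x s)) = t *: gen t x s).
rewrite rot_gen -rfun_nat rot_gen.
have h : arc (x (~~ ~~ s)) (x s) (2 * pi) by rewrite negbK arc_2pi.
rewrite (rmapC _ _ h); last by rewrite addrC len_sum.
by move: h; rewrite negbK => h; rewrite rmap_2pi.
Qed.

Definition pair_obj : fpi_obj RR t :=
  FpiObj (psum_fg t x) (psum_projective (x := x)) rot_rot.

Variable V : fpi_obj RR t.

Lemma pair_hom (w : forall s, V (x s)) :
  (forall s, fpi_d V (x s) (w s) = rmap V (len_arc s) (w (~~ s))) ->
  exists f : fpi_hom pair_obj V, forall s, f (x s) (gen t x s) = w s.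
Proof.
move=> h.
have e : rhom_eq (rcomp (psum_lift w) (fpi_d pair_obj)) (rcomp (fpi_d V) (psum_lift w)).
  apply: psum_ext => s.
  change (psum_lift w (x s) (rot (x s) (gen t x s)) =
    fpi_d V (x s) (psum_lift w (x s) (gen t x s))).
  by rewrite rot_gen -rfun_nat !psum_lift_gen h.
exists (FpiHom e : fpi_hom pair_obj V) => s; exact: psum_lift_gen.
Qed.

Hypothesis V_free : free_rep V.

(** The compatibility with [d] at the generator [~~ s] follows from the one at [s]: after applying
    the injective structure map of length [len s] both sides become multiplication by [t]. *)
Lemma pair_hom1 s (w : V (x s)) (w' : V (x (~~ s))) :
  fpi_d V (x s) w = rmap V (len_arc s) w' ->
  exists f : fpi_hom pair_obj V,
    f (x s) (gen t x s) = w /\ f (x (~~ s)) (gen t x (~~ s)) = w'.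
Proof.
move=> h; have [u [us us']] := bool_family (P := fun k => V (x k)) w w'.
suff /pair_hom[f fE] : forall k, fpi_d V (x k) (u k) = rmap V (len_arc k) (u (~~ k)).
  by exists f; rewrite !fE us us'.
have {h w w' us us'} h : fpi_d V (x s) (u s) = rmap V (len_arc s) (u (~~ s)).
  by rewrite us us'.
move=> k; have [->//|->] : k = s \/ k = ~~ s by case: k s {h} => [] []; auto.
apply: (free_rmap_inj t0 V_free (h := len_arc s)).
rewrite rfun_nat -h fpi_dd.
have h2 : arc (x (~~ ~~ s)) (x s) (2 * pi) by rewrite negbK arc_2pi.
rewrite (rmapC _ _ h2); last by rewrite addrC len_sum.
by move: h2; rewrite negbK => h2; rewrite rmap_2pi.
Qed.

Lemma pair_hom_ext s (f g : fpi_hom pair_obj V) :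
  f (x s) (gen t x s) = g (x s) (gen t x s) -> rhom_eq f g.
Proof.
move=> e; apply: psum_ext => k.
have [->//|->] : k = s \/ k = ~~ s by case: k s {e} => [] []; auto.
apply: (free_rmap_inj t0 V_free (h := len_arc s)).
have aux (h : fpi_hom pair_obj V) :
    rmap V (len_arc s) (h (x (~~ s)) (gen t x (~~ s))) =
    fpi_d V (x s) (h (x s) (gen t x s)).
  have /= <- := fpi_comm h (gen t x s).
  rewrite rfun_nat; congr (h (x s) _); exact: esym (rot_gen s).
by rewrite !aux e.
Qed.

End Rot.

Section Boundary.
Variables (x : bool -> circle) (x_neq : x true != x false) (s : bool).
Let b := len x s.
Let Z := pair_obj x_neq.

(** If all of [d] on [V] is divisible by the structure map of length [b = len s], a morphism from
    the pair to [V] amounts to an arbitrary element of [V (x s)], which can be lifted. *)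
Lemma pair_projective (V W : fpi_obj RR t) (g : fpi_hom V W) (h : fpi_hom Z W) :
  free_rep V -> free_rep W -> deep b (fpi_d V) -> epic_rep g ->
  exists k : fpi_hom Z V, rhom_eq (rcomp g k) h.
Proof.
move=> fV fW dV eg; have [v vE] := eg _ (h (x s) (gen t x s)).
have [v' v'E] := dV _ _ (len_arc x s) v.
have [k [kE _]] := pair_hom1 x_neq fV (esym v'E).
exists k; apply: (@pair_hom_ext x x_neq W fW s (fpi_comp g k) h).
by rewrite -vE -kE.
Qed.

(** The component of [d] from [s] to [~~ s] has the same image as the structure map of length
    [len s] on the summand [~~ s]. *)
Lemma rot_exp_deep p q (h : arc q p b) : rot_exp x s p = turns (x (~~ s)) q b.
Proof.
have hq : arc (x (~~ s)) q (ang (x s - p)).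
  apply: arcP; first by case/andP: (ang_itv (x s - p)).
  rewrite angK; have := arc_cls (len_arc x s); rewrite (arc_cls h) => e.
  have -> : x (~~ s) = q - p + x s by rewrite e subrK.
  by rewrite [RHS]addrC -!addrA addKr addrC.
rewrite /rot_exp -(turnsD _ hq h) [X in (_ + X)%N]turns_small ?addn0//.
exact: ang_itv.
Qed.

(** Dually, the coordinate [~~ s] of a morphism [k] from [V] to the pair determines the coordinate
    [s], and it can be any morphism of representations: [k d] is divisible by the structure map of
    length [b], hence lies in the image of the component of [d] from [s] to [~~ s]. So only the
    coordinate [~~ s] needs to be extended, which the retraction [r] does. *)
Lemma pair_injective (U V : fpi_obj RR t) (f : fpi_hom U V) (r : rhom V U)
    (h : fpi_hom U Z) :
  deep b (fpi_d V) -> rhom_eq (rcomp r f) (rid U) ->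
  exists k : fpi_hom V Z, rhom_eq (rcomp k f) h.
Proof.
move=> dV rf.
pose D : rhom (prep t (x s)) (prep t (x (~~ s))) :=
  rcomp (pproj t x (~~ s)) (rcomp (rot x) (pin t x s)).
have DE p (a : R^o) : D p a = t ^+ rot_exp x s p * a :> R.
  change ((rot x p (pin t x s p a) : {ffun bool -> R^o}) (~~ s) = t ^+ rot_exp x s p * a).
  by rewrite rotE /= ffunE eqxx.
have mD : monic_rep D.
  by move=> p a a'; rewrite !DE; apply: mulfI; apply: expf_neq0.
pose k1 : rhom V (prep t (x (~~ s))) := rcomp (pproj t x (~~ s)) (rcomp h r).
(* [d v] is divisible by the structure map of length [b], and so is its image under [k1]. *)
have im p v : exists a, D p a = rcomp k1 (fpi_d V) p v.
  have b0 : 0 <= b := ltW (len_gt0 x_neq s).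
  have [w wE] := dV _ _ (arc_pre p b0) v.
  exists (k1 _ w); rewrite DE (rot_exp_deep (arc_pre p b0)) /=.
  rewrite -wE -!rfun_nat.
  by rewrite psum_rmapE.
have [k0 k0E] := rfactor mD im.
pose k : rhom V (psum t x) := radd (rcomp (pin t x s) k0) (rcomp (pin t x (~~ s)) k1).
have eqb_neg1 : (s == ~~ s) = false by case: (s).
have eqb_neg2 : (~~ s == s) = false by case: (s).
have ks p v : (k p v : {ffun bool -> R^o}) s = k0 p v.
  by rewrite /= !ffunE eqxx eqb_neg1 addr0.
have ks' p v : (k p v : {ffun bool -> R^o}) (~~ s) = k1 p v.
  by rewrite /= !ffunE eqxx eqb_neg2 add0r.
have sc (a : R) (z : {ffun bool -> R^o}) i : (a *: z) i = a * z i by rewrite ffunE.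
have sum_ext p (y z : psum t x p) :
    (y : {ffun bool -> R^o}) s = (z : {ffun bool -> R^o}) s ->
    (y : {ffun bool -> R^o}) (~~ s) = (z : {ffun bool -> R^o}) (~~ s) -> y = z.
  move=> e e'; apply/ffunP => i.
  by have [->|->] : i = s \/ i = ~~ s by case: i (s) => [] []; auto.
have kd : rhom_eq (rcomp k (fpi_d V)) (rcomp (rot x) k).
  move=> p v; change (k p (fpi_d V p v) = rot x p (k p v)); apply: sum_ext.
    apply: (mulfI (expf_neq0 (rot_exp x s p) t0)); rewrite -[RHS]rotE rot_rot// sc ks'.
    rewrite ks -DE; have /= -> := k0E p (fpi_d V p v).
    by rewrite fpi_dd !linearZ sc.
  by rewrite ks' rotE ks -DE; have /= -> := k0E p v.
exists (@FpiHom _ _ _ V Z k kd) => p u.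
change (k p (f p u) = h p u).
have k1f q w : k1 q (f q w) = (h q w : {ffun bool -> R^o}) (~~ s).
  by have /= rfw := rf q w; rewrite /= rfw.
apply: sum_ext; last by rewrite ks' k1f.
apply: (mulfI (expf_neq0 (rot_exp x s p) t0)); rewrite ks -DE -rotE.
have /= -> := k0E p (f p u).
have /= fd := fpi_comm f u; have /= hd := fpi_comm h u.
have := k1f p (fpi_d U p u); rewrite /= fd => ->.
by rewrite hd.
Qed.

End Boundary.
End PairObject.

(** * Shifts between admissible pairs *)

Section Shifts.
Variables (RR : realType) (R : idomainType) (t : R).
Hypotheses (R_dvr : is_dvr R) (t_unif : is_uniformizer t).
Variable c : RR.
Hypothesis c_itv : 0 < c < pi.
Local Notation circle := (circle RR).
Local Notation rep := (rep RR t).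
Local Notation Fc := (Fc t c).
Let t0 : t != 0 := uniformizer_neq0 R_dvr t_unif.
Let c0 : 0 < c := c_gt0 c_itv.
Let cpi : c < pi := c_ltpi c_itv.
Let pi0 := twopi_gt0 RR.
Let b0 : 0 <= pi - c. Proof. by rewrite subr_ge0 ltW. Qed.

(** The entries of [d] on a pair have depths [len false] and [len true], so these are the pairs
    that belong to [F_c]. *)
Record admissible := Admissible {
  apt :> bool -> circle;
  apt_neq : apt true != apt false;
  alen_ge : forall s, pi - c <= len apt s
}.

Implicit Types x y z : admissible.

Lemma alen_sum x s : len x s + len x (~~ s) = 2 * pi.
Proof. by apply: len_sum; apply: apt_neq. Qed.

Lemma alen_le x s : len x s <= pi + c.
Proof. by have := alen_sum x s; have := alen_ge x (~~ s); lra. Qed.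

Lemma deep_rot x : deep (pi - c) (rot t x).
Proof.
apply: deep_gens => s q h; rewrite rot_gen.
have h' : arc (x (~~ s)) q (len x s - (pi - c)).
  apply: arcP; first by rewrite subr_ge0 alen_ge.
  by rewrite clsB (arc_cls (len_arc x s)) (arc_cls h) opprB addrA subrK.
by exists (rmap (psum t x) h' (gen t x (~~ s))); apply: rmapC; rewrite subrK.
Qed.

Lemma pair_in_Fc x : in_Fc c (pair_obj t (apt_neq x) : Fpi RR t).
Proof. exact: (has_depth_deep R_dvr t_unif b0 (@deep_rot x)). Qed.

Definition Pair x : Fc := exist _ (pair_obj t (apt_neq x) : Fpi RR t) (pair_in_Fc x).

Lemma Fc_free (X : Fc) : free_rep (sval X : fpi_obj RR t).
Proof. by case: (in_Fc_free_deep R_dvr t_unif b0 (svalP X)). Qed.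

Lemma Fc_deep (X : Fc) : deep (pi - c) (fpi_d (sval X : fpi_obj RR t)).
Proof. by case: (in_Fc_free_deep R_dvr t_unif b0 (svalP X)). Qed.

(** For injectivity, the quotient of an exact sequence is projective as a representation, so its
    monomorphism has a retraction that need not commute with [d]. *)
Lemma boundary_projinj x s : len x s = pi - c ->
  projective_injective (@Fc_exact RR R t c) (Pair x).
Proof.
move=> ls; split=> [X Y Z f g [mf eg ex] h|X Y Z f g [mf eg ex] h].
  have dY := @Fc_deep Y; rewrite -ls in dY.
  exact: (pair_projective t0 (h : fpi_hom (pair_obj t (apt_neq x)) (sval Z)) (@Fc_free Y) (@Fc_free Z) dY eg).
have [si siE] := fpi_projective (eg : epic_rep (g : fpi_hom (sval Y) (sval Z))) (rid _).
pose u : rhom (sval Y : fpi_obj RR t) (sval Y : fpi_obj RR t) :=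
  radd (rid _) (rscale (- 1) (rcomp si (g : fpi_hom (sval Y) (sval Z)))).
have uE p v : u p v = v - si p ((g : fpi_hom (sval Y) (sval Z)) p v).
  by rewrite /u /= scaleN1r.
have [|r rE] := rfactor mf (f := u).
  move=> p v; apply/ex; rewrite uE linearB; have /= -> := siE p.
  by rewrite subrr.
have dY := @Fc_deep Y; rewrite -ls in dY.
apply: (pair_injective t0 (f := (f : fpi_hom (sval X) (sval Y))) (r := r)
  (h : fpi_hom (sval X) (pair_obj t (apt_neq x))) dY).
move=> p v /=; apply: mf; have /= -> := rE p ((f : fpi_hom (sval X) (sval Y)) p v).
have -> : (g : fpi_hom (sval Y) (sval Z)) p ((f : fpi_hom (sval X) (sval Y)) p v) = 0.
  by apply/ex; exists v.
by rewrite linear0 scaler0 addr0.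
Qed.

Lemma rmap_gen_irr (I : finType) (x : I -> circle) k k' p a a'
    (h : arc (x k) p a) (h' : arc (x k') p a') : k = k' -> a = a' ->
  rmap (psum t x) h (gen t x k) = rmap (psum t x) h' (gen t x k').
Proof. by move=> e; subst k'; apply: rmap_irr. Qed.

(** A shift moves the generator [s] of [x] forward by [al s] onto the generator [s (+) e] of [y];
    the equation between lengths says that this commutes with [d]. *)
Record shift_ok x y (e : bool) (al : bool -> RR) : Prop := ShiftOk {
  shift_arc : forall s, arc (y (s (+) e)) (x s) (al s);
  shift_len : forall s, len x s + al (~~ s) = al s + len y (s (+) e)
}.

Lemma shift_exists x y e al (h : shift_ok x y e al) :
  exists f : fpi_hom (pair_obj t (apt_neq x)) (pair_obj t (apt_neq y)),
  forall s, f (x s) (gen t x s) =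
    rmap (psum t y) (shift_arc h s) (gen t y (s (+) e)).
Proof.
apply: (@pair_hom _ _ _ x (apt_neq x) (pair_obj t (apt_neq y))
  (fun s => rmap (psum t y) (shift_arc h s) (gen t y (s (+) e)))) => s.
change (rot t y (x s) (rmap (psum t y) (shift_arc h s) (gen t y (s (+) e))) =
  rmap (psum t y) (len_arc x s) (rmap (psum t y) (shift_arc h (~~ s)) (gen t y (~~ s (+) e)))).
rewrite -rfun_nat rot_gen.
have h1 := arc_trans (len_arc y (s (+) e)) (shift_arc h s).
have h2 := arc_trans (shift_arc h (~~ s)) (len_arc x s).
rewrite (rmapC _ _ h1)// (rmapC _ _ h2)//.
apply: rmap_gen_irr; first by rewrite addNb.
by rewrite [LHS]addrC -(shift_len h) addrC.
Qed.

Definition shift x y e al (h : shift_ok x y e al) : @hom R Fc (Pair x) (Pair y) :=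
  projT1 (cid (shift_exists h)).

Lemma shift_gen x y e al (h : shift_ok x y e al) s :
  (shift h : fpi_hom _ _) (x s) (gen t x s) =
    rmap (psum t y) (shift_arc h s) (gen t y (s (+) e)).
Proof. exact: projT2 (cid (shift_exists h)) s. Qed.

Lemma shift_entry x y e al (h : shift_ok x y e al) s i :
  ((shift h : fpi_hom _ _) (x s) (gen t x s) : {ffun bool -> R^o}) i =
  if i == s (+) e then t ^+ turns (y (s (+) e)) (y (s (+) e)) (al s) else 0.
Proof. by rewrite shift_gen rmap_genE. Qed.

Lemma Pair_ext x (V : Fc) (f g : @hom R Fc (Pair x) V) s :
  (f : fpi_hom (pair_obj t (apt_neq x)) (sval V)) (x s) (gen t x s) =
  (g : fpi_hom (pair_obj t (apt_neq x)) (sval V)) (x s) (gen t x s) -> f =~ g.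
Proof. exact: (pair_hom_ext t0 (@Fc_free V)). Qed.

Lemma shift_irr x y e e' al al' (h : shift_ok x y e al) (h' : shift_ok x y e' al') :
  e = e' -> (forall s, al s = al' s) -> shift h =~ shift h'.
Proof.
move=> ee ea; apply: (@Pair_ext _ _ _ _ false); rewrite !shift_gen.
by apply: rmap_gen_irr => //; rewrite ee.
Qed.

Lemma shift_comp_ok x y z e e' al be : shift_ok x y e al -> shift_ok y z e' be ->
  shift_ok x z (e (+) e') (fun s => al s + be (s (+) e)).
Proof.
move=> h h'; split=> s.
  by rewrite addbA addrC; apply: arc_trans (shift_arc h' _) (shift_arc h s).
have := shift_len h s; have := shift_len h' (s (+) e).
by rewrite addbA addNb; lra.
Qed.

Lemma shift_comp x y z e e' al be (h : shift_ok x y e al) (h' : shift_ok y z e' be)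
    e'' ga (h'' : shift_ok x z e'' ga) :
  e'' = e (+) e' -> (forall s, ga s = al s + be (s (+) e)) ->
  hcomp (shift h') (shift h) =~ shift h''.
Proof.
move=> ee eg; apply: (@Pair_ext _ _ _ _ false).
change ((shift h' : fpi_hom _ _) (x false) ((shift h : fpi_hom _ _) (x false) (gen t x false)) =
  (shift h'' : fpi_hom _ _) (x false) (gen t x false)).
rewrite !shift_gen -rfun_nat shift_gen.
have k := arc_trans (shift_arc h' (false (+) e)) (shift_arc h false).
rewrite (rmapC _ _ k)//; apply: rmap_gen_irr; first by rewrite ee addbA.
by rewrite eg addrC.
Qed.

Lemma shift_id_ok x : shift_ok x x false (fun _ => 0).
Proof.
split=> s; first by rewrite addbF arc_refl.
by rewrite addr0 add0r addbF.
Qed.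

Lemma shift_id x : shift (shift_id_ok x) =~ hid (Pair x).
Proof.
apply: (@Pair_ext _ _ _ _ false); rewrite shift_gen.
change (rmap (psum t x) (shift_arc (shift_id_ok x) false) (gen t x (false (+) false)) =
  gen t x false).
rewrite (rmap_gen_irr (k' := false) _ (arc_refl (x false)))//.
exact: rmap_0.
Qed.

(** ** The boundary pairs next to a pair *)

Section Hull.
Variables (x : admissible) (s : bool).

(** The boundary object through which every shift moving the generator [s] of [x] far enough
    factors: the generator [~~ s] stays, and [s] moves until the distance is [pi - c]. *)
Let hull_pt (k : bool) : circle := x (~~ s) - (if k == s then cls (pi - c) else 0).

Let sN : (~~ s == s) = false. Proof. by case: s. Qed.

Let hull_len : len hull_pt s = pi - c.
Proof.
rewrite /len /hull_pt eqxx sN subr0 subKr.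
by apply: ang_cls; apply/andP; split; [exact: b0|move: c0 cpi; lra].
Qed.

Let hull_neq : hull_pt true != hull_pt false.
Proof.
have h : hull_pt (~~ s) - hull_pt s != 0.
  apply/eqP => e; have := hull_len; rewrite /len e ang0.
  by move: cpi; lra.
by move: h; rewrite subr_eq0; case: (s); rewrite // eq_sym.
Qed.

Let hull_ge k : pi - c <= len hull_pt k.
Proof.
have [->|->] : k = s \/ k = ~~ s by case: k s => [] []; auto.
  by rewrite hull_len.
have := len_sum hull_neq s; rewrite hull_len.
by move: c0; lra.
Qed.

Definition hull : admissible := Admissible hull_neq hull_ge.

Lemma len_hull : len hull s = pi - c. Proof. exact: hull_len. Qed.

Lemma len_hullN : len hull (~~ s) = pi + c.
Proof. by have := alen_sum hull s; rewrite len_hull; lra. Qed.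

Definition hull_shift (k : bool) : RR := if k == s then len x s - (pi - c) else 0.

Lemma hull_shift_ok : shift_ok x hull false hull_shift.
Proof.
split=> k; rewrite addbF; have [->|->] : k = s \/ k = ~~ s by case: k s => [] []; auto.
- rewrite /hull_shift eqxx; apply: arcP; first by rewrite subr_ge0 alen_ge.
  by rewrite /= /hull_pt eqxx clsB (arc_cls (len_arc x s)) addrAC.
- rewrite /hull_shift sN /= /hull_pt sN subr0; exact: arc_refl.
- by rewrite /hull_shift eqxx sN len_hull; lra.
- rewrite negbK /hull_shift eqxx sN len_hullN.
  by have := alen_sum x s; lra.
Qed.

Variables (y : admissible) (e : bool) (al : bool -> RR) (h : shift_ok x y e al).
Hypothesis far : len x s - (pi - c) <= al s.

Lemma far_shift_ok : shift_ok hull y e (fun k => al k - hull_shift k).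
Proof.
have kk k : k = s \/ k = ~~ s by case: k s => [] []; auto.
split=> k.
  apply: arcP.
    have [->|->] := kk k; rewrite /hull_shift ?eqxx ?sN; first by rewrite subr_ge0.
    by rewrite subr0; apply: arc_ge0 (shift_arc h _).
  rewrite clsB (arc_cls (shift_arc h k)).
  have := arc_cls (shift_arc hull_shift_ok k); rewrite addbF => ->.
  by rewrite opprB addrA subrK.
have := shift_len h k; have := shift_len hull_shift_ok k; rewrite addbF.
by lra.
Qed.

Lemma far_shift_ideal : factors_projinj (@Fc_exact RR R t c) (shift h).
Proof.
exists (Pair hull), (shift hull_shift_ok), (shift far_shift_ok); split.
  exact: boundary_projinj len_hull.
apply: shift_comp => // k; rewrite addbF; lra.
Qed.

End Hull.

Lemma turns_eq (p : circle) (a : RR) n :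
  n%:R * (2 * pi) <= a < n.+1%:R * (2 * pi) -> turns p p a = n.
Proof.
move=> h; rewrite /turns subrr ang0 add0r; apply: truncn_def.
by rewrite ler_pdivlMr ?twopi_gt0// ltr_pdivrMr ?twopi_gt0.
Qed.

(** The component of sign [e] of a morphism moves the generator [false] by an angle [a]. Commuting
    with [d] then prescribes the move [b] of the generator [true]. If [b < 0], the prescribed image
    exists only when the coefficient is divisible by [t], and a full turn is added to both moves. *)
Lemma hom_entry x y (f : fpi_hom (pair_obj t (apt_neq x)) (pair_obj t (apt_neq y))) e :
  exists al, shift_ok x y e al /\ exists r : R,
  (f (x false) (gen t x false) : {ffun bool -> R^o}) e =
    r * t ^+ turns (y e) (y e) (al false).
Proof.
pose w := f (x false) (gen t x false); rewrite -/w.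
pose a := ang (y e - x false); pose b := a + len y e - len x false.
have /andP[a0 a2] : 0 <= a < 2 * pi := ang_itv _.
have ly := alen_ge y e; have lx := alen_le x false.
have cb : cls b = y (~~ e) - x true.
  rewrite /b clsB clsD /a angK (arc_cls (len_arc y e)) (arc_cls (len_arc x false)) /=.
  by rewrite opprB [X in X + _]addrC !addrA !subrK.
have ok k : 0 <= b + k%:R * (2 * pi) ->
    shift_ok x y e (fun s => (if s then b else a) + k%:R * (2 * pi)).
  move=> bk; have ck (u : RR) : cls (u + k%:R * (2 * pi)) = cls u.
    by rewrite clsD -[k%:R]/((Posz k)%:~R) clsM2pi addr0.
  split=> [] [] //=.
  - by apply: arcP => //; rewrite ck cb.
  - apply: arcP; last by rewrite ck /a angK.
    by rewrite addr_ge0// mulr_ge0// ltW.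
  - have := alen_sum x true; have := alen_sum y e; rewrite /b /=; lra.
  - by rewrite /b; lra.
have [b_ge|b_lt] := lerP 0 b.
  exists (fun s => (if s then b else a) + 0%:R * (2 * pi)); split.
    by apply: ok; rewrite mul0r addr0.
  exists ((w : {ffun bool -> R^o}) e); rewrite (@turns_eq _ _ 0) ?expr0 ?mulr1//.
  by rewrite mul0r mul1r addr0 a0.
exists (fun s => (if s then b else a) + 1%:R * (2 * pi)); split.
  by apply: ok; rewrite mul1r /b; move: c0 cpi; lra.
have : rot t y (x false) w =
    rmap (psum t y) (len_arc x false) (f (x true) (gen t x true)).
  have /= <- := fpi_comm f (gen t x false).
  apply: etrans (congr1 (f (x false)) (rot_gen t x false)) _.
  exact: esym (rfun_nat f (len_arc x false) (gen t x true)).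
move=> /(congr1 (fun v : {ffun bool -> R^o} => v (~~ e))).
rewrite rotE psum_rmapE /rot_exp turns_small; last first.
  rewrite -/a; apply/andP; split; first by move: cpi; lra.
  by move: b_lt; rewrite /b; move: cpi c0; lra.
have ab : ang (y (~~ e) - x true) = b + 2 * pi.
  rewrite -cb -(cls_p b); apply: ang_cls; apply/andP; split; last by lra.
  by rewrite /b; move: c0 cpi; lra.
have : (0 < turns (y (~~ e)) (x true) (len x false))%N.
  by apply: turns_gt0; rewrite ab /b; move: cpi; lra.
case: (turns _ _ _) => // n _; rewrite expr0 mul1r => ->.
rewrite (@turns_eq _ _ 1); last by apply/andP; split; rewrite ?mul1r; lra.
by rewrite expr1 exprSr mulrAC; eexists.
Qed.

Lemma hom_decomp x y (f : @hom R Fc (Pair x) (Pair y)) :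
  exists (al : bool -> bool -> RR) (h : forall e, shift_ok x y e (al e)) (r : bool -> R),
  f =~ hadd (hscale (r false) (shift (h false))) (hscale (r true) (shift (h true))).
Proof.
have /choice[al /all_and2[h /choice[r rE]]] := @hom_entry x y f.
exists al, h, r; apply: (@Pair_ext _ _ _ _ false); apply/ffunP => i.
have sc (a : R) (z z' : {ffun bool -> R^o}) a' :
  (a *: z + a' *: z') i = a * z i + a' * z' i by rewrite !ffunE.
rewrite [LHS]rE; apply/esym.
apply: etrans (sc _ _ _ _) _; rewrite !shift_entry.
by case: i {sc} => /=; rewrite mulr0 ?addr0 ?add0r.
Qed.

End Shifts.

(** * The hull sequence and short shifts *)

Section Stable.
Variables (RR : realType) (R : idomainType) (t : R).
Hypotheses (R_dvr : is_dvr R) (t_unif : is_uniformizer t).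
Variable c : RR.
Hypothesis c_itv : 0 < c < pi.
Local Notation circle := (circle RR).
Local Notation rep := (rep RR t).
Local Notation Fc := (Fc t c).
Local Notation admissible := (admissible c).
Local Notation Pair := (Pair R_dvr t_unif c_itv).
Local Notation shift := (shift R_dvr t_unif c_itv).
Local Notation J := (projinj_ideal (@Fc_exact RR R t c) (Fc_has_biproducts t c)).
Let t0 : t != 0 := uniformizer_neq0 R_dvr t_unif.
Let c0 : 0 < c := c_gt0 c_itv.
Let cpi : c < pi := c_ltpi c_itv.
Let pi0 := twopi_gt0 RR.

Implicit Types x y z : admissible.

Lemma shiftE x y e al (h : shift_ok x y e al) p (v : psum t x p) k :
  ((shift h : fpi_hom _ _) p v : {ffun bool -> R^o}) (k (+) e) =
  t ^+ turns (y (k (+) e)) (y (k (+) e)) (al k + ang (x k - p)) * (v : {ffun bool -> R^o}) k.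
Proof.
have sc (a : R) (f : {ffun bool -> R^o}) i : (a *: f) i = a * f i by rewrite ffunE.
have -> : (shift h : fpi_hom _ _) p v = \sum_j (v : {ffun bool -> R^o}) j *:
    rmap (psum t y) (arc_ang (x j) p) ((shift h : fpi_hom _ _) (x j) (gen t x j)).
  rewrite {1}(psum_decomp v) linear_sum; apply: eq_bigr => j _.
  by rewrite linearZ -rfun_nat.
rewrite sum_ffunE (bigD1 k)// big1 => [|j jk].
  rewrite sc shift_gen.
  have hk := arc_trans (shift_arc h k) (arc_ang (x k) p).
  rewrite (rmapC _ _ hk)// rmap_genE eqxx mulrC; exact: addr0.
rewrite sc shift_gen.
have hj := arc_trans (shift_arc h j) (arc_ang (x j) p).
by rewrite (rmapC _ _ hj)// rmap_genE (inj_eq (@addIb e)) eq_sym (negbTE jk) mulr0.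
Qed.


Lemma ideal_zero (X Y : Fc) (f : hom X Y) : qeq J f (hzero X Y) <-> factors_projinj (@Fc_exact RR R t c) f.
Proof.
split=> [/qeqP[n nJ e]|h].
  apply: factors_eq nJ; apply: heq_sym; apply: heq_trans e _; exact: hadd0r.
by apply/qeqP; exists f => //; apply: heq_sym; apply: hadd0r.
Qed.

Section HullSequence.
Variable x : admissible.

Local Notation hull := (hull c_itv x).

(** Let [A_s] be the summand of [x] at the generator [s] and [A_s -> B_s] the move by
    [hull_shift x s s]. As representations [x = A_false + A_true], the hull at [s] is [B_s] plus the
    summand of [x] at [~~ s], and [cohull = B_false + B_true]; this makes the exactness of
    [0 -> x -> hull false + hull true -> cohull -> 0] visible. *)
Let cohull_pt (k : bool) : circle := x (~~ k) - cls (pi - c).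

Let cohull_neq : cohull_pt true != cohull_pt false.
Proof. by rewrite (inj_eq (addIr _)) eq_sym apt_neq. Qed.

Let cohull_len k : len cohull_pt k = len x (~~ k).
Proof. by rewrite /len /cohull_pt opprB addrA subrK. Qed.

Let cohull_ge k : pi - c <= len cohull_pt k.
Proof. by rewrite cohull_len alen_ge. Qed.

Definition cohull : admissible := Admissible cohull_neq cohull_ge.

Let sN (s : bool) : (~~ s == s) = false. Proof. by case: s. Qed.
Let sN' (s : bool) : (s == ~~ s) = false. Proof. by case: s. Qed.
Let sk (s k : bool) : k = s \/ k = ~~ s.
Proof. by case: k s => [] []; auto. Qed.

Lemma cohull_shift_ok s : shift_ok (hull s) cohull false (hull_shift x (~~ s)).
Proof.
have lsum := alen_sum x s; have lh := len_hull c_itv x s.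
have lh' := len_hullN c_itv x s.
split=> k; rewrite addbF; have [->|->] := sk s k.
- rewrite /hull_shift sN' /= /cohull_pt eqxx; exact: arc_refl.
- rewrite /hull_shift eqxx; apply: arcP; first by rewrite subr_ge0 alen_ge.
  by rewrite /= /cohull_pt sN subr0 clsB (arc_cls (len_arc x (~~ s))) addrAC.
- rewrite /hull_shift eqxx sN' [len cohull s]cohull_len lh; lra.
- rewrite negbK /hull_shift eqxx sN' [len cohull (~~ s)]cohull_len negbK lh'; lra.
Qed.

Local Notation into s := (shift (hull_shift_ok c_itv x s)).
Local Notation onto s := (shift (cohull_shift_ok s)).

Let m k p := turns (cohull k) (cohull k) (hull_shift x k k + ang (x k - p)).

Lemma intoE s p (v : psum t x p) k :
  ((into s : fpi_hom _ _) p v : {ffun bool -> R^o}) k =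
  (if k == s then t ^+ m k p else 1) * (v : {ffun bool -> R^o}) k.
Proof.
have := shiftE (hull_shift_ok c_itv x s) v k; rewrite addbF => ->.
rewrite /hull_shift; case: eqP => [->|_].
  by rewrite /m /hull_shift eqxx /= /cohull_pt eqxx.
by rewrite turns_small ?expr0// add0r ang_itv.
Qed.

Lemma ontoE s p (v : psum t (hull s) p) k :
  ((onto s : fpi_hom _ _) p v : {ffun bool -> R^o}) k =
  (if k == s then 1 else t ^+ m k p) * (v : {ffun bool -> R^o}) k.
Proof.
have := shiftE (cohull_shift_ok s) v k; rewrite addbF => ->.
rewrite /hull_shift; have [->|->] := sk s k.
  by rewrite sN' eqxx turns_small ?expr0// add0r ang_itv.
by rewrite /m /hull_shift !eqxx sN /= sN subr0.
Qed.

Lemma onto_intoE s p (v : psum t x p) k :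
  ((onto s : fpi_hom _ _) p ((into s : fpi_hom _ _) p v) : {ffun bool -> R^o}) k =
  t ^+ m k p * (v : {ffun bool -> R^o}) k.
Proof.
by rewrite ontoE intoE; case: eqP => _; rewrite mul1r.
Qed.

Lemma psum2_eq (u v : {ffun bool -> R^o}) s : u s = v s -> u (~~ s) = v (~~ s) -> u = v.
Proof. by move=> e e'; apply/ffunP => k; have [->|->] := sk s k. Qed.

(** The sequence [0 -> x -> hull false + hull true -> cohull -> 0] is exact in [F_c], so every
    morphism from [x] to an injective object extends to the sum of the hulls. *)
Lemma factors_hulls (V : Fc) (f : @hom R Fc (Pair x) V) :
  factors_projinj (@Fc_exact RR R t c) f ->
  exists g : forall s, @hom R Fc (Pair (hull s)) V,
  f =~ hadd (hcomp (g false) (into false)) (hcomp (g true) (into true)).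
Proof.
move=> [P [a [b [[_ Pinj] ef]]]].
have [_ bip] := Fc_has_biproducts t c.
have [S [i [j [p [r [pi1 rj1 pj0 ri0 e1]]]]]] := bip (Pair (hull false)) (Pair (hull true)).
pose io := hadd (hcomp i (into false)) (hcomp j (into true)).
pose pr := hadd (hcomp (onto false) p) (hscale (- 1) (hcomp (onto true) r)).
have ioE q u : (io : fpi_hom _ _) q u = (i : fpi_hom _ _) q ((into false : fpi_hom _ _) q u)
     + (j : fpi_hom _ _) q ((into true : fpi_hom _ _) q u) by [].
have prE q u : (pr : fpi_hom _ _) q u = (onto false : fpi_hom _ _) q ((p : fpi_hom _ _) q u)
     - (onto true : fpi_hom _ _) q ((r : fpi_hom _ _) q u).
  by rewrite -[in RHS]scaleN1r.
have pi1' q u : (p : fpi_hom _ _) q ((i : fpi_hom _ _) q u) = u := pi1 q u.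
have rj1' q u : (r : fpi_hom _ _) q ((j : fpi_hom _ _) q u) = u := rj1 q u.
have pj0' q u : (p : fpi_hom _ _) q ((j : fpi_hom _ _) q u) = 0 := pj0 q u.
have ri0' q u : (r : fpi_hom _ _) q ((i : fpi_hom _ _) q u) = 0 := ri0 q u.
have e1' q u : (i : fpi_hom _ _) q ((p : fpi_hom _ _) q u) +
  (j : fpi_hom _ _) q ((r : fpi_hom _ _) q u) = u := e1 q u.
have pio q u : (p : fpi_hom _ _) q ((io : fpi_hom _ _) q u) = (into false : fpi_hom _ _) q u.
  by rewrite ioE linearD pi1' pj0' addr0.
have rio q u : (r : fpi_hom _ _) q ((io : fpi_hom _ _) q u) = (into true : fpi_hom _ _) q u.
  by rewrite ioE linearD ri0' rj1' add0r.
have ex : @Fc_exact RR R t c (Pair x) S (Pair cohull) io pr.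
  split.
  - move=> q u u' e.
    have ef0 := congr1 ((p : fpi_hom _ _) q) e; have ef1 := congr1 ((r : fpi_hom _ _) q) e.
    rewrite !pio in ef0; rewrite !rio in ef1.
    apply: (psum2_eq (s := false)).
      by have /ffunP/(_ false) := ef1; rewrite !intoE !mul1r.
    by have /ffunP/(_ true) := ef0; rewrite !intoE !mul1r.
  - move=> q w.
    pose y0 : {ffun bool -> R^o} := [ffun k => if k then 0 else (w : {ffun bool -> R^o}) false].
    pose y1 : {ffun bool -> R^o} := [ffun k => if k then - (w : {ffun bool -> R^o}) true else 0].
    exists ((i : fpi_hom _ _) q y0 + (j : fpi_hom _ _) q y1).
    have yp : (p : fpi_hom _ _) q ((i : fpi_hom _ _) q y0 + (j : fpi_hom _ _) q y1) = y0.
      by rewrite linearD pi1' pj0' addr0.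
    have yr : (r : fpi_hom _ _) q ((i : fpi_hom _ _) q y0 + (j : fpi_hom _ _) q y1) = y1.
      by rewrite linearD ri0' rj1' add0r.
    rewrite prE yp yr.
    apply/ffunP => k; rewrite ffunE [X in _ + X]ffunE !ontoE !ffunE.
    by case: k => /=; rewrite ?mulr0 ?mul1r ?oppr0 ?opprK ?add0r ?addr0.
  - move=> q v; rewrite prE; split=> [/eqP|[u <-]].
      rewrite subr_eq0 => /eqP/ffunP e.
      have e0 := e false; have e1'' := e true; rewrite !ontoE /= !mul1r in e0 e1''.
      pose y0 : {ffun bool -> R^o} := (p : fpi_hom _ _) q v.
      pose y1 : {ffun bool -> R^o} := (r : fpi_hom _ _) q v.
      pose u : {ffun bool -> R^o} := [ffun k => if k then y0 true else y1 false].
      have u0 : (into false : fpi_hom _ _) q u = y0.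
        by apply: (psum2_eq (s := false)); rewrite intoE ffunE /= ?mul1r.
      have u1 : (into true : fpi_hom _ _) q u = y1.
        by apply: (psum2_eq (s := false)); rewrite intoE ffunE /= ?mul1r.
      by exists u; rewrite ioE u0 u1; exact: e1'.
    rewrite pio rio; apply/eqP; rewrite subr_eq0; apply/eqP/ffunP => k.
    exact: etrans (onto_intoE false u k) (esym (onto_intoE true u k)).
have [a' ea] := Pinj _ _ _ _ _ ex a.
exists (fun s => if s return hom (Pair (hull s)) V then hcomp (hcomp b a') j
                 else hcomp (hcomp b a') i).
apply: heq_trans (heq_sym ef) _.
apply: heq_trans (hcomp_eq (heq_refl b) (heq_sym ea)) _.
apply: heq_trans (hcompA _ _ _) _; apply: heq_trans (hcompDr _ _ _) _.
by apply: hadd_eq; apply: hcompA.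
Qed.

End HullSequence.

(** A stably trivial morphism passes through the two hulls of [x]. The hull at [s] moves the
    generator [s] beyond [al s]. Moves of a given sign are determined modulo [2 pi], so the
    component of sign [e] of whatever passes through that hull moves both generators a full turn
    further than [al], and hence is a multiple of [t] in the coordinate considered. *)
Lemma short_shift_faithful x y e al (h : shift_ok x y e al) (a : R) :
  (forall s, al s < len x s - (pi - c)) ->
  factors_projinj (@Fc_exact RR R t c) (hscale a (shift h)) -> principal t a.
Proof.
move=> small /factors_hulls[g eg].
have lsum := alen_sum x; have lge := alen_ge x.
have alt s : 0 <= al s < 2 * pi.
  rewrite (arc_ge0 (shift_arc h s)) /=.
  by have := small s; have := lsum s; have := lge (~~ s); move: cpi; lra.
have term s : exists r, (hcomp (g s) (shift (hull_shift_ok c_itv x s)) : fpi_hom _ _)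
   (x false) (gen t x false) e = t * r :> R.
  have [be [k [r er]]] := hom_decomp (g s).
  have tt e' := @shift_comp _ _ _ R_dvr t_unif _ c_itv _ _ _ _ _ _ _ (hull_shift_ok c_itv x s) (k e')
    _ _ (shift_comp_ok (hull_shift_ok c_itv x s) (k e')) erefl (fun _ => erefl).
  have {er} er : hcomp (g s) (shift (hull_shift_ok c_itv x s)) =~
    hadd (hscale (r false) (shift (shift_comp_ok (hull_shift_ok c_itv x s) (k false))))
         (hscale (r true) (shift (shift_comp_ok (hull_shift_ok c_itv x s) (k true)))).
    apply: heq_trans (hcomp_eq er (heq_refl _)) _.
    apply: heq_trans (hcompDl _ _ _) _.
    by apply: hadd_eq; apply: heq_trans (hcompZl _ _ _) _; apply: hscale_eq (tt _).
  pose ga s' := hull_shift x s s' + be e (s' (+) false).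
  have ga_ok : shift_ok x y e ga by have := shift_comp_ok (hull_shift_ok c_itv x s) (k e).
  have gas : 2 * pi <= ga s - al s.
    have g_gt : al s < ga s.
      have := arc_ge0 (shift_arc (k e) (s (+) false)).
      by have := small s; rewrite /ga /hull_shift eqxx; lra.
    rewrite leNgt; apply/negP => lt2.
    have : ga s = al s; last by move: g_gt; lra.
    apply: cls_inj_itv; last by rewrite ltr_norml; apply/andP; split; lra.
    by rewrite (arc_cls (shift_arc ga_ok s)) (arc_cls (shift_arc h s)).
  have gaf : 2 * pi <= ga false.
    have alf := alt false.
    case: (s) gas => gas; last by lra.
    by have := shift_len ga_ok false; have := shift_len h false; rewrite /=; lra.
  have tp : (0 < turns (y e) (y e) (ga false))%N.
    by apply: turns_gt0; rewrite subrr ang0 add0r.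
  exists (r e * t ^+ (turns (y e) (y e) (ga false)).-1).
  have er' := congr1 (fun v : {ffun bool -> R^o} => v e) (er (x false) (gen t x false)).
  apply: etrans er' _.
  have sc (a1 a2 : R) (z1 z2 : {ffun bool -> R^o}) i :
    (a1 *: z1 + a2 *: z2) i = a1 * z1 i + a2 * z2 i by rewrite !ffunE.
  apply: etrans (sc _ _ _ _ _) _; rewrite !shift_entry.
  move: tp; rewrite /ga; case: (e) => /= tp; rewrite mulr0 ?addr0 ?add0r mulrCA -exprS prednK//.
have [r0 e0] := term false; have [r1 e1] := term true.
exists (r0 + r1).
have := congr1 (fun v : {ffun bool -> R^o} => v e) (eg (x false) (gen t x false)).
have sc (a1 : R) (z1 : {ffun bool -> R^o}) i : (a1 *: z1) i = a1 * z1 i by rewrite !ffunE.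
have ad (z1 z2 : {ffun bool -> R^o}) i : (z1 + z2) i = z1 i + z2 i by rewrite !ffunE.
move=> /(etrans (esym (sc _ _ _))); rewrite shift_entry /= eqxx turns_small// expr0 mulr1 => ->.
by apply: etrans (ad _ _ _) _; rewrite e0 e1 -mulrDr mulrC.
Qed.

End Stable.

(** * Lifting the basis of C_c to F_c *)

Section LiftBasis.
Variables (RR : realType) (R : idomainType) (t : R).
Hypotheses (R_dvr : is_dvr R) (t_unif : is_uniformizer t).
Variables (K : fieldType) (q : {rmorphism R -> K}).
Hypothesis K_res : is_residue_field t q.
Variable c : RR.
Hypothesis c_itv : 0 < c < pi.
Local Notation circle := (circle RR).
Local Notation Fc := (Fc t c).
Local Notation admissible := (admissible c).
Local Notation cpair := (cpair c).
Local Notation shift := (shift R_dvr t_unif c_itv).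
Local Notation J := (projinj_ideal (@Fc_exact RR R t c) (Fc_has_biproducts t c)).
Let c0 : 0 < c := c_gt0 c_itv.
Let cpi : c < pi := c_ltpi c_itv.
Let pi0 := twopi_gt0 RR.

Definition cpoint (X : cpair) (s : bool) : circle := if s then cp1 X else cp0 X.

Lemma cpoint_len X (u v : RR) : cls u = cp0 X -> cls v = cp1 X -> 0 < v - u < 2 * pi ->
  forall s, len (cpoint X) s = if s then u + 2 * pi - v else v - u.
Proof.
move=> U V /andP[l1 l2] [] /=; rewrite /len /= -U -V -clsB.
  by rewrite -(cls_p (u - v)) ang_cls; [lra|apply/andP; split; lra].
by rewrite ang_cls//; apply/andP; split; lra.
Qed.

Lemma cpoint_admissible X : cpoint X true != cpoint X false /\ forall s, pi - c <= len (cpoint X) s.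
Proof.
have [u [v [U V h1 h2 h3]]] := cp_lift X; rewrite /phi /phiV in h1 h2 h3.
have l : 0 < v - u < 2 * pi by move: c0 cpi; lra.
split; last by move=> s; rewrite (cpoint_len U V l); case: s; lra.
apply/eqP => e; have {}e : cls v = cls u by rewrite U V.
have : v = u; last by lra.
by apply: cls_inj_itv e _; rewrite ltr_norml; apply/andP; split; lra.
Qed.

Definition admissible_of X : admissible := Admissible (proj1 (cpoint_admissible X)) (proj2 (cpoint_admissible X)).

Local Notation Pair_of X := (Pair R_dvr t_unif c_itv (admissible_of X)).

Definition short (x y : admissible) (e : bool) : Prop :=
  exists al, shift_ok x y e al /\ forall s, al s < len x s - (pi - c).

(** With [al false = a - u] and [al true = b - v], the inequalities between lifts [u], [v] of [X]
    and [a], [b] of [Y] that define the basis element say that this shift moves forward and is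
    short. *)
Lemma basis_short e X Y : basis e X Y <-> short (admissible_of X) (admissible_of Y) e.
Proof.
split=> [[u [v [a [b [[U V] [A B] n]]]]]|[al [ok sm]]].
  have l := near_len c_itv n; have l' := near_len' c_itv n.
  have lx := cpoint_len U V l.
  have ly : len (cpoint Y) e = b - a.
    have la : cls b - cls a = cpoint Y (~~ e) - cpoint Y e by rewrite A B; case: (e).
    by rewrite /len -la -clsB ang_cls//; case/andP: l' => ? ?; rewrite ltW.
  case: n; rewrite /phiV => n1 n2 n3 n4; exists (fun s => if s then b - v else a - u); split.
    have ly' := len_sum (proj1 (cpoint_admissible Y)) e.
    split=> [] [] /=.
    - apply: arcP; first by rewrite subr_ge0.
      by rewrite clsB V B; case: (e).
    - apply: arcP; first by rewrite subr_ge0.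
      by rewrite clsB U A; case: (e).
    - by rewrite lx; lra.
    - by rewrite lx ly; lra.
  by case; rewrite lx; lra.
have ly := alen_sum (admissible_of X) false; rewrite /= in ly.
have lg := alen_ge (admissible_of X) false; have lg' := alen_ge (admissible_of X) true.
have a0 := arc_ge0 (shift_arc ok false); have a1 := arc_ge0 (shift_arc ok true).
have s0 := sm false; have s1 := sm true.
have le := shift_len ok false; rewrite /= in lg lg' s0 s1 le.
pose u := ang (cp0 X); pose v := u + len (cpoint X) false.
have U : cls u = cp0 X by rewrite angK.
have V : cls v = cp1 X by rewrite /v clsD (arc_cls (len_arc _ _)) U /= addrC subrK.
exists u, v, (u + al false), (v + al true); split=> //.
  split; rewrite clsD (arc_cls (shift_arc ok _)) ?U ?V /= addrC subrK; by case: (e).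
by split; rewrite /phiV /v; lra.
Qed.

Lemma small_ang (x y : admissible) e al : shift_ok x y e al ->
  (forall s, al s < 2 * pi) -> forall s, al s = ang (y (s (+) e) - x s).
Proof. by move=> ok sm s; apply/esym; apply: ang_arc (shift_arc ok s) (sm s). Qed.

Lemma short_lt (x : admissible) (al : bool -> RR) : (forall s, al s < len x s - (pi - c)) ->
  forall s, al s < 2 * pi.
Proof.
move=> sm s; have := sm s; have := alen_le x s.
by move: cpi c0; lra.
Qed.

Definition has_shift X Y :=
  exists e al, shift_ok (admissible_of X) (admissible_of Y) e al /\ forall s, al s < len (admissible_of X) s - (pi - c).

(** Lifts the basis element of [C_c(X, Y)], of either sign, and is zero if there is none. *)
Definition basic_shift X Y : @hom R Fc (Pair_of X) (Pair_of Y) :=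
  match pselect (has_shift X Y) with
  | left h => shift (proj1 (projT2 (cid (projT2 (cid h)))))
  | right _ => hzero _ _
  end.

Lemma basic_shiftE X Y e al (ok : shift_ok (admissible_of X) (admissible_of Y) e al) :
  (forall s, al s < len (admissible_of X) s - (pi - c)) -> basic_shift X Y =~ shift ok.
Proof.
move=> sm; rewrite /basic_shift; case: pselect => [h|nh]; last by case: nh; exists e, al.
move: (projT2 (cid (projT2 (cid h)))) => [ok' sm'] /=.
have ee : projT1 (cid h) = e.
  apply: (basis_uniq c_itv (X := X) (Y := Y)); apply/basis_short.
    by exists (projT1 (cid (projT2 (cid h)))).
  by exists al.
apply: shift_irr => // s.
apply: etrans (small_ang ok' (short_lt sm') s) _; rewrite ee.
exact: esym (small_ang ok (short_lt sm) s).
Qed.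

Lemma basic_shift_short X Y e : cbasis X Y = Some e ->
  exists al, exists2 ok : shift_ok (admissible_of X) (admissible_of Y) e al,
    (forall s, al s < len (admissible_of X) s - (pi - c)) & basic_shift X Y =~ shift ok.
Proof.
move=> /(cbasisP c_itv)/basis_short[al [ok sm]]; exists al, ok => //.
exact: basic_shiftE.
Qed.

Lemma short_cbasis X Y e al : shift_ok (admissible_of X) (admissible_of Y) e al ->
  (forall s, al s < len (admissible_of X) s - (pi - c)) -> cbasis X Y = Some e.
Proof. by move=> ok sm; apply/(cbasisP c_itv)/basis_short; exists al. Qed.

(** Multiplication by [t] on a pair is the shift by a full turn, which is longer than any short
    shift. *)
Lemma scale_t_ideal (x : admissible) (V : Fc) (f : @hom R Fc (Pair R_dvr t_unif c_itv x) V) a :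
  principal t a -> inI J (hscale a f).
Proof.
move=> [r ->]; apply: inI_eq (hscaleA _ _ _) _; apply: inIZ.
have ok : shift_ok x x false (fun _ => 2 * pi).
  split=> s; rewrite addbF; first exact: arc_2pi.
  by rewrite addrC.
have ok_ideal : inI J (shift ok).
  by apply: (@far_shift_ideal _ _ _ _ _ _ _ _ false); have := alen_le x false; move: cpi; lra.
have e : shift ok =~ hscale t (hid (Pair R_dvr t_unif c_itv x)).
  apply: (@Pair_ext _ _ _ R_dvr t_unif _ c_itv _ _ _ _ false); rewrite shift_gen.
  exact: (rmap_2pi (V := psum t x)).
have {}ok_ideal := inI_eq e ok_ideal.
apply: inI_eq (inIl f ok_ideal).
apply: heq_trans (hcompZr _ _ _) _; apply: hscale_eq; exact: hcomp1r.
Qed.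

Lemma qeq_scale_q (x : admissible) (V : Fc) (f : @hom R Fc (Pair R_dvr t_unif c_itv x) V) a a' :
  q a = q a' -> qeq J (hscale a f) (hscale a' f).
Proof.
move=> e; apply/qeqP; exists (hscale (a - a') f).
  apply: scale_t_ideal; apply/(proj2 K_res); by rewrite rmorphB e subrr.
apply: heq_trans (hscaleDl _ _ _).
rewrite subrK; exact: heq_refl.
Qed.

Definition qlift (k : K) : R := projT1 (cid (proj1 K_res k)).
Lemma qliftK k : q (qlift k) = k. Proof. exact: projT2 (cid (proj1 K_res k)). Qed.

Definition lift_chom X Y (f : chom K X Y) : @hom R Fc (Pair_of X) (Pair_of Y) :=
  hscale (qlift (ccoef f)) (basic_shift X Y).

Lemma lift_chom_scale X Y (f : chom K X Y) a : q a = ccoef f ->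
  qeq J (lift_chom f) (hscale a (basic_shift X Y)).
Proof. by move=> e; apply: qeq_scale_q; rewrite qliftK. Qed.

Lemma lift_chom0 X Y (f : chom K X Y) : ccoef f = 0 -> qeq J (lift_chom f) (hzero _ _).
Proof.
move=> e; apply: qeq_trans (@lift_chom_scale _ _ f 0 _) _; first by rewrite rmorph0.
by apply: qeq_heq; apply: hscale0l.
Qed.

Lemma lift_chomD X Y (f g h : chom K X Y) : ccoef h = ccoef f + ccoef g ->
  qeq J (lift_chom h) (hadd (lift_chom f) (lift_chom g)).
Proof.
move=> e; apply: qeq_trans (@lift_chom_scale _ _ h (qlift (ccoef f) + qlift (ccoef g)) _) _.
  by rewrite rmorphD !qliftK.
by apply: qeq_heq; apply: hscaleDl.
Qed.

Lemma lift_chomZ X Y a (f h : chom K X Y) : ccoef h = q a * ccoef f ->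
  qeq J (lift_chom h) (hscale a (lift_chom f)).
Proof.
move=> e; apply: qeq_trans (@lift_chom_scale _ _ h (a * qlift (ccoef f)) _) _.
  by rewrite rmorphM qliftK.
by apply: qeq_heq; apply: heq_sym; apply: hscaleA.
Qed.

Lemma far_ideal (x y : admissible) e al (ok : shift_ok x y e al) :
  ~ (forall s, al s < len x s - (pi - c)) -> inI J (shift ok).
Proof.
move=> /existsNP[s /negP]; rewrite -leNgt => far.
exact: far_shift_ideal far.
Qed.

Lemma lift_chom1 X (f : chom K X X) :
  ccoef f = (if cbasis X X == Some false then 1 else 0) ->
  qeq J (lift_chom f) (hid (Pair_of X)).
Proof.
have ok := shift_id_ok (admissible_of X).
have e1 : shift ok =~ hid (Pair_of X).
  apply: heq_trans _ (@shift_id _ _ _ R_dvr t_unif _ c_itv (admissible_of X)).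
  exact: shift_irr.
have [sm|far] := pselect (forall s, 0 < len (admissible_of X) s - (pi - c)).
  rewrite (short_cbasis ok sm) eqxx => e.
  apply: qeq_trans (@lift_chom_scale _ _ f 1 _) _; first by rewrite rmorph1.
  apply: qeq_heq; apply: heq_trans (hscale1 _) _.
  exact: heq_trans (basic_shiftE ok sm) e1.
have nb : cbasis X X != Some false.
  apply/eqP => /basic_shift_short[al [ok' sm _]]; apply: far => s.
  have := sm s; have -> := small_ang ok' (short_lt sm) s.
  by rewrite addbF subrr ang0.
rewrite (negbTE nb) => e.
apply: qeq_trans (lift_chom0 e) _; apply: qeq_sym.
apply/qeqP; exists (hid (Pair_of X)); last exact: heq_sym (hadd0r _).
exact: inI_eq e1 (far_ideal ok far).
Qed.

(** The composite of two short shifts moves generators by less than [2 pi], so it is the only shift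
    of its sign with this property. It is therefore short exactly when [C_c(X, Z)] has a basis
    element of that sign, and stably zero otherwise. *)
Lemma lift_chomM X Y Z (g : chom K Y Z) (f : chom K X Y) :
  qeq J (lift_chom (ccomp g f)) (hcomp (lift_chom g) (lift_chom f)).
Proof.
apply: qeq_sym.
have zero : compatible X Y Z = false -> ccoef (ccomp g f) = 0 by move=> /= ->.
case EYZ : (cbasis Y Z) => [e'|]; last first.
  have z0 : ccoef (ccomp g f) = 0 by apply: zero; rewrite /compatible EYZ.
  apply: qeq_trans (qcomp_eq (lift_chom0 (ccoef0 g EYZ)) (qeq_heq _ (heq_refl _))) _.
  apply: qeq_trans (qeq_heq _ (hcomp0l _ _)) _; exact: qeq_sym (lift_chom0 z0).
case EXY : (cbasis X Y) => [e|]; last first.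
  have z0 : ccoef (ccomp g f) = 0 by apply: zero; rewrite /compatible EYZ EXY.
  apply: qeq_trans (qcomp_eq (qeq_heq _ (heq_refl _)) (lift_chom0 (ccoef0 f EXY))) _.
  apply: qeq_trans (qeq_heq _ (hcomp0r _ _)) _; exact: qeq_sym (lift_chom0 z0).
have [al [ok sm be]] := basic_shift_short EXY.
have [al' [ok' sm' be']] := basic_shift_short EYZ.
pose ok'' := shift_comp_ok ok ok'.
have comp_e : hcomp (lift_chom g) (lift_chom f) =~
    hscale (qlift (ccoef g) * qlift (ccoef f)) (shift ok'').
  apply: heq_trans (hcompZl _ _ _) _; apply: heq_trans (hscale_eq _ (hcompZr _ _ _)) _.
  apply: heq_trans (hscaleA _ _ _) _; apply: hscale_eq.
  apply: heq_trans (hcomp_eq be' be) _; exact: shift_comp.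
apply: qeq_trans (qeq_heq _ comp_e) _.
have [short|far] := pselect (forall s, al s + al' (s (+) e) < len (admissible_of X) s - (pi - c)).
  have EXZ := short_cbasis ok'' short.
  apply: qeq_sym; apply: qeq_trans (@lift_chom_scale _ _ _ (qlift (ccoef g) * qlift (ccoef f)) _) _.
    by rewrite rmorphM !qliftK /= /compatible EYZ EXY EXZ addbC eqxx.
  by apply: qeq_heq; apply: hscale_eq; apply: basic_shiftE.
have z0 : ccoef (ccomp g f) = 0.
  apply: zero; rewrite /compatible EYZ EXY; apply/eqP => /basic_shift_short[ga [ok3 sm3 _]].
  have lt2 s : al s + al' (s (+) e) < 2 * pi.
    have := sm' (s (+) e); have := sm (~~ s); have := shift_len ok s.
    have := alen_sum (admissible_of X) s; have := alen_ge (admissible_of X) s.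
    have := alen_ge (admissible_of X) (~~ s); move: cpi; lra.
  apply: far => s; have := sm3 s.
  have -> := small_ang ok3 (short_lt sm3) s.
  by have /= -> := small_ang ok'' lt2 s; rewrite [e' (+) e]addbC.
apply: qeq_trans _ (qeq_sym (lift_chom0 z0)).
apply/qeqP; eexists; last exact: heq_sym (hadd0r _).
by apply: inIZ; apply: far_ideal.
Qed.

Lemma lift_chom_full X Y (f : @hom R Fc (Pair_of X) (Pair_of Y)) :
  exists g : chom K X Y, qeq J (lift_chom g) f.
Proof.
have one e al (ok : shift_ok (admissible_of X) (admissible_of Y) e al) r :
    exists g : chom K X Y, qeq J (lift_chom g) (hscale r (shift ok)).
  have [sm|far] := pselect (forall s, al s < len (admissible_of X) s - (pi - c)).
    have EXY := short_cbasis ok sm.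
    have h0 : cbasis X Y = None -> q r = 0 by rewrite EXY.
    exists (CHom h0).
    have hs : qeq J (lift_chom (CHom h0)) (hscale r (basic_shift X Y)) by exact: lift_chom_scale.
    apply: qeq_trans hs _.
    by apply: qeq_heq; apply: hscale_eq; apply: basic_shiftE.
  have z0 : cbasis X Y = None -> (0 : K) = 0 by [].
  have hs : qeq J (lift_chom (CHom z0)) (hzero _ _) by exact: lift_chom0.
  exists (CHom z0); apply: qeq_trans hs _.
  apply: qeq_sym; apply/qeqP; eexists; last exact: heq_sym (hadd0r _).
  by apply: inIZ; apply: far_ideal.
have [al [ok [r e]]] := hom_decomp f.
have [g0 e0] := one _ _ (ok false) (r false).
have [g1 e1] := one _ _ (ok true) (r true).
exists (CHom (@cadd_subproof _ _ _ _ _ g0 g1)).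
have hs : qeq J (lift_chom (CHom (@cadd_subproof _ _ _ _ _ g0 g1))) (hadd (lift_chom g0) (lift_chom g1)).
  exact: lift_chomD.
apply: qeq_trans hs _.
apply: qeq_trans (qadd_eq e0 e1) _; exact: qeq_heq (heq_sym e).
Qed.

Lemma lift_chom_faithful X Y (f : chom K X Y) : qeq J (lift_chom f) (hzero _ _) -> ccoef f = 0.
Proof.
move=> /ideal_zero h; case EXY : (cbasis X Y) => [e|]; last exact: ccoef0 EXY.
have [al [ok sm be]] := basic_shift_short EXY.
have : factors_projinj (@Fc_exact RR R t c) (hscale (qlift (ccoef f)) (shift ok)).
  by apply: factors_eq h; apply: hscale_eq be.
move=> /(short_shift_faithful sm)/(proj2 K_res).
by rewrite qliftK.
Qed.

End LiftBasis.

(** * Decomposition of the objects of F_c *)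

Section Decomposition.
Variables (RR : realType) (R : idomainType) (t : R).
Hypotheses (R_dvr : is_dvr R) (t_unif : is_uniformizer t).
Variable c : RR.
Hypothesis c_itv : 0 < c < pi.
Local Notation circle := (circle RR).
Local Notation rep := (rep RR t).
Local Notation Fc := (Fc t c).
Local Notation cpair := (cpair c).
Local Notation Pair_of X := (Pair R_dvr t_unif c_itv (admissible_of c_itv X)).
Let t0 : t != 0 := uniformizer_neq0 R_dvr t_unif.
Let c0 : 0 < c := c_gt0 c_itv.
Let cpi : c < pi := c_ltpi c_itv.
Let pi0 := twopi_gt0 RR.
Let b0 : 0 <= pi - c. Proof. by rewrite subr_ge0 ltW. Qed.

Lemma rhom_psumE (I : finType) (x : I -> circle) (W : rep) (f : rhom (psum t x) W) p
    (v : psum t x p) :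
  f p v = \sum_k (v : {ffun I -> R^o}) k *: rmap W (arc_ang (x k) p) (f (x k) (gen t x k)).
Proof.
rewrite {1}(psum_decomp v) linear_sum; apply: eq_bigr => k _.
by rewrite linearZ -rfun_nat.
Qed.

Lemma turns_0 (x p : circle) : turns x p 0 = 0%N.
Proof.
have /andP[a0 a1] := ang_itv (x - p); rewrite /turns addr0.
by apply: truncn_def; rewrite divr_ge0// 1?ltW//= ltr_pdivrMr// mul1r.
Qed.

Section Split.
Variables (I : finType) (x : I -> circle) (d : rhom (psum t x) (psum t x)).
Hypothesis dd : forall p v, d p (d p v) = t *: v.
Hypothesis d_deep : deep (pi - c) d.

Let entry k i : R := (d (x i) (gen t x i) : {ffun I -> R^o}) k.

Lemma entry_neq0 (i0 : I) : exists k i, entry k i != 0.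
Proof.
apply: contrapT => h.
have z i : d (x i) (gen t x i) = 0.
  apply/ffunP => k; rewrite ffunE; apply: contrapT => /eqP ne; apply: h.
  by exists k, i.
have : t = 0; last exact/eqP.
have := dd (gen t x i0); rewrite z linear0 => /ffunP/(_ i0).
by rewrite !ffunE eqxx /GRing.scale /= mulr1.
Qed.

(** The depth of a nonzero entry is an angle plus [2 pi] times its valuation. Comparing valuations,
    an entry of depth at least [a] is divisible by the structure map of length [a]. *)
Lemma least_entry (i0 : I) : exists i j a u,
  [/\ arc (x j) (x i) a, u \is a GRing.unit,
      entry j i = u * t ^+ turns (x j) (x j) a & deep a d].
Proof.
have fac (r : R) : exists n, r != 0 -> exists2 u, u \is a GRing.unit & r = u * t ^+ n.
  have [->|/(dvr_factor R_dvr t_unif)[n [u [uu e]]]] := eqVneq r 0; first by exists 0%N.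
  by exists n => _; exists u.
have /choice[v vE] := fac.
pose D (p : I * I) : RR := ang (x p.1 - x p.2) + (v (entry p.1 p.2))%:R * (2 * pi).
have [k0 [l0 ne0]] := entry_neq0 i0.
have [[j i] /= ne mn] : exists2 p : I * I, entry p.1 p.2 != 0 &
    forall p', entry p'.1 p'.2 != 0 -> D p <= D p'.
  have ne' : entry (k0, l0).1 (k0, l0).2 != 0 by [].
  by case: (@arg_minP _ _ _ (k0, l0) (fun p => entry p.1 p.2 != 0) D ne') => p; exists p.
have [u uu e] := vE _ ne.
have D0 : 0 <= D (j, i).
  by rewrite addr_ge0//; [case/andP: (ang_itv (x j - x i))|rewrite mulr_ge0// ltW].
have ha : arc (x j) (x i) (D (j, i)).
  by apply: arcP => //; rewrite clsD angK -[(v _)%:R]/((Posz _)%:~R) clsM2pi addr0.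
exists i, j, (D (j, i)), u; split=> //.
  rewrite [LHS]e; congr (_ * _ ^+ _).
  apply/eqP; rewrite -(eqr_nat RR); apply/eqP; apply: (mulIf (lt0r_neq0 pi0)).
  by have := turnsE (x j) ha; rewrite subrr ang0 /D /=; lra.
apply: deep_gens => k q h.
have /choice[w wE] : forall l, exists s, entry l k = t ^+ turns (x l) q (D (j, i)) * s.
  move=> l; have [->|nl] := eqVneq (entry l k) 0; first by exists 0; rewrite mulr0.
  have le := mn (l, k) nl; have [u' uu' e'] := vE _ nl.
  have := turnsE (x l) h; have /andP[q0 q1] := ang_itv (x l - q).
  set T := turns _ _ _ => eT.
  have Tv : (T <= v (entry l k))%N.
    rewrite -ltnS -(ltr_nat RR) -(ltr_pM2r pi0) -[_.+1%:R]natr1 mulrDl mul1r.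
    by move: le eT; rewrite {2}/D /=; lra.
  by exists (u' * t ^+ (v (entry l k) - T)); rewrite mulrCA -exprD subnKC.
exists ([ffun l => w l] : {ffun I -> R^o}); apply/ffunP => l.
by rewrite psum_rmapE ffunE -wE.
Qed.

(** [d ^ 2] is divisible by the structure map of length [2 a], but multiplication by [t] is that of
    length [2 pi] and not divisible by [t ^+ 2]. *)
Lemma deep_square_le (a : RR) (i : I) : 0 <= a -> deep a d -> a <= pi.
Proof.
move=> a0 da.
have [w wE] := da _ _ (arc_pre (x i) a0) (gen t x i).
have [y yE] := da _ _ (arc_pre _ a0) w.
have h := arc_trans (arc_pre (x i + cls a) a0) (arc_pre (x i) a0).
have := dd (gen t x i); rewrite -wE -rfun_nat -yE (rmapC _ _ h)//.
move=> /ffunP/(_ i); rewrite psum_rmapE !ffunE eqxx /GRing.scale /= mulr1.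
have := turnsE (x i) h; rewrite subrr ang0 add0r.
have /andP[q0 _] := ang_itv (x i - (x i + cls a + cls a)).
case: (turns _ _ _) => [|[|n]] eT e; [by move: eT pi0; rewrite mul0r; lra|by move: eT; rewrite mul1r; lra|].
move: e; rewrite !exprS -!mulrA -[RHS]mulr1 => /(mulfI t0) e; exfalso.
move/negP: (uniformizer_nunit t_unif); apply; apply/unitrP; eexists.
by rewrite [X in X = _ /\ _]mulrC; split; exact: e.
Qed.

Lemma entry_depth_ge (i j : I) a u : arc (x j) (x i) a -> u \is a GRing.unit ->
  entry j i = u * t ^+ turns (x j) (x j) a -> pi - c <= a.
Proof.
move=> ha uu e; have [w wE] := d_deep (arc_pre (x i) b0) (gen t x i).
have := congr1 (fun z : {ffun I -> R^o} => z j) wE; rewrite psum_rmapE -/(entry j i) e.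
set z := (w : {ffun I -> R^o}) j; have [->|z0] := eqVneq z 0.
  rewrite mulr0 => /esym/eqP; rewrite mulf_eq0 (negbTE (expf_neq0 _ t0)) orbF => /eqP u0.
  by move: uu; rewrite u0 unitr0.
have [k [u' [uu' ->]]] := dvr_factor R_dvr t_unif z0.
rewrite mulrCA -exprD => /(unif_pow_unit R_dvr t_unif uu' uu) eT.
have := turnsE (x j) ha; have := turnsE (x j) (arc_pre (x i) b0).
rewrite subrr ang0 -eT natrD mulrDl.
have /andP[q0 _] := ang_itv (x j - (x i + cls (pi - c))).
have : 0 <= k%:R * (2 * pi) :> RR by rewrite mulr_ge0// ltW.
lra.
Qed.

Definition psum_obj : Fc :=
  exist _ (FpiObj (psum_fg t x) (psum_projective (x := x)) dd : Fpi RR t)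
    (has_depth_deep R_dvr t_unif b0 d_deep).

End Split.

(** ** Splitting off a pair *)

Section Summand.
Variables (I : finType) (x : I -> circle) (d : rhom (psum t x) (psum t x)).
Hypothesis dd : forall p v, d p (d p v) = t *: v.
Hypothesis d_deep : deep (pi - c) d.
Let V : Fc := psum_obj dd d_deep.
Variables (i j : I) (X : cpair).
Local Notation a := (cpoint X).
Variables (g : psum t x (a false)) (g' : psum t x (a true)).
Hypotheses (ij : i != j) (Xi : a false = x i) (Xj : a true = x j).
Hypothesis gE : forall k, (g : {ffun I -> R^o}) k = if k == i then 1 else 0.
Let u : R := (g' : {ffun I -> R^o}) j.
Hypothesis u_unit : u \is a GRing.unit.
Hypothesis dg : d (a false) g = rmap (psum t x) (len_arc a false) g'.
Hypothesis d_deeper : deep (len a false) d.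

(** [g] is the generator [i] and [d g] is the structure map applied to [g'], whose coordinate [u]
    at [j] is a unit. So [g], [g'] and the generators other than [i], [j] form another basis. *)
Definition others := {k : I | (k != i) && (k != j)}.
Let x' (l : others) : circle := x (val l).

Let incl_ex : exists f : @hom R Fc (Pair_of X) V,
  (f : fpi_hom _ _) (a false) (gen t a false) = g /\
  (f : fpi_hom _ _) (a true) (gen t a true) = g'.
Proof.
exact: (@pair_hom1 _ _ _ t0 a (apt_neq (admissible_of c_itv X)) (sval V)
  (@Fc_free _ _ _ R_dvr t_unif _ c_itv V) false g g').
Qed.

Let iota : @hom R Fc (Pair_of X) V := projT1 (cid incl_ex).
Let iota0 : (iota : fpi_hom _ _) (a false) (gen t a false) = g.
Proof. by case: (projT2 (cid incl_ex)). Qed.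
Let iota1 : (iota : fpi_hom _ _) (a true) (gen t a true) = g'.
Proof. by case: (projT2 (cid incl_ex)). Qed.

(** [rho] and [prj] are the coordinates in the new basis along [g], [g'] and along the others. *)
Let rho_gen (k : I) : {ffun bool -> R^o} :=
  [ffun s : bool => if k == j then (if s then u^-1 else - u^-1 * (g' : {ffun I -> R^o}) i)
                    else if (k == i) && ~~ s then 1 else 0].
Let rho : rhom (psum t x) (psum t a) :=
  psum_lift (fun k : I => rho_gen k : psum t a (x k)).

Let pi_gen (k : I) : {ffun others -> R^o} :=
  [ffun l : others => if k == j then - u^-1 * (g' : {ffun I -> R^o}) (val l)
                      else if k == val l then 1 else 0].
Let prj : rhom (psum t x) (psum t x') :=
  psum_lift (fun k : I => pi_gen k : psum t x' (x k)).

Let sec : rhom (psum t x') (psum t x) := psum_lift (fun l : others => gen t x (val l)).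

Let lift_at (J : finType) (y : J -> circle) (F : I -> {ffun J -> R^o}) p (v : psum t x p) m :
  (psum_lift (fun k : I => F k : psum t y (x k)) p v : {ffun J -> R^o}) m =
  \sum_k (v : {ffun I -> R^o}) k * (t ^+ turns (y m) (x k) (ang (x k - p)) * F k m) :> R.
Proof.
rewrite psum_liftE sum_ffunE; apply: eq_bigr => k _.
by rewrite ffunE psum_rmapE.
Qed.

Let rho_iota : rhom_eq (rcomp rho (iota : fpi_hom _ _)) (rid _).
Proof.
apply: psum_ext => -[].
  change (rho (a true) ((iota : fpi_hom _ _) (a true) (gen t a true)) = gen t a true).
  rewrite iota1; apply/ffunP => s; rewrite lift_at (bigD1 j)//= (bigD1 i)//= big1 ?addr0.
    rewrite -Xj subrr ang0 turns_0 expr0 mul1r !ffunE eqxx (negbTE ij) eqxx /=.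
    case: s => /=; rewrite /= ?mulr0 ?addr0 -/u; first by rewrite divrr.
    rewrite -Xi turns_small ?ang_itv// expr0 !mulr1 mulNr mulrN mulrA divrr// mul1r.
    by rewrite addNr.
  by move=> k /andP[kj ki]; rewrite ffunE (negbTE kj) (negbTE ki) /= !mulr0.
change (rho (a false) ((iota : fpi_hom _ _) (a false) (gen t a false)) = gen t a false).
rewrite iota0; apply/ffunP => s; rewrite lift_at (bigD1 i)//= big1 ?addr0.
  rewrite gE eqxx mul1r -Xi subrr ang0 turns_0 expr0 mul1r !ffunE (negbTE ij) eqxx /=.
  by case: s.
by move=> k ki; rewrite gE (negbTE ki) mul0r.
Qed.

Let prj_iota : rhom_eq (rcomp prj (iota : fpi_hom _ _)) (rzero _ _).
Proof.
apply: psum_ext => -[].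
  change (prj (a true) ((iota : fpi_hom _ _) (a true) (gen t a true)) = 0).
  rewrite iota1; apply/ffunP => l; rewrite lift_at ffunE.
  have /andP[li lj] := valP l.
  rewrite (bigD1 j)//= (bigD1 (val l))//= big1 ?addr0.
    rewrite -Xj subrr ang0 turns_0 expr0 mul1r !ffunE eqxx (negbTE lj) eqxx -/u.
    rewrite turns_small ?ang_itv// expr0 !mulr1 mulNr mulrN mulrA divrr// mul1r.
    by rewrite addNr.
  by move=> k /andP[kj kl]; rewrite ffunE (negbTE kj) (negbTE kl) !mulr0.
change (prj (a false) ((iota : fpi_hom _ _) (a false) (gen t a false)) = 0).
rewrite iota0; apply/ffunP => l; rewrite lift_at ffunE big1// => k _.
rewrite gE; case: eqP => [->|_]; last by rewrite mul0r.
have /andP[li lj] := valP l.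
by rewrite ffunE (negbTE ij) eq_sym (negbTE li) !mulr0.
Qed.

Let prj_sec : rhom_eq (rcomp prj sec) (rid _).
Proof.
apply: psum_ext => l.
change (prj (x' l) (sec (x' l) (gen t x' l)) = gen t x' l).
rewrite [sec _ _]psum_lift_gen [LHS]psum_lift_gen; apply/ffunP => l'; rewrite !ffunE.
have /andP[_ lj] := valP l.
by rewrite (negbTE lj) (inj_eq val_inj) eq_sym.
Qed.

Let secE p (v : psum t x' p) m : (sec p v : {ffun I -> R^o}) m =
  if insub m is Some l then (v : {ffun others -> R^o}) l else 0.
Proof.
rewrite psum_liftE sum_ffunE.
have term l : (((v : {ffun others -> R^o}) l *: rmap (psum t x) (arc_ang (x' l) p)
    (gen t x (val l))) : {ffun I -> R^o}) m =
    if m == val l then (v : {ffun others -> R^o}) l else 0.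
  by rewrite ffunE rmap_gen_ang; case: eqP => _; rewrite /GRing.scale /= ?mulr1 ?mulr0.
case: insubP => [l _ lm|nm].
  rewrite (bigD1 l)// big1 => [|l' ll'].
    by apply: etrans (addr0 _) _; rewrite term lm eqxx.
  by rewrite term -lm (inj_eq val_inj) eq_sym (negbTE ll').
rewrite big1// => l _; rewrite term; case: eqP => // ml.
by move: nm; rewrite ml (valP l).
Qed.

Let iotaE p (v : psum t a p) m : ((iota : fpi_hom _ _) p v : {ffun I -> R^o}) m =
  (v : {ffun bool -> R^o}) false * (if m == i then 1 else 0) +
  (v : {ffun bool -> R^o}) true *
    (t ^+ turns (x m) (a true) (ang (a true - p)) * (g' : {ffun I -> R^o}) m).
Proof.
have e : (iota : fpi_hom _ _) p v = (v : {ffun bool -> R^o}) true *: rmap (psum t x) (arc_ang (a true) p) g' +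
   (v : {ffun bool -> R^o}) false *: rmap (psum t x) (arc_ang (a false) p) g.
  have := rhom_psumE (W := psum t x) (iota : fpi_hom _ _) v.
  by rewrite big_bool iota0 iota1.
have sc (r1 r2 : R) (z1 z2 : {ffun I -> R^o}) k :
  (r1 *: z1 + r2 *: z2) k = r1 * z1 k + r2 * z2 k by rewrite !ffunE.
apply: etrans (congr1 (fun z : {ffun I -> R^o} => z m) e) _.
apply: etrans (sc _ _ _ _ _) _; rewrite addrC; congr (_ * _ + _ * _).
  rewrite psum_rmapE gE; case: eqP => [->|_]; last by rewrite mulr0.
  by rewrite -Xi turns_small ?ang_itv// expr0 mulr1.
by rewrite psum_rmapE.
Qed.

Let complete : rhom_eq
  (radd (rcomp (iota : fpi_hom _ _) rho) (rcomp sec prj)) (rid _).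
Proof.
apply: psum_ext => k.
change ((iota : fpi_hom _ _) (x k) (rho (x k) (gen t x k)) +
  sec (x k) (prj (x k) (gen t x k)) = gen t x k).
rewrite [rho _ _]psum_lift_gen [prj _ _]psum_lift_gen; apply/ffunP => m.
have ad (z1 z2 : {ffun I -> R^o}) k' : (z1 + z2) k' = z1 k' + z2 k' by rewrite !ffunE.
apply: etrans (ad _ _ _) _; rewrite iotaE secE !ffunE /= andbT andbF.
have tj : k = j -> turns (x m) (a true) (ang (a true - x k)) = 0%N.
  by move=> ->; rewrite Xj subrr ang0 turns_0.
case: insubP => [l Pm lm|nm].
  rewrite -lm in Pm tj *; have /andP[/negbTE mi /negbTE mj] := Pm.
  rewrite mi mulr0 add0r ffunE; have [kj|kj] := eqVneq k j.
    by rewrite tj// expr0 mul1r mulNr subrr kj mj.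
  rewrite mul0r add0r eq_sym; by [].
rewrite addr0; move: nm; rewrite negb_and !negbK => /orP[]/eqP mE; rewrite mE in tj *.
  rewrite eqxx mulr1; have [kj|kj] := eqVneq k j.
    by rewrite tj// expr0 mul1r mulNr addNr kj (negbTE ij).
  by rewrite mul0r addr0 eq_sym.
rewrite [j == i]eq_sym (negbTE ij) mulr0 add0r eq_sym; have [kj|kj] := eqVneq j k.
  by rewrite tj// expr0 mul1r -/u mulVr.
by rewrite mul0r.
Qed.

Let dW : rhom (psum t x') (psum t x') := rcomp prj (rcomp d sec).

Let prj_d : rhom_eq (rcomp prj d) (rcomp dW prj).
Proof.
move=> p v; change (prj p (d p v) = prj p (d p (sec p (prj p v)))).
have cE : (iota : fpi_hom _ _) p (rho p v) + sec p (prj p v) = v by exact: complete.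
have dE : (iota : fpi_hom _ _) p (rot t a p (rho p v)) = d p ((iota : fpi_hom _ _) p (rho p v)).
  exact: (fpi_comm (iota : fpi_hom _ _) (rho p v)).
have pE : prj p ((iota : fpi_hom _ _) p (rot t a p (rho p v))) = 0 by exact: prj_iota.
by rewrite -{1}cE (linearD (d p)) -dE (linearD (prj p)) pE add0r.
Qed.

Let ddW p v : dW p (dW p v) = t *: v.
Proof.
change (dW p (prj p (d p (sec p v))) = t *: v).
have e : prj p (d p (d p (sec p v))) = dW p (prj p (d p (sec p v))) by exact: prj_d.
rewrite -e dd linearZ; congr (_ *: _); exact: prj_sec.
Qed.

Let dW_deep : deep (pi - c) dW.
Proof. by apply: deep_comp_l; apply: deep_comp_r. Qed.

Let W : Fc := psum_obj ddW dW_deep.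

(** The pair spanned by [g] and [g'] is stable under [d], so [d] induces a differential [dW] on the
    quotient. The retraction [rho] need not commute with [d], but as [d] is nowhere less deep than on
    this pair, [pair_injective] provides a retraction [r] that does; subtracting its values from
    [sec] gives a complement stable under [d]. *)
Lemma split_off : exists (dV : rhom (psum t x') (psum t x')) (ddV : forall p v, dV p (dV p v) = t *: v)
    (dV_deep : deep (pi - c) dV),
  forall (J : finType) (F : J -> Fc), dsum_data F (psum_obj (x := x') ddV dV_deep) ->
  inhabited (dsum_data (ocons (Pair_of X) F) V).
Proof.
exists dW, ddW, dW_deep => J F D.
have [r rE] := pair_injective t0 (x_neq := apt_neq (admissible_of c_itv X)) (s := false)
  (V := sval V) (f := (iota : fpi_hom _ _)) (r := rho) (fpi_id _) d_deeper rho_iota.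
pose p0 : @hom R Fc V (Pair_of X) := r.
pose q0 : @hom R Fc V W := @FpiHom _ _ _ (sval V) (sval W) prj prj_d.
pose s0 : rhom (psum t x') (psum t x) :=
  radd sec (rscale (- 1) (rcomp (iota : fpi_hom _ _) (rcomp r sec))).
have s0E p v : s0 p v = sec p v - (iota : fpi_hom _ _) p (r p (sec p v)).
  by rewrite -[in RHS]scaleN1r.
have rE' p v : r p ((iota : fpi_hom _ _) p v) = v by exact: rE.
have piE p v : prj p ((iota : fpi_hom _ _) p v) = 0 by exact: prj_iota.
have cE p v : (iota : fpi_hom _ _) p (rho p v) + sec p (prj p v) = v by exact: complete.
have psE p v : prj p (sec p v) = v by exact: prj_sec.
have rs p v : r p (s0 p v) = 0 by rewrite s0E linearB rE' subrr.
have ps p v : prj p (s0 p v) = v by rewrite s0E linearB piE subr0 psE.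
have c' p v : (iota : fpi_hom _ _) p (r p v) + s0 p (prj p v) = v.
  rewrite s0E; have e : sec p (prj p v) = v - (iota : fpi_hom _ _) p (rho p v).
    by rewrite -{2}(cE p v) addrAC subrr add0r.
  have e2 : r p (v - (iota : fpi_hom _ _) p (rho p v)) = r p v - rho p v.
    by rewrite linearB rE'.
  have e3 : (iota : fpi_hom _ _) p (r p v - rho p v) =
      (iota : fpi_hom _ _) p (r p v) - (iota : fpi_hom _ _) p (rho p v) by exact: linearB.
  have cancel (U : zmodType) (y z w : U) : y + (w - z - (y - z)) = w.
    by rewrite opprB subrKA addrC subrK.
  by rewrite e e2 e3; exact: cancel.
have s0d : rhom_eq (rcomp s0 (fpi_d (sval W))) (rcomp (fpi_d (sval V)) s0).
  move=> p v; change (s0 p (dW p v) = d p (s0 p v)).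
  rewrite -[RHS]c'; have -> : r p (d p (s0 p v)) = rot t a p (r p (s0 p v)) by exact: (fpi_comm r).
  rewrite rs !linear0 add0r; congr (s0 p _).
  have -> : prj p (d p (s0 p v)) = dW p (prj p (s0 p v)) by exact: prj_d.
  by rewrite ps.
pose j0 : @hom R Fc W V := @FpiHom _ _ _ (sval W) (sval V) s0 s0d.
by constructor; apply: (@dsum_cons _ _ _ _ _ _ _ (iota : @hom R Fc (Pair_of X) V) j0 p0 q0 _ D).
Qed.

End Summand.
(** The least depth [al] of an entry satisfies [pi - c <= al] because [d] is that deep, and
    [al <= pi] because [d ^ 2] is multiplication by [t]. So both arcs between the two points involved
    are long enough for an object of [C_c]; in particular the points differ, and the entry is off the
    diagonal. *)
Lemma psum_decomposes (n : nat) (I : finType) (x : I -> circle)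
    (d : rhom (psum t x) (psum t x)) (dd : forall p v, d p (d p v) = t *: v)
    (d_deep : deep (pi - c) d) : (#|I| <= n)%N ->
  exists (J : finType) (X : J -> cpair),
    inhabited (dsum_data (fun k => Pair_of (X k)) (psum_obj dd d_deep)).
Proof.
elim: n I x d dd d_deep => [|n ih] I x d dd d_deep cI; last first.
  have [I0|/card_gt0P[i0 _]] := posnP #|I|; first by apply: ih; rewrite I0.
  have [i [j [al [u [ha uu e da]]]]] := least_entry dd i0.
  have al0 := arc_ge0 ha.
  have al_le := deep_square_le dd i0 al0 da.
  have al_ge := entry_depth_ge d_deep ha uu e.
  have al_lt : 0 < al < 2 * pi by move: cpi; lra.
  have [g' g'E] := da _ _ ha (gen t x i).
  have lift_ij : exists x0 x1 : RR, [/\ cls x0 = x i, cls x1 = x j,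
      x0 <= phi c x0, phi c x0 <= x1 & x1 <= phiV c (x0 + 2 * pi)].
    exists (ang (x i)), (ang (x i) + al); rewrite /phi /phiV clsD angK (arc_cls ha).
    rewrite addrC subrK; split=> //; move: cpi c0; lra.
  pose X := CPair lift_ij.
  have lX : len (cpoint X) false = al.
    by apply: (ang_arc ha); case/andP: al_lt.
  have ij : i != j.
    by apply/eqP => ij; move: lX al_lt; rewrite /len /cpoint /= ij subrr ang0 => <-; rewrite ltxx.
  have dX : deep (len (cpoint X) false) d by rewrite lX.
  have g'j : (g' : {ffun I -> R^o}) j = u :> R.
    have /ffunP/(_ j) := g'E; rewrite psum_rmapE [RHS]e mulrC.
    exact: (mulIf (expf_neq0 _ t0)).
  have dgX : d (cpoint X false) (gen t x i : psum t x (cpoint X false)) =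
      rmap (psum t x) (len_arc (cpoint X) false) (g' : psum t x (cpoint X true)).
    by rewrite -[LHS]g'E; apply: rmap_irr.
  have gX k : (gen t x i : {ffun I -> R^o}) k = if k == i then 1 else 0 by rewrite ffunE.
  have uX : (g' : {ffun I -> R^o}) j \is a GRing.unit by rewrite g'j.
  have [dV [ddV [dVd split]]] := @split_off I x d dd d_deep i j X (gen t x i) g' ij erefl erefl gX uX dgX dX.
  have [|J [Y [D]]] := ih _ _ dV ddV dVd.
    rewrite card_sub -ltnS; apply: leq_trans cI.
    have I1 : (0 < #|I|)%N by apply/card_gt0P; exists i.
    rewrite -(prednK I1) ltnS -(cardC1 i); apply: subset_leq_card.
    by apply/fintype.subsetP => k; rewrite !inE => /andP[].
  have [D'] := split _ _ D.
  exists (option J), (fun o => if o is Some k then Y k else X); constructor.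
  move: D'; congr (dsum_data _ _).
  by apply: functional_extensionality_dep => -[].
exists void, (fun v : void => match v with end); constructor.
apply: dsum_empty => p v; apply/ffunP => i.
by have := max_card (pred1 i); rewrite card1 leqNgt ltnS cI.
Qed.

Lemma Fc_decomposes (V : Fc) : exists n (X : 'I_n -> cpair),
  inhabited (dsum_data (fun k => Pair_of (X k)) V).
Proof.
have [I [x [f]]] := Fc_free R_dvr t_unif c_itv V.
pose d := rcomp f (rcomp (fpi_d (sval V)) (riso_inv f)).
have fK p v : riso_inv f p (f p v) = v by exact: riso_toK.
have Kf p v : f p (riso_inv f p v) = v by exact: riso_invK.
have dd p v : d p (d p v) = t *: v.
  change (f p (fpi_d (sval V) p (riso_inv f p (f p (fpi_d (sval V) p (riso_inv f p v))))) = t *: v).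
  by rewrite fK fpi_dd linearZ Kf.
have d_deep : deep (pi - c) d.
  by apply: deep_comp_l; apply: deep_comp_r; apply: (Fc_deep R_dvr t_unif c_itv).
have [J [X [D]]] := @psum_decomposes #|I| I x d dd d_deep (leqnn _).
have fd : rhom_eq (rcomp f (fpi_d (sval V))) (rcomp d f).
  move=> p v; change (f p (fpi_d (sval V) p v) = f p (fpi_d (sval V) p (riso_inv f p (f p v)))).
  by rewrite fK.
have gd : rhom_eq (rcomp (riso_inv f) d) (rcomp (fpi_d (sval V)) (riso_inv f)).
  move=> p v; exact: fK.
pose P := psum_obj dd d_deep.
pose f0 : @hom R Fc V P := @FpiHom _ _ _ (sval V) (sval P) f fd.
pose g0 : @hom R Fc P V := @FpiHom _ _ _ (sval P) (sval V) (riso_inv f) gd.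
have D' : dsum_data (fun k => Pair_of (X k)) V.
  by apply: (dsum_iso (f := g0) (g := f0)) D => p v; [exact: fK|exact: Kf].
exists #|J|, (fun k => X (enum_val k)); constructor.
exact: dsum_reindex (@enum_val_bij J) D'.
Qed.

End Decomposition.

(** * The equivalence *)

Lemma has_biproducts_quotient (A : comNzRingType) (C : lincat A) (J : lin_ideal C) :
  has_biproducts C -> has_biproducts (quotient_cat J).
Proof.
move=> [[Z Z0] bip]; split; first by exists Z; apply: qeq_heq.
move=> X Y; have [S [i [j [p [q [pi1 qj1 pj0 qi0 e1]]]]]] := bip X Y.
by exists S, i, j, p, q; split; apply: qeq_heq.
Qed.

Theorem corollary3p2p3 (RR : realType) (R : idomainType) (t : R)
    (R_dvr : is_dvr R) (t_unif : is_uniformizer t)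
    (K : fieldType) (q : {rmorphism R -> K}) (K_res : is_residue_field t q)
    (c : RR) (c_itv : 0 < c < pi) :
  equivalent (stable_Fc t c) (restrict_scalars q (Cc K c_itv)).
Proof.
pose Pair_of (X : cpair c) : stable_Fc t c := Pair R_dvr t_unif c_itv (admissible_of c_itv X).
pose b X Y (f : chom K X Y) : hom (Pair_of X) (Pair_of Y) := lift_chom R_dvr t_unif K_res c_itv f.
apply: (@hull_equivalent RR R K q c c_itv (stable_Fc t c) Pair_of b).
- exact: has_biproducts_quotient (Fc_has_biproducts t c).
- by move=> X Y f g e; rewrite /b /lift_chom e; apply: heq_refl.
- by move=> X Y f g h e; apply: lift_chomD.
- by move=> X Y a f h e; apply: lift_chomZ.
- by move=> X f e; apply: lift_chom1.
- by move=> X Y Z g f; apply: lift_chomM.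
- by move=> X Y g; have [f e] := lift_chom_full K_res g; exists f.
- by move=> X Y f; apply: lift_chom_faithful.
move=> V; have [n [X [D]]] := Fc_decomposes R_dvr t_unif c_itv V.
by exists n, X; constructor; apply: dsum_quotient.
Qed.
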